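(* Let $\mathcal V$ be a rigid monoidal category, and suppose that $H\colon\mathcal V\to\mathcal V$ is a Hopf monad that admits a Drinfeld double $D(H)$ and an anti-Drinfeld double $Q(H)$. The following statements are equivalent: (i) The monoidal unit $1\in\mathcal V$ lifts to a module over $Q(H)$, i.e. there is a $Q(H)$-module with underlying object $1$. (ii) The Drinfeld double $D(H)$ and the anti-Drinfeld double $Q(H)$ are isomorphic as comodule monads over $D(H)$. (iii) There is an isomorphism of monads $g\colon Q(H)\to D(H)$. Additionally, if $\mathcal V$ is pivotal with pivotal structure $\phi$, then any of the equivalent statements (i), (ii), (iii) holds if and only if $H$ and $\phi$ admit a pair in involution.
   Context: Monoidal categories are strict. Rigid: all objects have left duals $X^\vee$ (with $\mathrm{ev}^l_X\colon X^\vee\otimes X\to1$, $\mathrm{coev}^l_X\colon1\to X\otimes X^\vee$) and right duals. A pivotal structure is a monoidal natural isomorphism $\phi\colon\mathrm{Id}\to(-)^{\vee\vee}$. Bimonads, Hopf monads. A bimonad on $\mathcal V$ is a monad $(H,\mu,\eta)$ with an oplax monoidal structure $\Delta_{X,Y}\colon H(X\otimes Y)\to H(X)\otimes H(Y)$, $\varepsilon\colon H(1)\to1$ such that $\mu,\eta$ are oplax monoidal. Its category of modules $\mathcal V^H$ is monoidal via $(M,\vartheta_M)\otimes(N,\vartheta_N)=(M\otimes N,(\vartheta_M\otimes\vartheta_N)\Delta_{M,N})$. $H$ is a Hopf monad if $\mathcal V$ and $\mathcal V^H$ are rigid; left duals in $\mathcal V^H$ are chosen with underlying object the left dual in $\mathcal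 V$. The left antipode $s^l_X\colon H(H(X)^\vee)\to X^\vee$ is the unique natural transformation with $\vartheta_{M^\vee}=s^l_MH(\vartheta_M^\vee)$ for every $H$-module $M$. $F^H\dashv U^H$ is the free/forgetful adjunction, with counit $\epsilon$. Comodule monads. Let $B$ be a bimonad on $\mathcal V$; $\mathcal V$ is a right module over itself. A comodule monad over $B$ on $\mathcal V$ is a monad $(K,\mu^{(K)},\eta^{(K)})$ with a natural transformation $\delta_{M,X}\colon K(M\otimes X)\to K(M)\otimes B(X)$ such that $(\mathrm{id}\otimes\Delta_{X,Y})\delta_{M,X\otimes Y}=(\delta_{M,X}\otimes\mathrm{id})\delta_{M\otimes X,Y}$, $(\mathrm{id}\otimes\varepsilon)\delta_{M,1}=\mathrm{id}$, $\delta_{M,X}\mu^{(K)}_{M\otimes X}=(\mu^{(K)}_M\otimes\mu_X)\delta_{K(M),B(X)}K(\delta_{M,X})$ and $\delta_{M,X}\eta^{(K)}_{M\otimes X}=\eta^{(K)}_M\otimes\eta_X$. A morphism of comodule monads is a monad morphism $f$ with $\delta_{M,X}f_{M\otimes X}=(f_M\otimes\mathrm{id}_{B(X)})\delta_{M,X}$. $B$ is a comodule monad over itself via $\Delta$. Centralisers. In a rigid $\mathcal C$, an endofunctor $T$ is centralisable if for each $X$ there is a universal extranatural transformation $\zeta_{Y,X}\colon T(Y)^\vee\otimes X\otimes Y\to Z_T(X)$, i.e. $Z_T(X)=\int^YT(Y)^\vee\otimes X\otimes Y$ exists; its centraliser is $(Z_T,\chi)$, $\chi_{X,Y}=(\mathrm{id}_{T(Y)}\otimes\zeta_{Y,X})(\mathrm{coev}^l_{T(Y)}\otimes\mathrm{id}_{X\otimes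 Y})\colon X\otimes Y\to T(Y)\otimes Z_T(X)$. If $T$ is oplax monoidal, $Z_T$ is a monad with unit $(\varepsilon^{(T)}\otimes\mathrm{id})\chi_{X,1}$ and multiplication determined by $(\Delta^{(T)}_{Y,W}\otimes\mathrm{id})\chi_{X,Y\otimes W}=(\mathrm{id}\otimes\mu_X)(\mathrm{id}\otimes\chi_{Z_T(X),W})(\chi_{X,Y}\otimes\mathrm{id}_W)$. Doubles. ''$H$ admits a double and anti-double'' means that the endofunctors $H=U^HF^H$ and $U^H(F^H(-)^{\vee\vee})$ of $\mathcal V$ are centralisable, with centralisers $Z_H$, $Q_H$. Then $\mathrm{Id}_{\mathcal V^H}$ and $(-)^{\vee\vee}$ on $\mathcal V^H$ have centralisers $(Z,\chi)$ and $(Q,\xi)$ with $U^HZ=Z_HU^H$, $U^HQ=Q_HU^H$. $Z$ is a bimonad with $\Delta^{(Z)},\varepsilon^{(Z)}$ determined by $(\mathrm{id}_Y\otimes\Delta^{(Z)}_{X,W})\chi_{X\otimes W,Y}=(\chi_{X,Y}\otimes\mathrm{id}_{Z(W)})(\mathrm{id}_X\otimes\chi_{W,Y})$ and $(\mathrm{id}_Y\otimes\varepsilon^{(Z)})\chi_{1,Y}=\mathrm{id}_Y$; $Q$ is a comodule monad over $Z$ with coaction determined by $(\mathrm{id}_{Y^{\vee\vee}}\otimes\delta^{(Q)}_{X,W})\xi_{X\otimes W,Y}=(\xi_{X,Y}\otimes\mathrm{id}_{Z(W)})(\mathrm{id}_X\otimes\chi_{W,Y})$. For a monad $T$ on $\mathcal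 V^H$, $T\rtimes H=U^HTF^H$ with multiplication $U^H(\mu^{(T)}_{F^H})U^HT(\epsilon_{TF^H})$ and unit $U^H(\eta^{(T)}_{F^H})\eta$. Put $D(H)=Z\rtimes H$ (a bimonad, with comultiplication $U^H(\Delta^{(Z)}_{F^HX,F^HY})\,U^HZ(\Delta_{X,Y})$ and analogous counit) and $Q(H)=Q\rtimes H$ (a comodule monad over $D(H)$, with coaction $U^H(\delta^{(Q)}_{F^HX,F^HY})\,U^HQ(\Delta_{X,Y})$). Pairs in involution. A character is an $H$-module $\beta=(1,\vartheta_\beta)$. A group-like is a natural transformation $g\colon\mathrm{Id}_{\mathcal V}\to H$ with $\Delta_{X,Y}g_{X\otimes Y}=g_X\otimes g_Y$, $\varepsilon g_1=\mathrm{id}_1$; these form a group under $(gh)_X=\mu_Xg_{H(X)}h_X$. Put $\mathrm{Ad}_{g,X}=L_{g,X}R_{g^{-1},X}$ with $L_{g,X}=\mu_Xg_{H(X)}$, $R_{g,X}=\mu_XH(g_X)$, and $\mathrm{Ad}_{\beta,X}=(\vartheta_\beta\otimes\mathrm{id}_{H(X)}\otimes\vartheta_{\beta^\vee})\Delta_{1,X,1}$, where $\Delta_{X,Y,W}=(\Delta_{X,Y}\otimes\mathrm{id})\Delta_{X\otimes Y,W}$. The square of the antipode is $S^2_X=\phi^{-1}_{H(X)}s^l_{H(X)^\vee}H((s^l_X)^\vee)H(\phi_X)$. A pair in involution of $H$ and $\phi$ is a group-like $g$ and a character $\beta$ with $\mathrm{Ad}_{g,X}=\mathrm{Ad}_{\beta,X}S^2_X$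 for all $X\in\mathcal V$. *)

(* Defs.v *)
From mathcomp Require Import ssreflect ssrfun ssrbool.
From Stdlib Require Import ProofIrrelevance.

Set Implicit Arguments.
Unset Strict Implicit.
Unset Printing Implicit Defensive.

(* Categories are presented with a single carrier of (raw) arrows: [hom f X Y]
   means that f is an arrow from X to Y.  Composition and the tensor product of
   arrows are total functions whose values on ill-typed arguments are junk, and
   every law is restricted to well-typed arguments.  With this presentation
   strict associativity of the tensor product is Leibniz equality on objects
   and on arrows, and no transport along object equalities is ever needed.
   Elements of [Mor] that are in no [hom f X Y] are not arrows. *)
Record category := Category {
  Ob : Type;
  Mor : Type;
  dom : Mor -> Ob;
  cod : Mor -> Ob;
  hom : Mor -> Ob -> Ob -> Prop;
  idm : Ob -> Mor;
  compm : Mor -> Mor -> Mor;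
  hom_dom : forall f X Y, hom f X Y -> dom f = X;
  hom_cod : forall f X Y, hom f X Y -> cod f = Y;
  idm_hom : forall X, hom (idm X) X X;
  compm_hom : forall f g X Y Z,
    hom f X Y -> hom g Y Z -> hom (compm g f) X Z;
  compm_idl : forall f X Y, hom f X Y -> compm (idm Y) f = f;
  compm_idr : forall f X Y, hom f X Y -> compm f (idm X) = f;
  compmA : forall f g h X Y Z W, hom f X Y -> hom g Y Z -> hom h Z W ->
    compm h (compm g f) = compm (compm h g) f }.

Arguments hom {c} f X Y.
Arguments idm {c} X.
Arguments compm {c} g f.
Arguments dom {c} f.
Arguments cod {c} f.

Notation "g ∘ f" := (compm g f) (at level 50, left associativity).

Definition mutually_inverse (C : category) (f g : Mor C) (X Y : Ob C) : Prop :=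
  [/\ hom f X Y, hom g Y X, g ∘ f = idm X & f ∘ g = idm Y].

Record functor (C D : category) := Functor {
  fob :> Ob C -> Ob D;
  fmap : Mor C -> Mor D;
  fmap_hom : forall f X Y, hom f X Y -> hom (fmap f) (fob X) (fob Y);
  fmap_id : forall X, fmap (idm X) = idm (fob X);
  fmap_comp : forall f g X Y Z, hom f X Y -> hom g Y Z ->
    fmap (g ∘ f) = fmap g ∘ fmap f }.

Arguments fmap {C D} F f : rename.

Definition idF (C : category) : functor C C :=
  @Functor C C (fun X => X) (fun f => f)
    (fun _ _ _ h => h) (fun=> erefl) (fun _ _ _ _ _ _ _ => erefl).

Section CompFunctor.
Context (C D E : category) (G : functor D E) (F : functor C D).

Lemma compF_hom f X Y :
  hom f X Y -> hom (fmap G (fmap F f)) (G (F X)) (G (F Y)).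
Proof. by move=> h; do 2!apply: fmap_hom. Qed.

Lemma compF_id X : fmap G (fmap F (idm X)) = idm (G (F X)).
Proof. by rewrite !fmap_id. Qed.

Lemma compF_comp f g X Y Z : hom f X Y -> hom g Y Z ->
  fmap G (fmap F (g ∘ f)) = fmap G (fmap F g) ∘ fmap G (fmap F f).
Proof.
move=> hf hg; rewrite (fmap_comp F hf hg).
by rewrite (fmap_comp G (fmap_hom F hf) (fmap_hom F hg)).
Qed.

Definition compF : functor C E := Functor compF_hom compF_id compF_comp.

End CompFunctor.

Record natural (C D : category) (F G : functor C D) (a : Ob C -> Mor D) : Prop :=
  Natural {
    nat_hom : forall X, hom (a X) (F X) (G X);
    nat_sq : forall f X Y, hom f X Y -> fmap G f ∘ a X = a Y ∘ fmap F f }.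

Record monad (C : category) := Monad {
  mfun :> functor C C;
  mu : Ob C -> Mor C;
  eta : Ob C -> Mor C;
  mu_nat : natural (compF mfun mfun) mfun mu;
  eta_nat : natural (idF C) mfun eta;
  muA : forall X, mu X ∘ fmap mfun (mu X) = mu X ∘ mu (mfun X);
  mu_etal : forall X, mu X ∘ eta (mfun X) = idm (mfun X);
  mu_etar : forall X, mu X ∘ fmap mfun (eta X) = idm (mfun X) }.

Arguments mu {C} m X.
Arguments eta {C} m X.

Record monad_morphism (C : category) (K L : monad C) (f : Ob C -> Mor C) : Prop :=
  MonadMorphism {
    mm_nat : natural K L f;
    mm_mu : forall X, f X ∘ mu K X = mu L X ∘ (f (L X) ∘ fmap K (f X));
    mm_eta : forall X, f X ∘ eta K X = eta L X }.

Definition monads_iso (C : category) (K L : monad C) : Prop :=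
  exists f g : Ob C -> Mor C,
    [/\ monad_morphism K L f, monad_morphism L K g &
        forall X, mutually_inverse (f X) (g X) (K X) (L X)].

Record module (C : category) (T : monad C) := Module {
  carrier : Ob C;
  act : Mor C;
  act_hom : hom act (T carrier) carrier;
  act_mu : act ∘ fmap T act = act ∘ mu T carrier;
  act_eta : act ∘ eta T carrier = idm carrier }.

Lemma module_eq (C : category) (T : monad C) (M N : module T) :
  carrier M = carrier N -> act M = act N -> M = N.
Proof.
case: M N => [X a h1 h2 h3] [Y b h1' h2' h3'] /= eXY eab.
case: _ / eXY in h1' h2' h3' *; case: _ / eab in h1' h2' h3' *.
by rewrite (proof_irrelevance _ h1 h1') (proof_irrelevance _ h2 h2')
           (proof_irrelevance _ h3 h3').
Qed.

Section EilenbergMoore.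
Context (C : category) (T : monad C).

Record em_mor := EmMor { em_dom : module T; em_cod : module T; em_arr : Mor C }.

Definition em_hom (f : em_mor) (M N : module T) : Prop :=
  [/\ em_dom f = M, em_cod f = N, hom (em_arr f) (carrier M) (carrier N) &
      em_arr f ∘ act M = act N ∘ fmap T (em_arr f)].

Definition em_id (M : module T) : em_mor := EmMor M M (idm (carrier M)).

Definition em_comp (g f : em_mor) : em_mor :=
  EmMor (em_dom f) (em_cod g) (em_arr g ∘ em_arr f).

Lemma em_hom_dom f M N : em_hom f M N -> em_dom f = M.
Proof. by case. Qed.

Lemma em_hom_cod f M N : em_hom f M N -> em_cod f = N.
Proof. by case. Qed.

Lemma em_id_hom M : em_hom (em_id M) M M.
Proof.
split => //=; first exact: idm_hom.
by rewrite fmap_id (compm_idl (act_hom M)) (compm_idr (act_hom M)).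
Qed.

Lemma em_comp_hom f g M N P :
  em_hom f M N -> em_hom g N P -> em_hom (em_comp g f) M P.
Proof.
move=> [df cf hf lf] [dg cg hg lg]; split => //=; first exact: compm_hom hf hg.
rewrite -(compmA (act_hom M) hf hg) lf.
rewrite (compmA (fmap_hom T hf) (act_hom N) hg) lg.
by rewrite -(compmA (fmap_hom T hf) (fmap_hom T hg) (act_hom P))
           (fmap_comp T hf hg).
Qed.

Lemma em_comp_idl f M N : em_hom f M N -> em_comp (em_id N) f = f.
Proof.
case: f => [M' N' f] [/= -> -> hf _].
by rewrite /em_comp /= (compm_idl hf).
Qed.

Lemma em_comp_idr f M N : em_hom f M N -> em_comp f (em_id M) = f.
Proof.
case: f => [M' N' f] [/= -> -> hf _].
by rewrite /em_comp /= (compm_idr hf).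
Qed.

Lemma em_compA f g h M N P Q : em_hom f M N -> em_hom g N P -> em_hom h P Q ->
  em_comp h (em_comp g f) = em_comp (em_comp h g) f.
Proof.
by move=> [_ _ hf _] [_ _ hg _] [_ _ hh _]; rewrite /em_comp /= (compmA hf hg hh).
Qed.

Definition EM : category :=
  @Category (module T) em_mor em_dom em_cod em_hom em_id em_comp
    em_hom_dom em_hom_cod em_id_hom em_comp_hom em_comp_idl em_comp_idr em_compA.

Lemma forgetF_hom (f : Mor EM) (M N : Ob EM) :
  hom f M N -> hom (em_arr f) (carrier M) (carrier N).
Proof. by case. Qed.

Definition forgetF : functor EM C :=
  @Functor EM C (@carrier C T) em_arr forgetF_hom
    (fun=> erefl) (fun _ _ _ _ _ _ _ => erefl).

Definition free_module (X : Ob C) : module T :=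
  @Module C T (T X) (mu T X) (nat_hom (mu_nat T) X) (muA T X) (mu_etal T X).

Definition free_mor (f : Mor C) : Mor EM :=
  EmMor (free_module (dom f)) (free_module (cod f)) (fmap T f).

Lemma freeF_hom f X Y :
  hom f X Y -> @hom EM (free_mor f) (free_module X) (free_module Y).
Proof.
move=> hf; split => /=.
- by rewrite (hom_dom hf).
- by rewrite (hom_cod hf).
- exact: fmap_hom.
- exact: (nat_sq (mu_nat T) hf).
Qed.

Lemma freeF_id X : free_mor (idm X) = @idm EM (free_module X).
Proof.
by rewrite /free_mor (hom_dom (idm_hom X)) (hom_cod (idm_hom X)) fmap_id.
Qed.

Lemma freeF_comp f g X Y Z : hom f X Y -> hom g Y Z ->
  free_mor (g ∘ f) = @compm EM (free_mor g) (free_mor f).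
Proof.
move=> hf hg; have hgf := compm_hom hf hg.
rewrite /free_mor (hom_dom hgf) (hom_cod hgf) (fmap_comp T hf hg) /=.
by rewrite /em_comp /= (hom_dom hf) (hom_cod hg).
Qed.

Definition freeF : functor C EM := Functor freeF_hom freeF_id freeF_comp.

Definition free_counit (M : Ob EM) : Mor EM := EmMor (freeF (carrier M)) M (act M).

End EilenbergMoore.

Record monoidal_category := MonoidalCategory {
  mcat :> category;
  one : Ob mcat;
  tob : Ob mcat -> Ob mcat -> Ob mcat;
  tmor : Mor mcat -> Mor mcat -> Mor mcat;
  tobA : forall X Y Z, tob X (tob Y Z) = tob (tob X Y) Z;
  tob1l : forall X, tob one X = X;
  tob1r : forall X, tob X one = X;
  tmor_hom : forall f g X Y X' Y', hom f X Y -> hom g X' Y' ->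
    hom (tmor f g) (tob X X') (tob Y Y');
  tmor_id : forall X Y, tmor (idm X) (idm Y) = idm (tob X Y);
  tmor_comp : forall f g f' g' X Y Z X' Y' Z',
    hom f X Y -> hom g Y Z -> hom f' X' Y' -> hom g' Y' Z' ->
    tmor (g ∘ f) (g' ∘ f') = tmor g g' ∘ tmor f f';
  tmorA : forall f g h X Y X' Y' X'' Y'',
    hom f X Y -> hom g X' Y' -> hom h X'' Y'' ->
    tmor f (tmor g h) = tmor (tmor f g) h;
  tmor1l : forall f X Y, hom f X Y -> tmor (idm one) f = f;
  tmor1r : forall f X Y, hom f X Y -> tmor f (idm one) = f }.

Arguments one {m}.
Arguments tob {m} X Y.
Arguments tmor {m} f g.

Notation "X ⊗ Y" := (tob X Y) (at level 40, left associativity).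
Notation "f ⊠ g" := (tmor f g) (at level 40, left associativity).

Lemma compm_hom_eq (C : category) (f g : Mor C) X Y Y' Z :
  hom f X Y -> hom g Y' Z -> Y = Y' -> hom (g ∘ f) X Z.
Proof. by move=> hf hg e; apply: compm_hom hf _; rewrite e. Qed.

Lemma hom_eq (C : category) (f : Mor C) X Y X' Y' :
  hom f X Y -> X = X' -> Y = Y' -> hom f X' Y'.
Proof. by move=> h <- <-. Qed.

Create HintDb homdb.

(* [homs] proves [hom f X Y] up to strictness of the tensor product of objects. *)
Ltac obeq := first [reflexivity | by rewrite /= ?(tobA, tob1l, tob1r)].
Ltac synth :=
  lazymatch goal with
  | |- hom (compm _ _) _ _ => eapply compm_hom_eq; [synth | synth | obeq]
  | |- hom (tmor _ _) _ _ => eapply tmor_hom; [synth | synth]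
  | |- hom (idm _) _ _ => eapply idm_hom
  | |- hom (fmap _ _) _ _ => eapply fmap_hom; synth
  | |- _ => first [eassumption | solve [eauto with homdb nocore]]
  end.
Ltac homs := by eapply hom_eq; [synth | obeq | obeq].

Record oplax (C : monoidal_category) (F : functor C C)
    (Delta : Ob C -> Ob C -> Mor C) (eps : Mor C) : Prop := Oplax {
  Delta_hom : forall X Y, hom (Delta X Y) (F (X ⊗ Y)) (F X ⊗ F Y);
  Delta_nat : forall f g X Y X' Y', hom f X Y -> hom g X' Y' ->
    (fmap F f ⊠ fmap F g) ∘ Delta X X' = Delta Y Y' ∘ fmap F (f ⊠ g);
  eps_hom : hom eps (F one) one;
  DeltaA : forall X Y W,
    (Delta X Y ⊠ idm (F W)) ∘ Delta (X ⊗ Y) W =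
    (idm (F X) ⊠ Delta Y W) ∘ Delta X (Y ⊗ W);
  Delta_epsl : forall X, (eps ⊠ idm (F X)) ∘ Delta one X = idm (F X);
  Delta_epsr : forall X, (idm (F X) ⊠ eps) ∘ Delta X one = idm (F X) }.

Record bimonad (C : monoidal_category) := Bimonad {
  bmon :> monad C;
  Delta : Ob C -> Ob C -> Mor C;
  eps : Mor C;
  bm_oplax : oplax bmon Delta eps;
  Delta_mu : forall X Y, Delta X Y ∘ mu bmon (X ⊗ Y) =
    (mu bmon X ⊠ mu bmon Y) ∘ (Delta (bmon X) (bmon Y) ∘ fmap bmon (Delta X Y));
  Delta_eta : forall X Y,
    Delta X Y ∘ eta bmon (X ⊗ Y) = eta bmon X ⊠ eta bmon Y;
  eps_mu : eps ∘ mu bmon one = eps ∘ fmap bmon eps;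
  eps_eta : eps ∘ eta bmon one = idm one }.

Arguments Delta {C} b X Y.
Arguments eps {C} b.

Lemma mu_hom (C : category) (T : monad C) X : hom (mu T X) (T (T X)) (T X).
Proof. exact: (nat_hom (mu_nat T) X). Qed.
Lemma eta_hom (C : category) (T : monad C) X : hom (eta T X) X (T X).
Proof. exact: (nat_hom (eta_nat T) X). Qed.
Lemma bDelta_hom (C : monoidal_category) (H : bimonad C) X Y :
  hom (Delta H X Y) (H (X ⊗ Y)) (H X ⊗ H Y).
Proof. exact: (Delta_hom (bm_oplax H)). Qed.
Lemma beps_hom (C : monoidal_category) (H : bimonad C) : hom (eps H) (H one) one.
Proof. exact: (eps_hom (bm_oplax H)). Qed.

#[export] Hint Resolve mu_hom eta_hom bDelta_hom beps_hom act_hom : homdb.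

Section ModulesMonoidal.
Context (C : monoidal_category) (H : bimonad C).
Implicit Types M N P : module H.

Lemma mod_tens_hom M N : hom ((act M ⊠ act N) ∘ Delta H (carrier M) (carrier N))
  (H (carrier M ⊗ carrier N)) (carrier M ⊗ carrier N).
Proof. homs. Qed.

Lemma mod_tens_mu M N :
  let a := (act M ⊠ act N) ∘ Delta H (carrier M) (carrier N) in
  a ∘ fmap H a = a ∘ mu H (carrier M ⊗ carrier N).
Proof.
move=> /=; set X := carrier M; set Y := carrier N.
have hD : hom (Delta H X Y) (H (X ⊗ Y)) (H X ⊗ H Y) by homs.
have hT : hom (act M ⊠ act N) (H X ⊗ H Y) (X ⊗ Y) by homs.
rewrite (fmap_comp H hD hT).
rewrite -(compmA (mu_hom H _) hD hT) Delta_mu.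
have hDD : hom (Delta H (H X) (H Y)) (H (H X ⊗ H Y)) (H (H X) ⊗ H (H Y)) by homs.
have hHD := fmap_hom H hD.
have hHT := fmap_hom H hT.
have hM : hom (mu H X ⊠ mu H Y) (H (H X) ⊗ H (H Y)) (H X ⊗ H Y) by homs.
rewrite (compmA (compm_hom hHD hDD) hM hT).
rewrite -(tmor_comp (mu_hom H X) (act_hom M) (mu_hom H Y) (act_hom N)).
rewrite -!act_mu.
rewrite (tmor_comp (fmap_hom H (act_hom M)) (act_hom M)
                   (fmap_hom H (act_hom N)) (act_hom N)).
have hTT : hom (fmap H (act M) ⊠ fmap H (act N)) (H (H X) ⊗ H (H Y)) (H X ⊗ H Y)
  by homs.
rewrite -(compmA (compm_hom hHD hDD) hTT hT) (compmA hHD hDD hTT).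
rewrite (Delta_nat (bm_oplax H) (act_hom M) (act_hom N)).
by rewrite -(compmA hHD hHT hD) (compmA (compm_hom hHD hHT) hD hT).
Qed.

Lemma mod_tens_eta M N :
  ((act M ⊠ act N) ∘ Delta H (carrier M) (carrier N)) ∘
     eta H (carrier M ⊗ carrier N) = idm (carrier M ⊗ carrier N).
Proof.
rewrite -(compmA (eta_hom H _) (bDelta_hom H _ _)
                 (tmor_hom (act_hom M) (act_hom N))) Delta_eta.
rewrite -(tmor_comp (eta_hom H _) (act_hom M) (eta_hom H _) (act_hom N)).
by rewrite !act_eta tmor_id.
Qed.

Definition mod_tens M N : module H :=
  Module (mod_tens_hom M N) (mod_tens_mu M N) (mod_tens_eta M N).

Definition mod_one : module H :=
  @Module C H one (eps H) (beps_hom H) (esym (eps_mu H)) (eps_eta H).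

Definition mod_tmor (f g : Mor (EM H)) : Mor (EM H) :=
  EmMor (mod_tens (em_dom f) (em_dom g)) (mod_tens (em_cod f) (em_cod g))
        (em_arr f ⊠ em_arr g).

Lemma mod_tensA M N P : mod_tens M (mod_tens N P) = mod_tens (mod_tens M N) P.
Proof.
apply: module_eq => /=; first exact: tobA.
set X := carrier M; set Y := carrier N; set Z := carrier P.
have hM : hom (act M) (H X) X by homs.
have hN : hom (act N) (H Y) Y by homs.
have hP : hom (act P) (H Z) Z by homs.
have hDN : hom (Delta H Y Z) (H (Y ⊗ Z)) (H Y ⊗ H Z) by homs.
have hDM : hom (Delta H X Y) (H (X ⊗ Y)) (H X ⊗ H Y) by homs.
rewrite -{1}(compm_idr hM) -{2}(compm_idr hP).
rewrite (tmor_comp (idm_hom _) hM hDN (tmor_hom hN hP)).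
rewrite (tmor_comp hDM (tmor_hom hM hN) (idm_hom _) hP).
rewrite (tmorA hM hN hP).
have h1 : hom (idm (H X) ⊠ Delta H Y Z) (H X ⊗ H (Y ⊗ Z)) (H X ⊗ H Y ⊗ H Z)
  by homs.
have h2 : hom (Delta H X Y ⊠ idm (H Z)) (H (X ⊗ Y) ⊗ H Z) (H X ⊗ H Y ⊗ H Z)
  by homs.
have hT : hom (act M ⊠ act N ⊠ act P) (H X ⊗ H Y ⊗ H Z) (X ⊗ Y ⊗ Z) by homs.
rewrite -(compmA (bDelta_hom H _ _) h1 hT) -(compmA (bDelta_hom H _ _) h2 hT).
by rewrite (DeltaA (bm_oplax H)).
Qed.

Lemma mod_tens1l M : mod_tens mod_one M = M.
Proof.
apply: module_eq => /=; first exact: tob1l.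
set X := carrier M.
have hM : hom (act M) (H X) X by homs.
rewrite -(compm_idl (beps_hom H)) -{1}(compm_idr hM).
rewrite (tmor_comp (beps_hom H) (idm_hom one) (idm_hom (H X)) hM) (tmor1l hM).
have h1 : hom (eps H ⊠ idm (H X)) (H one ⊗ H X) (H X) by homs.
rewrite -(compmA (bDelta_hom H _ _) h1 hM) (Delta_epsl (bm_oplax H)).
exact: compm_idr hM.
Qed.

Lemma mod_tens1r M : mod_tens M mod_one = M.
Proof.
apply: module_eq => /=; first exact: tob1r.
set X := carrier M.
have hM : hom (act M) (H X) X by homs.
rewrite -(compm_idl (beps_hom H)) -{1}(compm_idr hM).
rewrite (tmor_comp (idm_hom (H X)) hM (beps_hom H) (idm_hom one)) (tmor1r hM).
have h1 : hom (idm (H X) ⊠ eps H) (H X ⊗ H one) (H X) by homs.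
rewrite -(compmA (bDelta_hom H _ _) h1 hM) (Delta_epsr (bm_oplax H)).
exact: compm_idr hM.
Qed.

Lemma mod_tmor_hom (f g : Mor (EM H)) (M N M' N' : Ob (EM H)) :
  hom f M N -> hom g M' N' -> hom (mod_tmor f g) (mod_tens M M') (mod_tens N N').
Proof.
case: f g => [? ? f] [? ? g] [/= -> -> hf lf] [/= -> -> hg lg].
split => //=; first exact: tmor_hom.
have hD X Y := bDelta_hom H X Y.
rewrite (compmA (hD _ _) (tmor_hom (act_hom M) (act_hom M')) (tmor_hom hf hg)).
rewrite -(tmor_comp (act_hom M) hf (act_hom M') hg) lf lg.
rewrite (tmor_comp (fmap_hom H hf) (act_hom N) (fmap_hom H hg) (act_hom N')).
rewrite -(compmA (hD _ _) (tmor_hom (fmap_hom H hf) (fmap_hom H hg))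
                 (tmor_hom (act_hom N) (act_hom N'))).
rewrite (Delta_nat (bm_oplax H) hf hg).
by rewrite (compmA (fmap_hom H (tmor_hom hf hg)) (hD _ _)
                   (tmor_hom (act_hom N) (act_hom N'))).
Qed.

Lemma mod_tmor_id (M N : Ob (EM H)) :
  mod_tmor (idm M) (idm N) = @idm (EM H) (mod_tens M N).
Proof. by rewrite /mod_tmor /= tmor_id. Qed.

Lemma mod_tmor_comp (f g f' g' : Mor (EM H)) (M N P M' N' P' : Ob (EM H)) :
  hom f M N -> hom g N P -> hom f' M' N' -> hom g' N' P' ->
  mod_tmor (g ∘ f) (g' ∘ f') = mod_tmor g g' ∘ mod_tmor f f'.
Proof.
move=> [_ _ hf _] [_ _ hg _] [_ _ hf' _] [_ _ hg' _].
by rewrite /mod_tmor /= /em_comp /= (tmor_comp hf hg hf' hg').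
Qed.

Lemma mod_tmorA (f g h : Mor (EM H)) (M N M' N' M'' N'' : Ob (EM H)) :
  hom f M N -> hom g M' N' -> hom h M'' N'' ->
  mod_tmor f (mod_tmor g h) = mod_tmor (mod_tmor f g) h.
Proof.
move=> [_ _ hf _] [_ _ hg _] [_ _ hh _].
by rewrite /mod_tmor /= (tmorA hf hg hh) !mod_tensA.
Qed.

Lemma mod_tmor1l (f : Mor (EM H)) (M N : Ob (EM H)) :
  hom f M N -> mod_tmor (@idm (EM H) mod_one) f = f.
Proof.
case: f => [? ? f] [/= -> -> hf _].
by rewrite /mod_tmor /= (tmor1l hf) !mod_tens1l.
Qed.

Lemma mod_tmor1r (f : Mor (EM H)) (M N : Ob (EM H)) :
  hom f M N -> mod_tmor f (@idm (EM H) mod_one) = f.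
Proof.
case: f => [? ? f] [/= -> -> hf _].
by rewrite /mod_tmor /= (tmor1r hf) !mod_tens1r.
Qed.

Definition EMmon : monoidal_category :=
  @MonoidalCategory (EM H) mod_one mod_tens mod_tmor
    mod_tensA mod_tens1l mod_tens1r mod_tmor_hom mod_tmor_id mod_tmor_comp
    mod_tmorA mod_tmor1l mod_tmor1r.

End ModulesMonoidal.

Record left_duals (C : monoidal_category) := LeftDuals {
  ld : Ob C -> Ob C;
  ev : Ob C -> Mor C;
  coev : Ob C -> Mor C;
  ev_hom : forall X, hom (ev X) (ld X ⊗ X) one;
  coev_hom : forall X, hom (coev X) one (X ⊗ ld X);
  ld_snake : forall X, (idm X ⊠ ev X) ∘ (coev X ⊠ idm X) = idm X;
  ld_snake' : forall X,
    (ev X ⊠ idm (ld X)) ∘ (idm (ld X) ⊠ coev X) = idm (ld X) }.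

Arguments ld {C} l X.
Arguments ev {C} l X.
Arguments coev {C} l X.

Definition has_right_duals (C : monoidal_category) : Prop :=
  forall X : Ob C, exists (Y : Ob C) (e c : Mor C),
    [/\ hom e (X ⊗ Y) one, hom c one (Y ⊗ X),
        (e ⊠ idm X) ∘ (idm X ⊠ c) = idm X &
        (idm Y ⊠ e) ∘ (c ⊠ idm Y) = idm Y].

Record rigid_category := RigidCategory {
  rcat :> monoidal_category;
  rld : left_duals rcat;
  rright : has_right_duals rcat }.

Arguments rld : clear implicits.

#[export] Hint Resolve ev_hom coev_hom : homdb.

Section Duals.
Context (C : rigid_category).
Local Notation "X ^v" := (ld (rld C) X) (at level 30, format "X ^v").
Local Notation ev := (ev (rld C)).
Local Notation coev := (coev (rld C)).

(* The dual of f : X -> Y is the arrow Y^v -> X^v. *)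
Definition dual (f : Mor C) : Mor C :=
  (ev (cod f) ⊠ idm ((dom f)^v)) ∘
  ((idm ((cod f)^v) ⊠ f ⊠ idm ((dom f)^v)) ∘
   (idm ((cod f)^v) ⊠ coev (dom f))).

Lemma dualE f X Y : hom f X Y -> dual f =
  (ev Y ⊠ idm (X^v)) ∘ ((idm (Y^v) ⊠ f ⊠ idm (X^v)) ∘ (idm (Y^v) ⊠ coev X)).
Proof. by move=> hf; rewrite /dual (hom_dom hf) (hom_cod hf). Qed.

Lemma dual_hom f X Y : hom f X Y -> hom (dual f) (Y^v) (X^v).
Proof. by move=> hf; rewrite (dualE hf); homs. Qed.

Lemma dual_ev f X Y : hom f X Y ->
  ev X ∘ (dual f ⊠ idm X) = ev Y ∘ (idm (Y^v) ⊠ f).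
Proof.
move=> hf; rewrite (dualE hf).
rewrite -{1}(compm_idl (idm_hom X)) -{2}(compm_idl (idm_hom X)).
have h1 : hom (idm (Y^v) ⊠ coev X) (Y^v) (Y^v ⊗ X ⊗ X^v) by homs.
have h2 : hom (idm (Y^v) ⊠ f ⊠ idm (X^v)) (Y^v ⊗ X ⊗ X^v) (Y^v ⊗ Y ⊗ X^v) by homs.
have h3 : hom (ev Y ⊠ idm (X^v)) (Y^v ⊗ Y ⊗ X^v) (X^v) by homs.
rewrite (tmor_comp (compm_hom h1 h2) h3 (compm_hom (idm_hom X) (idm_hom X))
                   (idm_hom X)).
rewrite (tmor_comp h1 h2 (idm_hom X) (idm_hom X)).
rewrite -(tmorA (ev_hom _ Y) (idm_hom (X^v)) (idm_hom X)) tmor_id.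
rewrite -(tmorA (tmor_hom (idm_hom (Y^v)) hf) (idm_hom (X^v)) (idm_hom X)) tmor_id.
rewrite -(tmorA (idm_hom (Y^v)) (coev_hom _ X) (idm_hom X)).
set a := idm (Y^v) ⊠ (coev X ⊠ idm X).
have ha : hom a (Y^v ⊗ X) (Y^v ⊗ X ⊗ (X^v ⊗ X)) by rewrite /a; homs.
set b := idm (Y^v) ⊠ f ⊠ _.
have hb : hom b (Y^v ⊗ X ⊗ (X^v ⊗ X)) (Y^v ⊗ Y ⊗ (X^v ⊗ X)) by rewrite /b; homs.
have hc : hom (ev Y ⊠ idm (X^v ⊗ X)) (Y^v ⊗ Y ⊗ (X^v ⊗ X)) (X^v ⊗ X) by homs.
rewrite (compmA (compm_hom ha hb) hc (ev_hom _ X)).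
have -> : ev X ∘ (ev Y ⊠ idm (X^v ⊗ X)) = ev Y ∘ (idm (Y^v ⊗ Y) ⊠ ev X).
  rewrite -{1}(tmor1l (ev_hom _ X)).
  rewrite -(tmor_comp (ev_hom _ Y) (idm_hom one) (idm_hom (X^v ⊗ X)) (ev_hom _ X)).
  rewrite (compm_idl (ev_hom _ Y)) (compm_idr (ev_hom _ X)).
  rewrite -{2}(tmor1r (ev_hom _ Y)).
  rewrite -(tmor_comp (idm_hom (Y^v ⊗ Y)) (ev_hom _ Y) (ev_hom _ X) (idm_hom one)).
  by rewrite (compm_idr (ev_hom _ Y)) (compm_idl (ev_hom _ X)).
have hd : hom (idm (Y^v ⊗ Y) ⊠ ev X) (Y^v ⊗ Y ⊗ (X^v ⊗ X)) (Y^v ⊗ Y) by homs.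
rewrite (compmA ha hb (compm_hom hd (ev_hom _ Y))).
rewrite -(compmA hb hd (ev_hom _ Y)) /b.
have hf' : hom (idm (Y^v) ⊠ f) (Y^v ⊗ X) (Y^v ⊗ Y) by homs.
rewrite -(tmor_comp hf' (idm_hom _) (idm_hom _) (ev_hom _ X)).
rewrite (compm_idl hf') (compm_idr (ev_hom _ X)).
have -> : idm (Y^v) ⊠ f ⊠ ev X = (idm (Y^v) ⊠ f) ∘ (idm (Y^v ⊗ X) ⊠ ev X).
  rewrite -{2}(tmor1r hf').
  rewrite -(tmor_comp (idm_hom _) hf' (ev_hom _ X) (idm_hom one)).
  by rewrite (compm_idr hf') (compm_idl (ev_hom _ X)).
have he : hom (idm (Y^v ⊗ X) ⊠ ev X) (Y^v ⊗ X ⊗ (X^v ⊗ X)) (Y^v ⊗ X) by homs.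
rewrite -(compmA ha (compm_hom he hf') (ev_hom _ Y)) -(compmA ha he hf') /a.
rewrite -tmor_id -(tmorA (idm_hom (Y^v)) (idm_hom X) (ev_hom _ X)).
have h4 : hom (coev X ⊠ idm X) X (X ⊗ (X^v ⊗ X)) by homs.
have h5 : hom (idm X ⊠ ev X) (X ⊗ (X^v ⊗ X)) X by homs.
rewrite -(tmor_comp (idm_hom (Y^v)) (idm_hom _) h4 h5) ld_snake.
rewrite (compm_idl (idm_hom _)) tmor_id.
by rewrite (compm_idr hf').
Qed.

Lemma ld_uniq u v A X : hom u A (X^v) -> hom v A (X^v) ->
  ev X ∘ (u ⊠ idm X) = ev X ∘ (v ⊠ idm X) -> u = v.
Proof.
suff key w : hom w A (X^v) ->
    w = ((ev X ∘ (w ⊠ idm X)) ⊠ idm (X^v)) ∘ (idm A ⊠ coev X).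
  by move=> hu hv e; rewrite (key u hu) (key v hv) e.
move=> hw.
rewrite -{1}(compm_idl (idm_hom (X^v))).
rewrite (tmor_comp (tmor_hom hw (idm_hom X)) (ev_hom _ X)
                   (idm_hom (X^v)) (idm_hom (X^v))).
rewrite -(tmorA hw (idm_hom X) (idm_hom (X^v))) tmor_id.
have h1 : hom (idm A ⊠ coev X) A (A ⊗ (X ⊗ X^v)) by homs.
have h2 : hom (w ⊠ idm (X ⊗ X^v)) (A ⊗ (X ⊗ X^v)) (X^v ⊗ X ⊗ X^v) by homs.
have h3 : hom (ev X ⊠ idm (X^v)) (X^v ⊗ X ⊗ X^v) (X^v) by homs.
rewrite -(compmA h1 h2 h3).
rewrite -(tmor_comp (idm_hom A) hw (coev_hom _ X) (idm_hom _)).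
rewrite (compm_idr hw) (compm_idl (coev_hom _ X)).
have -> : w ⊠ coev X = (idm (X^v) ⊠ coev X) ∘ w.
  rewrite -{2}(tmor1r hw).
  rewrite -(tmor_comp hw (idm_hom _) (idm_hom one) (coev_hom _ X)).
  by rewrite (compm_idl hw) (compm_idr (coev_hom _ X)).
have h4 : hom (idm (X^v) ⊠ coev X) (X^v) (X^v ⊗ X ⊗ X^v) by homs.
by rewrite (compmA hw h4 h3) ld_snake' (compm_idl hw).
Qed.

Lemma dual_id X : dual (idm X) = idm (X^v).
Proof.
apply: (ld_uniq (dual_hom (idm_hom X)) (idm_hom _)).
by rewrite (dual_ev (idm_hom X)) tmor_id.
Qed.

Lemma dual_comp f g X Y Z : hom f X Y -> hom g Y Z ->
  dual (g ∘ f) = dual f ∘ dual g.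
Proof.
move=> hf hg; have hgf := compm_hom hf hg.
have df := dual_hom hf; have dg := dual_hom hg.
apply: (ld_uniq (dual_hom hgf) (compm_hom dg df)).
rewrite (dual_ev hgf).
rewrite -{1}(compm_idl (idm_hom (Z^v))) -{1}(compm_idl (idm_hom X)).
rewrite (tmor_comp (idm_hom _) (idm_hom _) hf hg).
rewrite (tmor_comp dg df (idm_hom X) (idm_hom X)).
rewrite (compmA (tmor_hom (idm_hom _) hf) (tmor_hom (idm_hom _) hg) (ev_hom _ Z)).
rewrite (compmA (tmor_hom dg (idm_hom X)) (tmor_hom df (idm_hom X)) (ev_hom _ X)).
rewrite (dual_ev hf) -(dual_ev hg).
rewrite -(compmA (tmor_hom (idm_hom _) hf) (tmor_hom dg (idm_hom Y)) (ev_hom _ Y)).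
rewrite -(compmA (tmor_hom dg (idm_hom X)) (tmor_hom (idm_hom _) hf) (ev_hom _ Y)).
rewrite -(tmor_comp (idm_hom _) dg hf (idm_hom Y)).
rewrite -(tmor_comp dg (idm_hom _) (idm_hom X) hf).
by rewrite (compm_idr dg) (compm_idl dg) (compm_idl hf) (compm_idr hf).
Qed.

Lemma ddual_hom f X Y : hom f X Y -> hom (dual (dual f)) (X^v^v) (Y^v^v).
Proof. by move=> hf; do 2!apply: dual_hom. Qed.

Lemma ddual_id X : dual (dual (idm X)) = idm (X^v^v).
Proof. by rewrite !dual_id. Qed.

Lemma ddual_comp f g X Y Z : hom f X Y -> hom g Y Z ->
  dual (dual (g ∘ f)) = dual (dual g) ∘ dual (dual f).
Proof.
move=> hf hg; rewrite (dual_comp hf hg).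
exact: (dual_comp (dual_hom hg) (dual_hom hf)).
Qed.

Definition ddual : functor C C := Functor ddual_hom ddual_id ddual_comp.

(* The canonical mutually inverse isomorphisms between Y^v ⊗ X^v and (X ⊗ Y)^v. *)
Definition ld_tens (X Y : Ob C) : Mor C :=
  ((ev Y ∘ (idm (Y^v) ⊠ ev X ⊠ idm Y)) ⊠ idm ((X ⊗ Y)^v)) ∘
  (idm (Y^v ⊗ X^v) ⊠ coev (X ⊗ Y)).

Definition ld_tens_inv (X Y : Ob C) : Mor C :=
  (ev (X ⊗ Y) ⊠ idm (Y^v ⊗ X^v)) ∘
  (idm ((X ⊗ Y)^v) ⊠ ((idm X ⊠ coev Y ⊠ idm (X^v)) ∘ coev X)).

(* The (strong, in particular oplax) monoidal structure of the double dual
   functor: (X ⊗ Y)^vv -> X^vv ⊗ Y^vv and 1^vv -> 1. *)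
Definition ddual_Delta (X Y : Ob C) : Mor C :=
  ld_tens_inv (Y^v) (X^v) ∘ dual (ld_tens X Y).

Definition ddual_eps : Mor C := ev one ∘ dual (coev one).

Lemma ld_tens_hom X Y : hom (ld_tens X Y) (Y^v ⊗ X^v) ((X ⊗ Y)^v).
Proof. by rewrite /ld_tens; homs. Qed.

Lemma ld_tens_inv_hom X Y : hom (ld_tens_inv X Y) ((X ⊗ Y)^v) (Y^v ⊗ X^v).
Proof. by rewrite /ld_tens_inv; homs. Qed.

Lemma ddual_Delta_hom X Y :
  hom (ddual_Delta X Y) ((X ⊗ Y)^v^v) (X^v^v ⊗ Y^v^v).
Proof. exact: compm_hom (dual_hom (ld_tens_hom X Y)) (ld_tens_inv_hom _ _). Qed.

Lemma ddual_eps_hom : hom ddual_eps (one^v^v) one.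
Proof.
have h : hom (dual (coev one)) ((one ⊗ one^v)^v) (one^v).
  exact: dual_hom (coev_hom _ one).
by rewrite tob1l in h; rewrite /ddual_eps; homs.
Qed.

Record pivotal := Pivotal {
  piv : Ob C -> Mor C;
  piv_inv : Ob C -> Mor C;
  piv_nat : natural (idF C) ddual piv;
  pivK : forall X, mutually_inverse (piv X) (piv_inv X) X (ddual X);
  piv_tens : forall X Y, ddual_Delta X Y ∘ piv (X ⊗ Y) = piv X ⊠ piv Y;
  piv_one : ddual_eps ∘ piv one = idm one }.

Definition extranatural (T : functor C C) (X P : Ob C) (z : Ob C -> Mor C) : Prop :=
  (forall Y, hom (z Y) ((T Y)^v ⊗ X ⊗ Y) P) /\
  (forall f Y Y', hom f Y Y' ->
     z Y ∘ (dual (fmap T f) ⊠ idm X ⊠ idm Y) =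
     z Y' ∘ (idm ((T Y')^v) ⊠ idm X ⊠ f)).

Definition is_coend (T : functor C C) (X Z : Ob C) (z : Ob C -> Mor C) : Prop :=
  extranatural T X Z z /\
  forall P k, extranatural T X P k ->
    exists! u, hom u Z P /\ forall Y, u ∘ z Y = k Y.

(* The argument order of [zeta] is X Y: [zeta X Y] is the arrow
   T(Y)^v ⊗ X ⊗ Y -> Z X. *)
Definition is_centraliser (T Z : functor C C) (zeta : Ob C -> Ob C -> Mor C) : Prop :=
  (forall X, is_coend T X (Z X) (zeta X)) /\
  (forall f X X' Y, hom f X X' ->
     fmap Z f ∘ zeta X Y = zeta X' Y ∘ (idm ((T Y)^v) ⊠ f ⊠ idm Y)).

Record centraliser (T : functor C C) := Centraliser {
  cent_fun :> functor C C;
  cent_zeta : Ob C -> Ob C -> Mor C;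
  centP : is_centraliser T cent_fun cent_zeta }.

(* The transposed family X ⊗ Y -> T(Y) ⊗ Z(X) of [zeta]. *)
Definition cent_chi (T : functor C C) (zeta : Ob C -> Ob C -> Mor C)
    (X Y : Ob C) : Mor C :=
  (idm (T Y) ⊠ zeta X Y) ∘ (coev (T Y) ⊠ idm (X ⊗ Y)).

(* The monad structure on the centraliser of T which is determined by an oplax
   monoidal structure (DT, eT) on T. *)
Definition is_cent_monad (T : functor C C) (DT : Ob C -> Ob C -> Mor C) (eT : Mor C)
    (Z : monad C) (zeta : Ob C -> Ob C -> Mor C) : Prop :=
  let chi := cent_chi T zeta in
  [/\ is_centraliser T Z zeta,
      forall X, eta Z X = (eT ⊠ idm (Z X)) ∘ chi X one &
      forall X Y W,
        (DT Y W ⊠ idm (Z X)) ∘ chi X (Y ⊗ W) =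
        (idm (T Y ⊗ T W) ⊠ mu Z X) ∘
          ((idm (T Y) ⊠ chi (Z X) W) ∘ (chi X Y ⊠ idm W))].

End Duals.

Arguments dual {C} f.
Arguments ddual : clear implicits.
Arguments ddual_Delta : clear implicits.
Arguments ddual_eps : clear implicits.
Arguments pivotal : clear implicits.
Arguments piv {C} p X.
Arguments piv_inv {C} p X.

(* The left dual of a module can always be chosen such that its object,
   evaluation and coevaluation are those of the underlying object of C; the
   choice [hld] is then unique, since the action on the dual is determined by
   linearity of the evaluation and the coevaluation. *)
Record hopf_monad (C : rigid_category) := HopfMonad {
  hbim :> bimonad C;
  hld : left_duals (EMmon hbim);
  hld_ob : forall M, carrier (ld hld M) = ld (rld C) (carrier M);
  hld_ev : forall M, em_arr (ev hld M) = ev (rld C) (carrier M);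
  hld_coev : forall M, em_arr (coev hld M) = coev (rld C) (carrier M);
  hright : has_right_duals (EMmon hbim) }.

Definition EMrigid (C : rigid_category) (H : hopf_monad C) : rigid_category :=
  @RigidCategory (EMmon H) (hld H) (@hright C H).

Definition left_antipode (C : rigid_category) (H : hopf_monad C)
    (s : Ob C -> Mor C) : Prop :=
  let D := ld (rld C) in
  [/\ forall X, hom (s X) (H (D (H X))) (D X),
      forall f X Y, hom f X Y ->
        s X ∘ fmap H (dual (fmap H f)) = dual f ∘ s Y &
      forall M : module H,
        act (ld (hld H) M) = s (carrier M) ∘ fmap H (dual (act M))].

Record comodule_monad (C : monoidal_category) (B : bimonad C) := ComoduleMonad {
  cmon :> monad C;
  coact : Ob C -> Ob C -> Mor C;
  coact_hom : forall M X, hom (coact M X) (cmon (M ⊗ X)) (cmon M ⊗ B X);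
  coact_nat : forall f g M N X Y, hom f M N -> hom g X Y ->
    (fmap cmon f ⊠ fmap B g) ∘ coact M X = coact N Y ∘ fmap cmon (f ⊠ g);
  coactA : forall M X Y,
    (idm (cmon M) ⊠ Delta B X Y) ∘ coact M (X ⊗ Y) =
    (coact M X ⊠ idm (B Y)) ∘ coact (M ⊗ X) Y;
  coact_eps : forall M, (idm (cmon M) ⊠ eps B) ∘ coact M one = idm (cmon M);
  coact_mu : forall M X, coact M X ∘ mu cmon (M ⊗ X) =
    (mu cmon M ⊠ mu B X) ∘ (coact (cmon M) (B X) ∘ fmap cmon (coact M X));
  coact_eta : forall M X, coact M X ∘ eta cmon (M ⊗ X) = eta cmon M ⊠ eta B X }.

Arguments coact {C B} c M X.

#[export] Hint Resolve coact_hom : homdb.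

Definition self_comodule (C : monoidal_category) (B : bimonad C) : comodule_monad B :=
  @ComoduleMonad C B B (Delta B) (Delta_hom (bm_oplax B)) (Delta_nat (bm_oplax B))
    (fun X Y W => esym (DeltaA (bm_oplax B) X Y W)) (Delta_epsr (bm_oplax B))
    (Delta_mu B) (Delta_eta B).

Definition comodule_monad_morphism (C : monoidal_category) (B : bimonad C)
    (K L : comodule_monad B) (f : Ob C -> Mor C) : Prop :=
  monad_morphism K L f /\
  forall M X, coact L M X ∘ f (M ⊗ X) = (f M ⊠ idm (B X)) ∘ coact K M X.

Definition comodule_monads_iso (C : monoidal_category) (B : bimonad C)
    (K L : comodule_monad B) : Prop :=
  exists f g : Ob C -> Mor C,
    [/\ comodule_monad_morphism K L f, comodule_monad_morphism L K g &
        forall X, mutually_inverse (f X) (g X) (K X) (L X)].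

Section CrossProduct.
Context (C : category) (H : monad C) (T : monad (EM H)).
Local Notation F := (freeF H).
Local Notation U := (forgetF H).
Local Notation e := (@free_counit C H).

Lemma free_counit_hom (M : Ob (EM H)) : hom (e M) (F (U M)) M.
Proof. by split => //=; [exact: act_hom | rewrite act_mu]. Qed.

Lemma free_counit_nat (f : Mor (EM H)) (M N : Ob (EM H)) :
  hom f M N -> f ∘ e M = e N ∘ fmap F (fmap U f).
Proof.
case: f => [M' N' f] [/= -> -> hf lf].
by rewrite /em_comp /= lf /free_mor (hom_dom hf).
Qed.

Lemma free_counit_F X : e (F X) ∘ fmap F (eta H X) = idm (F X).
Proof.
rewrite /= /em_comp /free_mor /= (hom_dom (eta_hom H X)) mu_etar.
by [].
Qed.

Definition cross_fun : functor C C := compF U (compF T F).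

Definition cross_mul (X : Ob C) : Mor (EM H) := mu T (F X) ∘ fmap T (e (T (F X))).

Definition cross_mu (X : Ob C) : Mor C := fmap U (cross_mul X).

Definition cross_eta (X : Ob C) : Mor C := fmap U (eta T (F X)) ∘ eta H X.

Lemma cross_mul_hom X : hom (cross_mul X) (T (F (U (T (F X))))) (T (F X)).
Proof. exact: compm_hom (fmap_hom T (free_counit_hom _)) (mu_hom T _). Qed.

Lemma cross_mul_nat f X Y : hom f X Y ->
  fmap T (fmap F f) ∘ cross_mul X =
  cross_mul Y ∘ fmap T (fmap F (fmap U (fmap T (fmap F f)))).
Proof.
move=> hf; set g := fmap F f.
have hg : hom g (F X) (F Y) by exact: fmap_hom.
have hTg := fmap_hom T hg.
have hFUTg := fmap_hom F (fmap_hom U hTg).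
have he Z := free_counit_hom Z.
rewrite /cross_mul.
have sq : fmap T g ∘ mu T (F X) = mu T (F Y) ∘ fmap T (fmap T g).
  exact: (nat_sq (mu_nat T) hg).
rewrite (compmA (fmap_hom T (he _)) (mu_hom T _) hTg) sq.
rewrite -(compmA (fmap_hom T (he _)) (fmap_hom T hTg) (mu_hom T _)).
rewrite -(fmap_comp T (he _) hTg) (free_counit_nat hTg).
rewrite (fmap_comp T hFUTg (he _)).
by rewrite (compmA (fmap_hom T hFUTg) (fmap_hom T (he _)) (mu_hom T _)).
Qed.

Lemma cross_mu_nat : natural (compF cross_fun cross_fun) cross_fun cross_mu.
Proof.
split=> [X|f X Y hf]; first exact: fmap_hom (cross_mul_hom X).
exact: (congr1 (fmap U) (cross_mul_nat hf)).
Qed.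

Lemma cross_eta_nat : natural (idF C) cross_fun cross_eta.
Proof.
have hE X : hom (fmap U (eta T (F X))) (H X) (cross_fun X).
  exact: (fmap_hom U (eta_hom T (F X))).
split=> [X|f X Y hf]; first exact: compm_hom (eta_hom H X) (hE X).
have hUF := fmap_hom U (fmap_hom F hf).
have hc := fmap_hom cross_fun hf.
rewrite /cross_eta (compmA (eta_hom H X) (hE X) hc).
have -> : fmap cross_fun f ∘ fmap U (eta T (F X)) =
    fmap U (eta T (F Y)) ∘ fmap U (fmap F f).
  exact: (congr1 (fmap U) (nat_sq (eta_nat T) (fmap_hom F hf))).
rewrite -(compmA (eta_hom H X) hUF (hE Y)).
have -> : fmap U (fmap F f) ∘ eta H X = eta H Y ∘ f by exact: (nat_sq (eta_nat H) hf).
by rewrite (compmA hf (eta_hom H Y) (hE Y)).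
Qed.

Lemma cross_mulA X :
  cross_mul X ∘ fmap T (fmap F (fmap U (cross_mul X))) =
  cross_mul X ∘ cross_mul (cross_fun X).
Proof.
have he Z := free_counit_hom Z.
have hn := cross_mul_hom X.
have hFUn := fmap_hom F (fmap_hom U hn).
set P := T (F X).
have hP : hom (e P) (F (U P)) P by exact: he.
set Q := T (F (U P)).
have hQ : hom (e Q) (F (U Q)) Q by exact: he.
have hTP := fmap_hom T hP.
have hTTP := fmap_hom T hTP.
have hTQ := fmap_hom T hQ.
have hm : hom (mu T (F X)) (T P) P by exact: mu_hom.
have hTm := fmap_hom T hm.
rewrite {1}/cross_mul -/P -(compmA (fmap_hom T hFUn) hTP hm).
rewrite -(fmap_comp T hFUn hP) -(free_counit_nat hn) (fmap_comp T hQ hn).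
rewrite /cross_mul -/P (fmap_comp T hTP hm).
rewrite (compmA hTQ (compm_hom hTTP hTm) hm) (compmA hTTP hTm hm) muA.
have hmP : hom (mu T P) (T (T P)) (T P) by exact: mu_hom.
have sq : mu T P ∘ fmap T (fmap T (e P)) = fmap T (e P) ∘ mu T (F (U P)).
  exact: (esym (nat_sq (mu_nat T) hP)).
rewrite -(compmA hTTP hmP hm) sq.
have hm' : hom (mu T (F (U P))) (T Q) Q by exact: mu_hom.
rewrite (compmA hm' hTP hm).
by rewrite -(compmA hTQ hm' (compm_hom hTP hm)).
Qed.

Lemma cross_muA X :
  cross_mu X ∘ fmap cross_fun (cross_mu X) = cross_mu X ∘ cross_mu (cross_fun X).
Proof. exact: (congr1 (fmap U) (cross_mulA X)). Qed.

Lemma cross_etal X : cross_mu X ∘ cross_eta (cross_fun X) = idm (cross_fun X).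
Proof.
set P := T (F X).
have hP : hom (free_counit P) (F (U P)) P by exact: free_counit_hom.
have hE : hom (eta T (F (U P))) (F (U P)) (T (F (U P))) by exact: eta_hom.
have hn : hom (cross_mul X) (T (F (U P))) P by exact: cross_mul_hom.
have hm : hom (mu T (F X)) (T P) P by exact: mu_hom.
have hTP := fmap_hom T hP.
rewrite /cross_mu /cross_eta.
rewrite (compmA (eta_hom H _) (fmap_hom U hE) (fmap_hom U hn)).
have -> : fmap U (cross_mul X) ∘ fmap U (eta T (F (U P))) = fmap U (free_counit P).
  rewrite -(fmap_comp U hE hn); congr (fmap U _).
  rewrite /cross_mul -/P -(compmA hE hTP hm) (nat_sq (eta_nat T) hP).
  by rewrite (compmA hP (eta_hom T P) hm) mu_etal (compm_idl hP).
exact: (act_eta P).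
Qed.

Lemma cross_etar X : cross_mu X ∘ fmap cross_fun (cross_eta X) = idm (cross_fun X).
Proof.
have hn := cross_mul_hom X.
have hh := eta_hom H X.
have hE : hom (eta T (F X)) (F X) (T (F X)) by exact: eta_hom.
have hFh := fmap_hom F hh.
have hFE := fmap_hom F (fmap_hom U hE).
have hP : hom (e (T (F X))) (F (U (T (F X)))) (T (F X)) by exact: free_counit_hom.
have hm : hom (mu T (F X)) (T (T (F X))) (T (F X)) by exact: mu_hom.
suff key : cross_mul X ∘ fmap T (fmap F (cross_eta X)) = idm (T (F X)).
  exact: (congr1 (fmap U) key).
rewrite /cross_eta (fmap_comp F hh (fmap_hom U hE)) /cross_mul.
have hc := compm_hom hFh hFE.
rewrite -(compmA (fmap_hom T hc) (fmap_hom T hP) hm).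
rewrite -(fmap_comp T hc hP) (compmA hFh hFE hP) -(free_counit_nat hE).
rewrite -(compmA hFh (free_counit_hom (F X)) hE) free_counit_F (compm_idr hE).
by rewrite mu_etar.
Qed.

Definition cross_product : monad C :=
  @Monad C cross_fun cross_mu cross_eta
    cross_mu_nat cross_eta_nat cross_muA cross_etal cross_etar.

End CrossProduct.

Arguments cross_product {C} H T.

(* Equations in the category of modules behind the comodule monad structure of
   a cross product. *)
Section ComoduleCalculus.
Context (D : monoidal_category) (Z : bimonad D) (Q : comodule_monad Z).

Lemma cross_coassoc_aux E A B W G G' a b c d :
  hom a E (A ⊗ G) -> hom b G (B ⊗ W) -> hom c E (G' ⊗ W) -> hom d G' (A ⊗ B) ->
  (idm A ⊠ b) ∘ a = (d ⊠ idm W) ∘ c ->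
  (idm (Q A) ⊠ (Delta Z B W ∘ fmap Z b)) ∘ (coact Q A G ∘ fmap Q a) =
  ((coact Q A B ∘ fmap Q d) ⊠ idm (Z W)) ∘ (coact Q G' W ∘ fmap Q c).
Proof.
move=> ha hb hc hd eq.
have hqA := idm_hom (Q A); have hzW := idm_hom (Z W).
have hQa := fmap_hom Q ha; have hQc := fmap_hom Q hc.
have hQd := fmap_hom Q hd; have hZb := fmap_hom Z hb.
have hD := bDelta_hom Z B W.
have h1 := coact_hom Q A G; have h2 := coact_hom Q G' W.
have h3 := coact_hom Q A B.
rewrite -{1}(compm_idl hqA) (tmor_comp hqA hqA hZb hD).
rewrite -{1}(compm_idl hzW) (tmor_comp hQd h3 hzW hzW).
have t1 := tmor_hom hqA hZb; have t2 := tmor_hom hqA hD.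
have t3 := tmor_hom hQd hzW; have t4 := tmor_hom h3 hzW.
rewrite (compmA hQa h1 (compm_hom t1 t2)) -(compmA h1 t1 t2).
rewrite (compmA hQc h2 (compm_hom t3 t4)) -(compmA h2 t3 t4).
have n1 : (idm (Q A) ⊠ fmap Z b) ∘ coact Q A G =
    coact Q A (B ⊗ W) ∘ fmap Q (idm A ⊠ b).
  by rewrite -fmap_id (coact_nat Q (idm_hom A) hb).
have n2 : (fmap Q d ⊠ idm (Z W)) ∘ coact Q G' W =
    coact Q (A ⊗ B) W ∘ fmap Q (d ⊠ idm W).
  by rewrite -fmap_id (coact_nat Q hd (idm_hom W)).
rewrite n1 n2.
have u1 := tmor_hom (idm_hom A) hb; have u2 := tmor_hom hd (idm_hom W).
have h4 := coact_hom Q A (B ⊗ W); have h5 := coact_hom Q (A ⊗ B) W.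
rewrite tobA in u1 h4.
rewrite (compmA (fmap_hom Q u1) h4 t2) (compmA (fmap_hom Q u2) h5 t4).
have h6 : hom ((idm (Q A) ⊠ Delta Z B W) ∘ coact Q A (B ⊗ W))
    (Q (A ⊗ B ⊗ W)) (Q A ⊗ (Z B ⊗ Z W)) by exact: compm_hom h4 t2.
have h7 : hom ((coact Q A B ⊠ idm (Z W)) ∘ coact Q (A ⊗ B) W)
    (Q (A ⊗ B ⊗ W)) (Q A ⊗ Z B ⊗ Z W) by exact: compm_hom h5 t4.
rewrite -(compmA hQa (fmap_hom Q u1) h6) -(fmap_comp Q ha u1).
rewrite -(compmA hQc (fmap_hom Q u2) h7) -(fmap_comp Q hc u2).
by rewrite coactA eq.
Qed.

Lemma cross_coeps_aux E A G a b :
  hom a E (A ⊗ G) -> hom b G one -> (idm A ⊠ b) ∘ a = idm A ->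
  (idm (Q A) ⊠ (eps Z ∘ fmap Z b)) ∘ (coact Q A G ∘ fmap Q a) = idm (Q A).
Proof.
move=> ha hb eq.
have hqA := idm_hom (Q A).
have hQa := fmap_hom Q ha; have hZb := fmap_hom Z hb.
have h1 := coact_hom Q A G; have he := beps_hom Z.
rewrite -{1}(compm_idl hqA) (tmor_comp hqA hqA hZb he).
have t1 := tmor_hom hqA hZb; have t2 := tmor_hom hqA he.
rewrite (compmA hQa h1 (compm_hom t1 t2)) -(compmA h1 t1 t2).
have -> : (idm (Q A) ⊠ fmap Z b) ∘ coact Q A G =
    coact Q A one ∘ fmap Q (idm A ⊠ b).
  by rewrite -fmap_id (coact_nat Q (idm_hom A) hb).
have u1 := tmor_hom (idm_hom A) hb.
have h4 := coact_hom Q A one.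
rewrite (compmA (fmap_hom Q u1) h4 t2) coact_eps.
rewrite tob1r in u1.
by rewrite (compm_idl (fmap_hom Q u1)) -(fmap_comp Q ha u1) eq fmap_id.
Qed.

Lemma cross_comu_aux E A B a P1 P2 P3 P4 eE eA eB e Df d' :
  let d := coact Q A B ∘ fmap Q a in
  hom a E (A ⊗ B) -> hom eE P1 (Q E) -> hom eA P2 (Q A) -> hom eB P3 (Z B) ->
  hom Df P4 (P2 ⊗ P3) -> hom d' P1 P4 ->
  e = (eA ⊠ eB) ∘ Df -> e ∘ d' = d ∘ eE ->
  d ∘ (mu Q E ∘ fmap Q eE) =
  ((mu Q A ∘ fmap Q eA) ⊠ (mu Z B ∘ fmap Z eB)) ∘
    ((coact Q P2 P3 ∘ fmap Q Df) ∘ fmap Q d').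
Proof.
move=> d ha hE hA hB hDf hd' ee esq.
have hQa := fmap_hom Q ha; have h1 := coact_hom Q A B.
have hd : hom d (Q E) (Q A ⊗ Z B) by exact: compm_hom hQa h1.
have hQE := fmap_hom Q hE; have hQA := fmap_hom Q hA; have hZB := fmap_hom Z hB.
have mE := mu_hom Q E; have mA := mu_hom Q A; have mB := mu_hom Z B.
have mAB := mu_hom Q (A ⊗ B).
have t1 := tmor_hom mA mB; have t2 := tmor_hom hQA hZB.
rewrite (tmor_comp hQA mA hZB mB).
have h2 := coact_hom Q P2 P3.
have hQDf := fmap_hom Q hDf; have hQd' := fmap_hom Q hd'.
have u := compm_hom hQd' (compm_hom hQDf h2).
rewrite -(compmA u t2 t1).
rewrite -(compmA hQd' hQDf h2).
have v := compm_hom hQd' hQDf.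
rewrite (compmA v h2 t2) (coact_nat Q hA hB).
have h3 := coact_hom Q (Q A) (Z B).
have hAB := tmor_hom hA hB.
have hQAB := fmap_hom Q hAB.
rewrite -(compmA v hQAB h3) (compmA hQd' hQDf hQAB).
rewrite -(fmap_comp Q hDf hAB) -ee.
have he : hom e P4 (Q A ⊗ Z B) by rewrite ee; exact: compm_hom hDf hAB.
rewrite -(fmap_comp Q hd' he) esq (fmap_comp Q hE hd).
have hQd := fmap_hom Q hd.
rewrite (compmA hQE hQd h3) (compmA hQE (compm_hom hQd h3) t1).
rewrite (compmA hQE mE hd); congr (_ ∘ _).
have hQQa := fmap_hom Q hQa.
have hQ1 := fmap_hom Q h1.
rewrite {2}/d (fmap_comp Q hQa h1) (compmA hQQa hQ1 h3).
rewrite (compmA hQQa (compm_hom hQ1 h3) t1) -coact_mu.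
have sq : fmap Q a ∘ mu Q E = mu Q (A ⊗ B) ∘ fmap Q (fmap Q a).
  exact: (nat_sq (mu_nat Q) ha).
rewrite /d -(compmA mE hQa h1) sq.
by rewrite (compmA hQQa mAB h1).
Qed.

Lemma cross_coeta_aux E A B a :
  hom a E (A ⊗ B) ->
  (coact Q A B ∘ fmap Q a) ∘ eta Q E = (eta Q A ⊠ eta Z B) ∘ a.
Proof.
move=> ha; have hQa := fmap_hom Q ha; have h1 := coact_hom Q A B.
rewrite -(compmA (eta_hom Q E) hQa h1) (nat_sq (eta_nat Q) ha) /=.
by rewrite (compmA ha (eta_hom Q _) h1) coact_eta.
Qed.

Lemma cross_conat_aux E A B E' A' B' a a' f g h :
  hom a E (A ⊗ B) -> hom a' E' (A' ⊗ B') ->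
  hom f A A' -> hom g B B' -> hom h E E' ->
  (f ⊠ g) ∘ a = a' ∘ h ->
  (fmap Q f ⊠ fmap Z g) ∘ (coact Q A B ∘ fmap Q a) =
  (coact Q A' B' ∘ fmap Q a') ∘ fmap Q h.
Proof.
move=> ha ha' hf hg hh eq.
have hQa := fmap_hom Q ha; have hQa' := fmap_hom Q ha'; have hQh := fmap_hom Q hh.
have h1 := coact_hom Q A B; have h1' := coact_hom Q A' B'.
rewrite (compmA hQa h1 (tmor_hom (fmap_hom Q hf) (fmap_hom Z hg))).
have hfg := tmor_hom hf hg.
rewrite (coact_nat Q hf hg) -(compmA hQa (fmap_hom Q hfg) h1').
by rewrite -(fmap_comp Q ha hfg) eq (fmap_comp Q hh ha') (compmA hQh hQa' h1').
Qed.

End ComoduleCalculus.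

Section CrossBimonad.
Context (C : monoidal_category) (H : bimonad C).
Local Notation F := (freeF H).
Local Notation U := (forgetF H).

(* The oplax monoidal structure of the free module functor. *)
Definition free_Delta (X Y : Ob C) : Mor (EMmon H) :=
  EmMor (F (X ⊗ Y)) (@tob (EMmon H) (F X) (F Y)) (Delta H X Y).

Definition free_eps : Mor (EMmon H) := EmMor (F one) (@one (EMmon H)) (eps H).

Lemma free_Delta_hom X Y :
  @hom (EMmon H) (free_Delta X Y) (F (X ⊗ Y)) (@tob (EMmon H) (F X) (F Y)).
Proof.
split => //=; first exact: bDelta_hom.
rewrite Delta_mu.
have h1 := fmap_hom H (bDelta_hom H X Y).
by rewrite (compmA h1 (bDelta_hom H _ _) (tmor_hom (mu_hom H X) (mu_hom H Y))).
Qed.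

Lemma free_eps_hom : @hom (EMmon H) free_eps (F one) (@one (EMmon H)).
Proof. by split => //=; [exact: beps_hom | exact: eps_mu]. Qed.

Section CrossCoaction.
Context (Z : bimonad (EMmon H)) (Q : comodule_monad Z).

Definition cross_coact (X Y : Ob C) : Mor C :=
  fmap U (coact Q (F X) (F Y) ∘ fmap Q (free_Delta X Y)).

Definition cross_Delta (X Y : Ob C) : Mor C :=
  fmap U (Delta Z (F X) (F Y) ∘ fmap Z (free_Delta X Y)).

Definition cross_eps : Mor C := fmap U (eps Z ∘ fmap Z free_eps).

Local Notation K := (cross_product H Q).
Local Notation B := (cross_product H Z).

Lemma cross_coact_hom X Y : hom (cross_coact X Y) (K (X ⊗ Y)) (K X ⊗ B Y).
Proof.
have h := compm_hom (fmap_hom Q (free_Delta_hom X Y)) (coact_hom Q _ _).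
exact: (fmap_hom U h).
Qed.

Lemma cross_coact_nat f g X Y X' Y' : hom f X Y -> hom g X' Y' ->
  (fmap K f ⊠ fmap B g) ∘ cross_coact X X' = cross_coact Y Y' ∘ fmap K (f ⊠ g).
Proof.
move=> hf hg.
have key := cross_conat_aux Q (free_Delta_hom X X') (free_Delta_hom Y Y')
  (fmap_hom F hf) (fmap_hom F hg) (fmap_hom F (tmor_hom hf hg)).
apply: (congr1 (fmap U) (key _)) => /=.
rewrite /em_comp /mod_tmor /free_mor /=.
have hfg := tmor_hom hf hg.
rewrite (hom_dom hfg) (hom_cod hf) (hom_cod hg).
by rewrite (Delta_nat (bm_oplax H) hf hg).
Qed.

Lemma cross_coactA M X Y :
  (idm (K M) ⊠ cross_Delta X Y) ∘ cross_coact M (X ⊗ Y) =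
  (cross_coact M X ⊠ idm (B Y)) ∘ cross_coact (M ⊗ X) Y.
Proof.
have h1 := free_Delta_hom M (X ⊗ Y).
have h3 := free_Delta_hom (M ⊗ X) Y.
rewrite tobA in h1.
have key := cross_coassoc_aux Q h1 (free_Delta_hom X Y) h3 (free_Delta_hom M X).
apply: (congr1 (fmap U) (key _)) => /=.
rewrite /em_comp /mod_tmor /=.
by rewrite mod_tensA -(DeltaA (bm_oplax H)) tobA.
Qed.

Lemma cross_coact_eps M : (idm (K M) ⊠ cross_eps) ∘ cross_coact M one = idm (K M).
Proof.
have h1 := free_Delta_hom M one.
have key := cross_coeps_aux Q h1 free_eps_hom.
apply: (congr1 (fmap U) (key _)) => /=.
rewrite /em_comp /mod_tmor /=.
by rewrite mod_tens1r (Delta_epsr (bm_oplax H)) tob1r.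
Qed.

Lemma cross_coact_mu M X : cross_coact M X ∘ mu K (M ⊗ X) =
  (mu K M ⊠ mu B X) ∘ (cross_coact (K M) (B X) ∘ fmap K (cross_coact M X)).
Proof.
set d : Mor (EMmon H) := coact Q (F M) (F X) ∘ fmap Q (free_Delta M X).
have hd : hom d (Q (F (M ⊗ X))) (@tob (EMmon H) (Q (F M)) (Z (F X))).
  exact: compm_hom (fmap_hom Q (free_Delta_hom M X)) (coact_hom Q _ _).
have key := cross_comu_aux (free_Delta_hom M X) (free_counit_hom (Q (F (M ⊗ X))))
  (free_counit_hom (Q (F M))) (free_counit_hom (Z (F X)))
  (free_Delta_hom (K M) (B X)) (fmap_hom F (fmap_hom U hd)) _
  (esym (free_counit_nat hd)).
by apply: (congr1 (fmap U) (key _)).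
Qed.

Lemma cross_coact_eta M X :
  cross_coact M X ∘ eta K (M ⊗ X) = eta K M ⊠ eta B X.
Proof.
have hE Y := fmap_hom U (eta_hom Q (F Y)).
have hE' Y := fmap_hom U (eta_hom Z (F Y)).
have e1 := congr1 (fmap U) (cross_coeta_aux Q (free_Delta_hom M X)).
rewrite /= /cross_eta.
rewrite (compmA (eta_hom H _) (hE _) (cross_coact_hom M X)).
rewrite (e1 : cross_coact M X ∘ fmap U (eta Q (F (M ⊗ X))) =
  (fmap U (eta Q (F M)) ⊠ fmap U (eta Z (F X))) ∘ Delta H M X).
rewrite -(compmA (eta_hom H _) (bDelta_hom H _ _) (tmor_hom (hE _) (hE' _))).
by rewrite Delta_eta (tmor_comp (eta_hom H _) (hE _) (eta_hom H _) (hE' _)).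
Qed.

End CrossCoaction.

Section CrossBimonad.
Context (Z : bimonad (EMmon H)).
Local Notation B := (cross_product H Z).
Local Notation D := (cross_Delta Z).
Local Notation e := (cross_eps Z).

Lemma cross_eps_hom : hom e (B one) one.
Proof.
have h := compm_hom (fmap_hom Z free_eps_hom) (beps_hom Z).
exact: (fmap_hom U h).
Qed.

Lemma cross_Delta_epsl X : (e ⊠ idm (B X)) ∘ D one X = idm (B X).
Proof.
suff key : ((eps Z ∘ fmap Z free_eps) ⊠ idm (Z (F X))) ∘
    (Delta Z (F one) (F X) ∘ fmap Z (free_Delta one X)) = idm (Z (F X)).
  exact: (congr1 (fmap U) key).
have ha := free_Delta_hom one X.
have hz := idm_hom (Z (F X)).
have hZe := fmap_hom Z free_eps_hom; have he := beps_hom Z.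
have hZa := fmap_hom Z ha.
have h1 := bDelta_hom Z (F one) (F X).
rewrite -{1}(compm_idl hz) (tmor_comp hZe he hz hz).
have t1 := tmor_hom hZe hz; have t2 := tmor_hom he hz.
rewrite (compmA hZa h1 (compm_hom t1 t2)) -(compmA h1 t1 t2).
have -> : (fmap Z free_eps ⊠ idm (Z (F X))) ∘ Delta Z (F one) (F X) =
    Delta Z one (F X) ∘ fmap Z (free_eps ⊠ @idm (EMmon H) (F X)).
  by rewrite -fmap_id (Delta_nat (bm_oplax Z) free_eps_hom (idm_hom (F X : Ob (EMmon H)))).
have u1 := tmor_hom free_eps_hom (idm_hom (F X : Ob (EMmon H))).
have h4 := bDelta_hom Z one (F X).
rewrite (compmA (fmap_hom Z u1) h4 t2) (Delta_epsl (bm_oplax Z)).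
rewrite tob1l in u1.
rewrite (compm_idl (fmap_hom Z u1)) -(fmap_comp Z ha u1) -fmap_id.
congr (fmap Z _); rewrite /= /em_comp /mod_tmor /=.
by rewrite mod_tens1l (Delta_epsl (bm_oplax H)) tob1l.
Qed.

Lemma cross_oplax : oplax B D e.
Proof.
split.
- exact: (cross_coact_hom (self_comodule Z)).
- exact: (cross_coact_nat (self_comodule Z)).
- exact: cross_eps_hom.
- move=> X Y W; exact: (esym (cross_coactA (self_comodule Z) X Y W)).
- exact: cross_Delta_epsl.
- exact: (cross_coact_eps (self_comodule Z)).
Qed.

Lemma cross_eps_mu : e ∘ mu B one = e ∘ fmap B e.
Proof.
set d := eps Z ∘ fmap Z free_eps.
have hZe := fmap_hom Z free_eps_hom; have he := beps_hom Z.
have hd : hom d (Z (F one)) one by exact: compm_hom hZe he.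
have hP := free_counit_hom (Z (F one)).
have hFd := fmap_hom F (fmap_hom U hd).
suff key : d ∘ (mu Z (F one) ∘ fmap Z (free_counit (Z (F one)))) =
    d ∘ fmap Z (fmap F (fmap U d)).
  exact: (congr1 (fmap U) key).
have hm := mu_hom Z (F one); have hm1 := mu_hom Z one.
have hZP := fmap_hom Z hP.
rewrite (compmA hZP hm hd) {1}/d -(compmA hm hZe he).
have sq : fmap Z free_eps ∘ mu Z (F one) = mu Z one ∘ fmap Z (fmap Z free_eps).
  exact: (nat_sq (mu_nat Z) free_eps_hom).
rewrite sq.
rewrite (compmA (fmap_hom Z hZe) hm1 he) eps_mu.
rewrite -(compmA (fmap_hom Z hZe) (fmap_hom Z he) he) -(fmap_comp Z hZe he) -/d.
rewrite -(compmA hZP (fmap_hom Z hd) he) -(fmap_comp Z hP hd) (free_counit_nat hd).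
rewrite (fmap_comp Z hFd (free_counit_hom _)) /d.
by rewrite (compmA (fmap_hom Z hFd) hZe he).
Qed.

Lemma cross_eps_eta : e ∘ eta B one = idm one.
Proof.
have hE := fmap_hom U (eta_hom Z (F one)).
rewrite /= /cross_eta (compmA (eta_hom H _) hE cross_eps_hom).
have -> : e ∘ fmap U (eta Z (F one)) = eps H.
  have hZe := fmap_hom Z free_eps_hom.
  rewrite /cross_eps -(fmap_comp U (eta_hom Z (F one)) (compm_hom hZe (beps_hom Z))).
  rewrite -(compmA (eta_hom Z (F one)) hZe (beps_hom Z)).
  rewrite (nat_sq (eta_nat Z) free_eps_hom).
  rewrite (compmA free_eps_hom (eta_hom Z one) (beps_hom Z)) eps_eta.
  by rewrite (compm_idl free_eps_hom).
exact: eps_eta.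
Qed.

Definition cross_bimonad : bimonad C :=
  @Bimonad C B D e cross_oplax
    (cross_coact_mu (self_comodule Z)) (cross_coact_eta (self_comodule Z))
    cross_eps_mu cross_eps_eta.

Definition cross_comodule (Q : comodule_monad Z) : comodule_monad cross_bimonad :=
  @ComoduleMonad C cross_bimonad (cross_product H Q) (cross_coact Q)
    (cross_coact_hom Q) (cross_coact_nat Q) (cross_coactA Q) (cross_coact_eps Q)
    (cross_coact_mu Q) (cross_coact_eta Q).

End CrossBimonad.
End CrossBimonad.

Arguments cross_bimonad {C} H Z.
Arguments cross_comodule {C} H {Z} Q.

Definition same_functor (C D : category) (F G : functor C D) : Prop :=
  (forall X, F X = G X) /\ (forall f X Y, hom f X Y -> fmap F f = fmap G f).

Section Doubles.
Context (C : rigid_category) (H : hopf_monad C).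
Local Notation U := (forgetF H).
Local Notation F := (freeF H).
Local Notation VH := (EMrigid H).

Definition twisted_fun : functor C C := compF U (compF (ddual VH) F).

(* The centraliser Z of the identity functor of the category of modules; the
   identity functor carries the identity oplax structure. *)
Record central_bimonad (ZH : centraliser H) := CentralBimonad {
  cb_bimonad :> bimonad VH;
  cb_zeta : Ob VH -> Ob VH -> Mor VH;
  cb_lift : same_functor (compF U cb_bimonad) (compF ZH U);
  cb_monad : is_cent_monad (idF VH) (fun Y W => idm (Y ⊗ W)) (idm one)
    cb_bimonad cb_zeta;
  cb_Delta : forall X W Y, let chi := cent_chi (idF VH) cb_zeta in
    (idm Y ⊠ Delta cb_bimonad X W) ∘ chi (X ⊗ W) Y =
    (chi X Y ⊠ idm (cb_bimonad W)) ∘ (idm X ⊠ chi W Y);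
  cb_eps : forall Y, let chi := cent_chi (idF VH) cb_zeta in
    (idm Y ⊠ eps cb_bimonad) ∘ chi one Y = idm Y }.

(* The centraliser Q of the double dual functor of the category of modules. *)
Record twisted_comodule_monad (ZH : centraliser H) (Z : central_bimonad ZH)
    (QH : centraliser twisted_fun) := TwistedComoduleMonad {
  tc_comod :> comodule_monad Z;
  tc_xi : Ob VH -> Ob VH -> Mor VH;
  tc_lift : same_functor (compF U tc_comod) (compF QH U);
  tc_monad : is_cent_monad (ddual VH) (ddual_Delta VH) (ddual_eps VH) tc_comod tc_xi;
  tc_coact : forall X W Y,
    let chi := cent_chi (idF VH) (cb_zeta Z) in
    let xi := cent_chi (ddual VH) tc_xi in
    (idm (ddual VH Y) ⊠ coact tc_comod X W) ∘ xi (X ⊗ W) Y =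
    (xi X Y ⊠ idm (Z W)) ∘ (idm X ⊠ chi W Y) }.

Definition drinfeld_double (ZH : centraliser H) (Z : central_bimonad ZH) : bimonad C :=
  cross_bimonad H Z.

Definition anti_drinfeld_double (ZH : centraliser H) (Z : central_bimonad ZH)
    (QH : centraliser twisted_fun) (Q : twisted_comodule_monad Z QH) :
    comodule_monad (drinfeld_double Z) := cross_comodule H Q.

End Doubles.

Section Involution.
Context (C : rigid_category) (H : hopf_monad C).

Definition grouplike (g : Ob C -> Mor C) : Prop :=
  [/\ natural (idF C) H g,
      forall X Y, Delta H X Y ∘ g (X ⊗ Y) = g X ⊠ g Y &
      eps H ∘ g one = idm one].

Definition grouplike_mul (g h : Ob C -> Mor C) (X : Ob C) : Mor C :=
  mu H X ∘ (g (H X) ∘ h X).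

Definition grouplike_inverse (g h : Ob C -> Mor C) : Prop :=
  [/\ grouplike h, forall X, grouplike_mul g h X = eta H X &
      forall X, grouplike_mul h g X = eta H X].

(* [h] stands for the inverse of g. *)
Definition Ad_grouplike (g h : Ob C -> Mor C) (X : Ob C) : Mor C :=
  (mu H X ∘ g (H X)) ∘ (mu H X ∘ fmap H (h X)).

Definition character (b : module H) : Prop := carrier b = one.

(* The chosen left dual of the unit object need not be the unit object; the
   action of H on the dual of a character is transported to the unit along the
   canonical isomorphism coev : 1 -> 1^v, with inverse ev : 1^v -> 1. *)
Definition dual_character_act (b : module H) : Mor C :=
  ev (rld C) one ∘ (act (ld (hld H) b) ∘ fmap H (coev (rld C) one)).

Definition Delta3 (X Y W : Ob C) : Mor C :=
  (Delta H X Y ⊠ idm (H W)) ∘ Delta H (X ⊗ Y) W.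

Definition Ad_character (b : module H) (X : Ob C) : Mor C :=
  (act b ⊠ idm (H X) ⊠ dual_character_act b) ∘ Delta3 one X one.

Definition antipode_square (phi : pivotal C) (s : Ob C -> Mor C) (X : Ob C) : Mor C :=
  piv_inv phi (H X) ∘
    (s (ld (rld C) (H X)) ∘ (fmap H (dual (s X)) ∘ fmap H (piv phi X))).

Definition pair_in_involution (phi : pivotal C) (g : Ob C -> Mor C)
    (b : module H) : Prop :=
  [/\ grouplike g, character b &
      exists h s : Ob C -> Mor C,
        [/\ grouplike_inverse g h, left_antipode H s &
            forall X, Ad_grouplike g h X = Ad_character b X ∘ antipode_square phi s X]].

End Involution.

Arguments pair_in_involution {C} H phi g b.

(* Main.v *)
(* A module over the anti-Drinfeld double Q(H) with underlying object 1 is a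
   character b of H together with a Q-module structure on b, that is, a
   multiplicative half braiding s_Y : b ⊗ Y -> Y^vv ⊗ b of H-modules.

   Given a Q(H)-module structure t on 1, the coaction of D(H) yields a morphism of
   comodule monads (t ⊗ id) δ_{1,X} : Q(H) -> D(H).  It is invertible: half
   braidings are invertible by rigidity, so both monads represent the same
   functor, up to tensoring with the invertible H-module b.  Conversely, a monad
   morphism Q(H) -> D(H) pulls the trivial D(H)-module back to 1.

   If V has a pivotal structure φ, then φ^-1 s is a monoidal natural automorphism
   of the forgetful functor, hence the action of a group-like g.  Linearity of s
   says that Ad_g (b ⊗ id) Δ = S^2 (id ⊗ b) Δ, which is Ad_g = Ad_{b'} S^2 for the
   inverse character b' of b: the character of the pair in involution is the
   inverse of the character that lifts the unit. *)
Require Import Defs.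
From mathcomp Require Import ssreflect ssrfun ssrbool eqtype ssrnat seq.
From Stdlib Require Import IndefiniteDescription.

Set Implicit Arguments.
Unset Strict Implicit.
Unset Printing Implicit Defensive.

(** * Deciding equations of diagrams in strict monoidal categories *)

(** Three devices carry the argument. Composition is total on raw arrows, so each use of
    associativity or interchange costs typing premises; a reflective checker for string diagrams
    absorbs them, and most proofs are cut into equations that it can close. The invertibility of
    Q(H) -> D(H) is read off a factorisation: at X the morphism underlies Q(F X) -> Q(b ⊗ F X) -> b
    ⊗ Z(F X). The first arrow is an isomorphism because F X ≅ b ⊗ F X for an invertible module b on
    the unit object, and the target has the carrier of Z(F X) because the tensor product is strict.
    The square of the antipode is handled without the antipode: it measures the failure of φ to be
    H-linear from M to M^vv. Its compatibility with tensor products and its triviality on characters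
    then follow from monoidality of φ and linearity of the structure arrows of the double dual. *)

Inductive oterm := OOne | OAtom of nat | OTens of oterm & oterm.
Inductive aterm :=
  AGen of nat | AId of oterm | AComp of aterm & aterm | ATens of aterm & aterm.

Fixpoint flat (o : oterm) : seq nat :=
  match o with
  | OOne => [::] | OAtom i => [:: i] | OTens a b => flat a ++ flat b
  end.

(* A layer (u, i, v) stands for id_u ⊠ (generator i) ⊠ id_v; a list of layers
   is a composite, the head being applied first. *)
Notation layer := (seq nat * nat * seq nat)%type.
Notation sigt := (seq (oterm * oterm)).

Section Diagrams.
Variable sg : sigt.

Definition gdom i := flat (nth (OOne, OOne) sg i).1.
Definition gcod i := flat (nth (OOne, OOne) sg i).2.
Definition ldom (l : layer) := l.1.1 ++ gdom l.1.2 ++ l.2.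
Definition lcod (l : layer) := l.1.1 ++ gcod l.1.2 ++ l.2.

Fixpoint dwf (w : seq nat) (ls : seq layer) :=
  if ls is l :: ls' then (ldom l == w) && dwf (lcod l) ls' else true.
Fixpoint dcod (w : seq nat) (ls : seq layer) :=
  if ls is l :: ls' then dcod (lcod l) ls' else w.

Definition whisk (u v : seq nat) (l : layer) : layer := (u ++ l.1.1, l.1.2, l.2 ++ v).

Fixpoint layers (t : aterm) : option (seq nat * seq layer) :=
  match t with
  | AGen i => Some (gdom i, [:: ([::], i, [::])])
  | AId o => Some (flat o, [::])
  | AComp g f =>
      if (layers f, layers g) is (Some (w, lf), Some (w', lg)) then
        if dcod w lf == w' then Some (w, lf ++ lg) else None
      else None
  | ATens f g =>
      if (layers f, layers g) is (Some (w, lf), Some (w', lg)) then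
        Some (w ++ w', map (whisk [::] w') lf ++ map (whisk (dcod w lf) [::]) lg)
      else None
  end.

(* The interchange of two successive layers l, m acting on disjoint factors. *)
Definition swap_left (l m : layer) : option (layer * layer) :=
  let: ((u1, i, v1), (u2, j, v2)) := (l, m) in
  let w := drop (size u2 + size (gdom j)) u1 in
  if (u1 == u2 ++ gdom j ++ w) && (v2 == w ++ gcod i ++ v1)
  then Some ((u2, j, w ++ gdom i ++ v1), (u2 ++ gcod j ++ w, i, v1)) else None.

Definition swap_right (l m : layer) : option (layer * layer) :=
  let: ((u1, i, v1), (u2, j, v2)) := (l, m) in
  let w := drop (size u1 + size (gcod i)) u2 in
  if (u2 == u1 ++ gcod i ++ w) && (v1 == w ++ gdom j ++ v2)
  then Some ((u1 ++ gdom i ++ w, j, v2), (u1, i, w ++ gcod j ++ v2)) else None.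

(** Both swaps succeed when the first generator has empty codomain and the second, at the same
    place, has empty domain, as for an evaluation followed by a coevaluation. The results put them
    on different sides, so both are kept. *)
Definition swaps (l m : layer) : seq (layer * layer) :=
  pmap id [:: swap_left l m; swap_right l m].

Fixpoint sink (l : layer) (ls : seq layer) : seq layer :=
  if ls is m :: ls' then
    if swap_left l m is Some (m', l') then m' :: sink l' ls' else l :: ls
  else [:: l].

(** Bubble sort that applies layers acting further left first. It only has to be sound: a common
    form makes the syntactic comparison of two diagrams succeed. *)
Definition sort_layers (ls : seq layer) : seq layer :=
  iter (size ls) (foldr sink [::]) ls.

(* All ways to bring some layer to the front. *)
Fixpoint fronts (ls : seq layer) : seq (layer * seq layer) :=
  if ls is m :: ls' then
    (m, ls') ::
    flatten [seq [seq (p.1, p.2 :: zr.2) | p <- swaps m zr.1] | zr <- fronts ls']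
  else [::].

Fixpoint gather (u v : seq nat) (lhs ls : seq layer) : seq (seq layer) :=
  if lhs is l :: lhs' then
    flatten [seq (if zr.1 == whisk u v l then gather u v lhs' zr.2 else [::])
            | zr <- fronts ls]
  else [:: ls].

(* The whiskerings of l that give m. *)
Definition offsets (l m : layer) : seq (seq nat * seq nat) :=
  let u := take (size m.1.1 - size l.1.1) m.1.1 in
  let v := drop (size l.2) m.2 in
  if whisk u v l == m then [:: (u, v)] else [::].

(* All ways to delay the first layer: (pre, l, post). *)
Fixpoint delays (l : layer) (ls : seq layer) : seq (seq layer * seq layer) :=
  ([::], l :: ls) ::
  if ls is m :: ls' then
    flatten [seq [seq (p.1 :: d.1, d.2) | d <- delays p.2 ls'] | p <- swaps l m]
  else [::].

(* The same, but greedily moving to the front any later layer that commutes with l. *)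
Fixpoint hoists (n : nat) (l : layer) (ls : seq layer) : seq (seq layer * seq layer) :=
  ([::], l :: ls) ::
  if n is n'.+1 then
    if ohead (flatten [seq [seq (p, zr.2) | p <- swaps l zr.1] | zr <- fronts ls])
       is Some (p, r)
    then [seq (p.1 :: d.1, d.2) | d <- hoists n' p.2 r] else [::]
  else [::].

Definition match_head (lhs rhs ls : seq layer) : seq (seq layer) :=
  if (lhs, ls) is (l :: _, m :: _) then
    flatten [seq [seq map (whisk uv.1 uv.2) rhs ++ r | r <- gather uv.1 uv.2 lhs ls]
            | uv <- offsets l m]
  else [::].

(** A layer that feeds a later part of the redex, such as an arrow on the open strand of a snake,
    cannot be moved behind the redex. It has to pass before it, which is achieved by delaying the
    first layer of the redex. *)
Definition match_delayed (lhs rhs ls : seq layer) : seq (seq layer) :=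
  if ls is m :: ls' then
    flatten [seq [seq d.1 ++ r | r <- match_head lhs rhs d.2]
            | d <- delays m ls' ++ hoists (size ls') m ls']
  else [::].

Fixpoint matches (lhs rhs ls : seq layer) : seq (seq layer) :=
  match_delayed lhs rhs ls ++
  if ls is m :: ls' then [seq m :: r | r <- matches lhs rhs ls'] else [::].

Definition rewrite_once (rules : seq (seq layer * seq layer)) (ls : seq layer) :
    option (seq layer) :=
  ohead (flatten [seq matches r.1 r.2 ls | r <- rules]).

Fixpoint normalise (n : nat) rules ls :=
  let ls := sort_layers ls in
  if n is n'.+1 then
    if rewrite_once rules ls is Some ls' then normalise n' rules ls' else ls
  else ls.

Fixpoint rule_layers (rs : seq (aterm * aterm)) : option (seq (seq layer * seq layer)) :=
  if rs is (t, t') :: rs' then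
    if (layers t, layers t', rule_layers rs') is
       (Some (w, l), Some (w', l'), Some rl) then
      if (w == w') && (dcod w l == dcod w l') then Some ((sort_layers l, l') :: rl) else None
    else None
  else Some [::].

(* The constant only bounds the number of rewriting steps. *)
Definition diagram_eq (rs : seq (aterm * aterm)) (t t' : aterm) : bool :=
  if (layers t, layers t', rule_layers rs) is
     (Some (w, l), Some (w', l'), Some rl) then
    (w == w') && (normalise 60 rl l == normalise 60 rl l')
  else false.

(** * Interpretation of diagrams in a strict monoidal category, and soundness *)

Variable C : monoidal_category.
Variables (oe : seq (Ob C)) (me : seq (Mor C)).

Definition wob (w : seq nat) : Ob C := foldr (fun i X => nth one oe i ⊗ X) one w.
Fixpoint oev (o : oterm) : Ob C :=
  match o with OOne => one | OAtom i => nth one oe i | OTens a b => oev a ⊗ oev b end.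
Fixpoint aev (t : aterm) : Mor C :=
  match t with
  | AGen i => nth (idm one) me i
  | AId o => idm (oev o)
  | AComp g f => aev g ∘ aev f
  | ATens f g => aev f ⊠ aev g
  end.

Fixpoint typed_gens (ms : seq (Mor C)) (s : sigt) : Prop :=
  match ms, s with
  | m :: ms', t :: s' => hom m (oev t.1) (oev t.2) /\ typed_gens ms' s'
  | [::], [::] => True
  | _, _ => False
  end.

Fixpoint valid_rules (rs : seq (aterm * aterm)) : Prop :=
  if rs is (t, t') :: rs' then aev t = aev t' /\ valid_rules rs' else True.

Hypothesis me_typed : typed_gens me sg.

Lemma wob_cat u v : wob (u ++ v) = wob u ⊗ wob v.
Proof. by elim: u => [|i u IH] /=; rewrite ?tob1l // IH tobA. Qed.

Lemma oevE o : oev o = wob (flat o).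
Proof.
by elim: o => [|i|a IHa b IHb] /=; rewrite ?tob1r // wob_cat IHa IHb.
Qed.

Lemma gen_hom i : hom (nth (idm one) me i) (wob (gdom i)) (wob (gcod i)).
Proof.
rewrite /gdom /gcod -!oevE.
elim: me sg me_typed i => [|m ms IH] [|t s] //=.
  (* Outside the lists both [nth] return their defaults, which agree: the identity of the unit, with
     empty domain and codomain. *)
  by move=> _ i; rewrite !nth_nil; apply: idm_hom.
by case=> hm hs [|i] //=; apply: IH.
Qed.

Definition lev (l : layer) : Mor C :=
  idm (wob l.1.1) ⊠ nth (idm one) me l.1.2 ⊠ idm (wob l.2).
Fixpoint dev (w : seq nat) (ls : seq layer) : Mor C :=
  if ls is l :: ls' then dev (lcod l) ls' ∘ lev l else idm (wob w).

Lemma lev_hom l : hom (lev l) (wob (ldom l)) (wob (lcod l)).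
Proof.
rewrite /ldom /lcod !wob_cat !tobA.
exact: tmor_hom (tmor_hom (idm_hom _) (gen_hom _)) (idm_hom _).
Qed.

Lemma dev_hom w ls : dwf w ls -> hom (dev w ls) (wob w) (wob (dcod w ls)).
Proof.
elim: ls w => [|l ls IH] w /=; first by move=> _; apply: idm_hom.
by case/andP=> /eqP<- h; apply: compm_hom (lev_hom l) (IH _ h).
Qed.

Lemma dwf_cat w l1 l2 : dwf w (l1 ++ l2) = dwf w l1 && dwf (dcod w l1) l2.
Proof. by elim: l1 w => //= l ls IH w; rewrite IH andbA. Qed.

Lemma dcod_cat w l1 l2 : dcod w (l1 ++ l2) = dcod (dcod w l1) l2.
Proof. by elim: l1 w => //=. Qed.

Lemma dev_cat w l1 l2 : dwf w l1 -> dwf (dcod w l1) l2 ->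
  dev w (l1 ++ l2) = dev (dcod w l1) l2 ∘ dev w l1.
Proof.
elim: l1 w => [|l ls IH] w /=; first by move=> _ h; rewrite (compm_idr (dev_hom h)).
case/andP=> _ h h2.
by rewrite (IH _ h h2) (compmA (lev_hom l) (dev_hom h) (dev_hom h2)).
Qed.

Lemma ldom_whisk u v l : ldom (whisk u v l) = u ++ ldom l ++ v.
Proof. by rewrite /ldom /= !catA. Qed.
Lemma lcod_whisk u v l : lcod (whisk u v l) = u ++ lcod l ++ v.
Proof. by rewrite /lcod /= !catA. Qed.

Lemma dwf_whisk u v w ls : dwf w ls -> dwf (u ++ w ++ v) (map (whisk u v) ls).
Proof.
elim: ls w => //= l ls IH w /andP[/eqP<- h].
by rewrite ldom_whisk eqxx /= lcod_whisk; apply: IH.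
Qed.

Lemma dcod_whisk u v w ls :
  dcod (u ++ w ++ v) (map (whisk u v) ls) = u ++ dcod w ls ++ v.
Proof. by elim: ls w => //= l ls IH w; rewrite lcod_whisk IH. Qed.

Lemma lev_whisk u v l : lev (whisk u v l) = idm (wob u) ⊠ lev l ⊠ idm (wob v).
Proof.
case: l => [[a i] b]; rewrite /lev /= !wob_cat -!tmor_id.
have ha := idm_hom (wob a); have hb := idm_hom (wob b).
have hu := idm_hom (wob u); have hv := idm_hom (wob v).
have hg := gen_hom i.
rewrite -(tmorA hu ha hg) (tmorA (tmor_hom hu (tmor_hom ha hg)) hb hv).
by rewrite -(tmorA hu (tmor_hom ha hg) hb).
Qed.

Lemma dev_whisk u v w ls : dwf w ls ->
  dev (u ++ w ++ v) (map (whisk u v) ls) = idm (wob u) ⊠ dev w ls ⊠ idm (wob v).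
Proof.
have hu := idm_hom (wob u); have hv := idm_hom (wob v).
elim: ls w => [|l ls IH] w /=; first by rewrite !tmor_id !wob_cat tobA.
case/andP=> /eqP _ h; rewrite lcod_whisk (IH _ h) lev_whisk.
have hl := lev_hom l; have hd := dev_hom h.
rewrite -(tmor_comp (tmor_hom hu hl) (tmor_hom hu hd) hv hv) (compm_idl hv).
by rewrite -(tmor_comp hu hu hl hd) (compm_idl hu).
Qed.

Lemma layersP t w ls : layers t = Some (w, ls) -> dwf w ls /\ aev t = dev w ls.
Proof.
elim: t w ls => [i|o|g IHg f IHf|f IHf g IHg] w ls /=.
- case=> <- <- /=; rewrite /ldom /= cats0 eqxx; split=> //.
  rewrite /lev /lcod /= cats0 (tmor1l (gen_hom i)) (tmor1r (gen_hom i)).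
  by rewrite (compm_idl (gen_hom i)).
- by case=> <- <-; rewrite oevE.
- case: (layers f) IHf => [[wf lf]|] // /(_ _ _ erefl)[f1 f2].
  case: (layers g) IHg => [[wg lg]|] // /(_ _ _ erefl)[g1 g2].
  case: eqP => // e [<- <-]; rewrite dwf_cat f1 e g1 f2 g2.
  by rewrite dev_cat ?e.
case: (layers f) IHf => [[wf lf]|] // /(_ _ _ erefl)[f1 f2].
case: (layers g) IHg => [[wg lg]|] // /(_ _ _ erefl)[g1 g2] [<- <-].
have e1 := dcod_whisk [::] wg wf lf.
have e2 := dwf_whisk [::] wg f1; have e3 := dwf_whisk (dcod wf lf) [::] g1.
rewrite /= in e1 e2; rewrite cats0 in e3.
rewrite dwf_cat e1 e2 e3; split=> //.
rewrite dev_cat ?e1 // f2 g2.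
have:= dev_whisk [::] wg f1; rewrite /= => ->.
have:= dev_whisk (dcod wf lf) [::] g1; rewrite /= cats0 => ->.
have hf := dev_hom f1; have hg := dev_hom g1.
rewrite (tmor1l hf) (tmor1r (tmor_hom (idm_hom _) hg)).
rewrite -(tmor_comp hf (idm_hom _) (idm_hom _) hg).
by rewrite (compm_idl hf) (compm_idr hg).
Qed.

(** Well-formedness is a premise on the first list and a conclusion on the second, so the rewriting
    functions never have to check types themselves. *)
Definition deq (w : seq nat) (ls ls' : seq layer) : Prop :=
  dwf w ls -> [/\ dwf w ls', dcod w ls' = dcod w ls & dev w ls' = dev w ls].

Lemma deq_refl w ls : deq w ls ls. Proof. by []. Qed.

Lemma deq_trans w l1 l2 l3 : deq w l1 l2 -> deq w l2 l3 -> deq w l1 l3.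
Proof. by move=> h h' /h[/h'[? -> ->] -> ->]. Qed.

Lemma deq_cons w l l1 l2 : deq (lcod l) l1 l2 -> deq w (l :: l1) (l :: l2).
Proof. by move=> h; rewrite /deq /= => /andP[-> /h[-> -> ->]]. Qed.

Lemma deq_cat w l1 l1' l2 l2' :
  deq w l1 l1' -> deq (dcod w l1) l2 l2' -> deq w (l1 ++ l2) (l1' ++ l2').
Proof.
move=> h1 h2; rewrite /deq dwf_cat => /andP[w1 w2].
have [a1 a2 a3] := h1 w1; have [b1 b2 b3] := h2 w2.
by rewrite dwf_cat !dcod_cat !dev_cat ?a2 ?a1 ?b1 ?a3 ?b3.
Qed.

(** One identity serves both swaps: [swap_left] uses it from right to left and [swap_right] from
    left to right. *)
Lemma interchange u2 j w i v1 :
  lev (u2 ++ gcod j ++ w, i, v1) ∘ lev (u2, j, w ++ gdom i ++ v1) =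
  lev (u2, j, w ++ gcod i ++ v1) ∘ lev (u2 ++ gdom j ++ w, i, v1).
Proof.
rewrite /lev /= !wob_cat -!tmor_id.
have hu := idm_hom (wob u2); have hw := idm_hom (wob w); have hv := idm_hom (wob v1).
have hi := gen_hom i; have hj := gen_hom j.
set ui := idm (wob u2); set wi := idm (wob w); set vi := idm (wob v1).
set a := nth (idm one) me i; set b := nth (idm one) me j.
have di := idm_hom (wob (gdom i)); have ci := idm_hom (wob (gcod i)).
have dj := idm_hom (wob (gdom j)); have cj := idm_hom (wob (gcod j)).
have A x y X Y X' Y' : hom x X Y -> hom y X' Y' ->
    ui ⊠ (x ⊠ wi) ⊠ y ⊠ vi = ui ⊠ x ⊠ (wi ⊠ (y ⊠ vi)).
  move=> hx hy; rewrite (tmorA hu hx hw) -(tmorA (tmor_hom (tmor_hom hu hx) hw) hy hv).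
  by rewrite -(tmorA (tmor_hom hu hx) hw (tmor_hom hy hv)).
rewrite (A _ _ _ _ _ _ cj hi) (A _ _ _ _ _ _ dj hi).
have hbu := tmor_hom hu hj.
have hav := tmor_hom hw (tmor_hom hi hv).
rewrite -(tmor_comp hbu (tmor_hom hu cj) (tmor_hom hw (tmor_hom di hv)) hav).
rewrite -(tmor_comp (tmor_hom hu dj) hbu hav (tmor_hom hw (tmor_hom ci hv))).
rewrite !tmor_id.
have hbu' : hom (ui ⊠ b) (wob u2 ⊗ wob (gdom j)) (wob u2 ⊗ wob (gcod j)) by [].
by rewrite (compm_idl hbu') (compm_idr hbu') (compm_idl hav) (compm_idr hav).
Qed.

Lemma swap_leftP l m p w : swap_left l m = Some p -> deq w [:: l; m] [:: p.1; p.2].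
Proof.
case: l m p => [[u1 i] v1] [[u2 j] v2] [m' l']; rewrite /swap_left.
move: (drop _ _) => z /=; case: ifP => // /andP[/eqP-> /eqP->] [<- <-].
have := lev_hom (u2 ++ gcod j ++ z, i, v1); have := lev_hom (u2, j, z ++ gcod i ++ v1).
rewrite /deq /= /ldom /lcod /= -!catA !eqxx !andbT => h1 h2 /eqP<-.
by split=> //; rewrite (compm_idl h1) (compm_idl h2) interchange.
Qed.

Lemma swap_rightP l m p w : swap_right l m = Some p -> deq w [:: l; m] [:: p.1; p.2].
Proof.
case: l m p => [[u1 i] v1] [[u2 j] v2] [m' l']; rewrite /swap_right.
move: (drop _ _) => z /=; case: ifP => // /andP[/eqP-> /eqP->] [<- <-].
have := lev_hom (u1, i, z ++ gcod j ++ v2); have := lev_hom (u1 ++ gcod i ++ z, j, v2).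
rewrite /deq /= /ldom /lcod /= -!catA !eqxx !andbT => h1 h2 /eqP<-.
by split=> //; rewrite (compm_idl h1) (compm_idl h2) interchange.
Qed.

Lemma swapsP l m p w : p \in swaps l m -> deq w [:: l; m] [:: p.1; p.2].
Proof.
rewrite /swaps /=.
case e1: (swap_left l m) => [p1|]; case e2: (swap_right l m) => [p2|] //=;
  rewrite ?inE; do ?[case/orP]; move=> /eqP->;
  by [apply: swap_leftP | apply: swap_rightP].
Qed.

Lemma deq_swap w l m p r : deq w [:: l; m] [:: p.1; p.2] ->
  deq w (l :: m :: r) (p.1 :: p.2 :: r).
Proof.
move=> h; apply: (@deq_cat _ [:: l; m] [:: p.1; p.2] r r h); exact: deq_refl.
Qed.

Lemma sinkP w l ls : deq w (l :: ls) (sink l ls).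
Proof.
elim: ls w l => [|m ls IH] w l /=; first exact: deq_refl.
case e: (swap_left l m) => [[m' l']|]; last exact: deq_refl.
apply: (deq_trans (deq_swap (swap_leftP e))).
exact: deq_cons.
Qed.

Lemma sort_layersP w ls : deq w ls (sort_layers ls).
Proof.
rewrite /sort_layers; elim: (size ls) => [|n IH] /=; first exact: deq_refl.
apply: (deq_trans IH); move: (iter _ _ _) => {IH n} {}ls.
elim: ls w => [|l ls IH] w /=; first exact: deq_refl.
by apply: (deq_trans (l2 := l :: foldr sink [::] ls)); [exact: deq_cons | exact: sinkP].
Qed.

Lemma frontsP w ls zr : zr \in fronts ls -> deq w ls (zr.1 :: zr.2).
Proof.
elim: ls w zr => [|m ls IH] w zr //=; rewrite inE => /orP[/eqP->|]; first exact: deq_refl.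
case/flattenP=> s /mapP[[z r] /IH zrP ->] /mapP[p /swapsP pP ->] /=.
exact: deq_trans (deq_cons (zrP _)) (deq_swap (pP _)).
Qed.

Lemma gatherP w u v lhs ls r : r \in gather u v lhs ls ->
  deq w ls (map (whisk u v) lhs ++ r).
Proof.
elim: lhs w ls => [|l lhs IH] w ls /=; first by rewrite inE => /eqP->; apply: deq_refl.
case/flattenP=> s /mapP[zr /frontsP zrP ->]; case: eqP => // e /IH h.
by rewrite -e; apply: deq_trans (zrP _) (deq_cons (h _)).
Qed.

Lemma delaysP w l ls d : d \in delays l ls -> deq w (l :: ls) (d.1 ++ d.2).
Proof.
elim: ls w l d => [|m ls IH] w l d /=; first by rewrite inE => /eqP->; apply: deq_refl.
rewrite inE => /orP[/eqP->|]; first exact: deq_refl.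
case/flattenP=> s /mapP[p /swapsP pP ->] /mapP[d' /IH dP ->] /=.
exact: deq_trans (deq_swap (pP _)) (deq_cons (dP _)).
Qed.

Lemma hoistsP n w l ls d : d \in hoists n l ls -> deq w (l :: ls) (d.1 ++ d.2).
Proof.
elim: n w l ls d => [|n IH] w l ls d.
  by rewrite inE => /eqP->; apply: deq_refl.
rewrite [hoists _ _ _]/=; set s := flatten _; case e: (ohead s) => [[p r]|]; last first.
  by rewrite inE => /eqP->; apply: deq_refl.
rewrite inE => /orP[/eqP->|/mapP[d' /IH dP ->]]; first exact: deq_refl.
have: (p, r) \in s by case: s e => //= a s [->]; rewrite mem_head.
case/flattenP=> _ /mapP[zr /frontsP zP ->] /mapP[q /swapsP qP [ep er]].
rewrite ep er in dP *; apply: deq_trans (deq_cons (zP _)) _.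
exact: deq_trans (deq_swap (qP _)) (deq_cons (dP _)).
Qed.

Definition valid_rule (r : seq layer * seq layer) :=
  exists w, [/\ dwf w r.1, dwf w r.2, dcod w r.1 = dcod w r.2 & dev w r.1 = dev w r.2].

(** The domain of the first layer forces the ambient word to be [u ++ w0 ++ v]. An empty left side
    would leave [w] undetermined, which is why such rules never fire. *)
Lemma deq_rule r w u v : valid_rule r -> r.1 != [::] ->
  deq w (map (whisk u v) r.1) (map (whisk u v) r.2).
Proof.
case: r => [[|l lhs] rhs] // [w0 [/= a1 a2 a3 a4]] _ h.
have ew : w = u ++ w0 ++ v.
  by move: h a1 => /= /andP[/eqP<- _] /andP[/eqP<- _]; rewrite ldom_whisk.
rewrite ew dwf_whisk //.
have:= dcod_whisk u v w0 (l :: lhs) => /= ->.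
have:= dev_whisk u v (a1 : dwf w0 (l :: lhs)) => /= ->.
by rewrite dcod_whisk (dev_whisk u v a2) a3 a4.
Qed.

Lemma match_headP w r ls s : valid_rule r -> s \in match_head r.1 r.2 ls -> deq w ls s.
Proof.
rewrite /match_head; case: r => [lhs rhs] vr /=.
case: lhs vr => [|l lhs] vr //; case: ls => [|m ls] //.
case/flattenP=> t /mapP[[u v] _ ->] /mapP[r /(@gatherP w) h ->].
apply: (deq_trans h); apply: deq_cat; last exact: deq_refl.
exact: deq_rule vr _.
Qed.

Lemma match_delayedP w r ls s :
  valid_rule r -> s \in match_delayed r.1 r.2 ls -> deq w ls s.
Proof.
move=> vr; case: ls => [|m ls] //.
case/flattenP=> t /mapP[d dP ->] /mapP[x xP ->].
have h : deq w (m :: ls) (d.1 ++ d.2).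
  by move: dP; rewrite mem_cat => /orP[/delaysP|/hoistsP].
by apply: (deq_trans h); apply: deq_cat (@deq_refl _ _) (match_headP _ xP).
Qed.

Lemma matchesP w r ls s : valid_rule r -> s \in matches r.1 r.2 ls -> deq w ls s.
Proof.
move=> vr; elim: ls w s => [|m ls IH] w s //.
rewrite -[matches _ _ _]/(match_delayed r.1 r.2 (m :: ls) ++
  [seq m :: s | s <- matches r.1 r.2 ls]).
rewrite mem_cat => /orP[|/mapP[x /IH h ->]]; first exact: match_delayedP.
exact: deq_cons.
Qed.

Fixpoint all_valid (rl : seq (seq layer * seq layer)) : Prop :=
  if rl is r :: rl' then valid_rule r /\ all_valid rl' else True.

Lemma rewrite_onceP w rl ls s : all_valid rl -> rewrite_once rl ls = Some s -> deq w ls s.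
Proof.
move=> vrl e.
have {e} : s \in flatten [seq matches r.1 r.2 ls | r <- rl].
  by move: e; rewrite /rewrite_once; case: flatten => //= a l [->]; rewrite mem_head.
elim: rl vrl => //= r rl IH [vr vrl]; rewrite mem_cat => /orP[|/IH]; last exact.
exact: matchesP.
Qed.

Lemma normaliseP n w rl ls : all_valid rl -> deq w ls (normalise n rl ls).
Proof.
move=> vrl; elim: n ls => [|n IH] ls /=; first exact: sort_layersP.
have h := @sort_layersP w ls.
case e: rewrite_once => [s|] //.
exact: deq_trans h (deq_trans (rewrite_onceP vrl e) (IH _)).
Qed.

Lemma rule_layersP rs rl : valid_rules rs -> rule_layers rs = Some rl -> all_valid rl.
Proof.
elim: rs rl => [|[t t'] rs IH] rl /=; first by move=> _ [<-].
case=> ett' vrs.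
case e1: (layers t) => [[w l]|] //; case e2: (layers t') => [[w' l']|] //.
case e3: (rule_layers rs) => [rl'|] //; have {}IH := IH _ vrs e3.
case: ifP => // /andP[/eqP ew /eqP ec] [<-] /=; split=> //.
have [a1 a2] := layersP e1; have [b1 b2] := layersP e2; rewrite -ew in b1 b2 ec.
have [c1 c2 c3] := sort_layersP a1.
by exists w => /=; rewrite c2 c3 -a2 ett' b2.
Qed.

Lemma diagram_eq_sound rs t t' : valid_rules rs -> diagram_eq rs t t' -> aev t = aev t'.
Proof.
rewrite /diagram_eq => vrs.
case e1: (layers t) => [[w l]|] //; case e2: (layers t') => [[w' l']|] //.
case e3: (rule_layers rs) => [rl|] // /andP[/eqP ew /eqP en].
have vrl := rule_layersP vrs e3.
have [a1 a2] := layersP e1; have [b1 b2] := layersP e2; rewrite -ew in b1 b2.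
have [_ _ c3] := normaliseP 60 vrl a1; have [_ _ d3] := normaliseP 60 vrl b1.
by rewrite a2 b2 -c3 -d3 en.
Qed.

End Diagrams.

(** Through this class the tactic asks for the source and target of an opaque arrow. The answer
    comes from the [hom] facts in the context or from [synth]; the many [have h := ..._hom] that
    precede a call of [diag] are therefore type declarations of its generators. *)
Class typed_arrow (C : category) (f : Mor C) (X Y : Ob C) : Prop :=
  typed_arrow_hom : hom f X Y.
#[export] Hint Extern 0 (typed_arrow _ _ _) =>
  unfold typed_arrow; first [eassumption | synth] : typeclass_instances.

Ltac in_list x l :=
  lazymatch l with
  | nil => constr:(false) | x :: _ => constr:(true) | _ :: ?l' => in_list x l'
  end.
Ltac index_in x l :=
  lazymatch l with
  | x :: _ => constr:(O) | _ :: ?l' => let n := index_in x l' in constr:(S n)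
  end.
Ltac add_to x l :=
  lazymatch in_list x l with true => l | false => constr:(x :: l) end.

Ltac object_atoms X l :=
  lazymatch X with
  | @one _ => l
  | @tob _ ?A ?B => let l := object_atoms A l in object_atoms B l
  | _ => add_to X l
  end.
Ltac arrow_atoms t acc :=
  lazymatch t with
  | @compm _ ?g ?f => let acc := arrow_atoms f acc in arrow_atoms g acc
  | @tmor _ ?f ?g => let acc := arrow_atoms f acc in arrow_atoms g acc
  | @idm _ ?X =>
      lazymatch acc with (?ol, ?ml, ?hl) =>
        let ol := object_atoms X ol in constr:((ol, ml, hl)) end
  | _ =>
      lazymatch acc with (?ol, ?ml, ?hl) =>
        lazymatch in_list t ml with
        | true => acc
        | false =>
            let h := constr:(_ : typed_arrow t _ _) in
            lazymatch type of h with typed_arrow _ ?X ?Y =>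
              let X := eval simpl in X in
              let Y := eval simpl in Y in
              let ol := object_atoms X ol in
              let ol := object_atoms Y ol in
              constr:((ol, t :: ml, ((X, Y, h), hl)))
            end
        end
      end
  end.
Ltac reify_object ol X :=
  lazymatch X with
  | @one _ => constr:(OOne)
  | @tob _ ?A ?B =>
      let a := reify_object ol A in let b := reify_object ol B in constr:(OTens a b)
  | _ => let n := index_in X ol in constr:(OAtom n)
  end.
Ltac reify_arrow ol ml t :=
  lazymatch t with
  | @compm _ ?g ?f =>
      let a := reify_arrow ol ml g in let b := reify_arrow ol ml f in constr:(AComp a b)
  | @tmor _ ?f ?g =>
      let a := reify_arrow ol ml f in let b := reify_arrow ol ml g in constr:(ATens a b)
  | @idm _ ?X => let o := reify_object ol X in constr:(AId o)
  | _ => let n := index_in t ml in constr:(AGen n)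
  end.
Ltac reify_signature ol hl :=
  lazymatch hl with
  | tt => constr:(@nil (oterm * oterm))
  | ((?X, ?Y, _), ?hl') =>
      let x := reify_object ol X in let y := reify_object ol Y in
      let s := reify_signature ol hl' in constr:((x, y) :: s)
  end.
Ltac typing_proof hl :=
  lazymatch hl with
  | tt => constr:(I)
  | ((_, _, ?h), ?hl') => let p := typing_proof hl' in constr:(conj h p)
  end.
Ltac rule_atoms es acc :=
  lazymatch es with
  | tt => acc
  | (?es', ?e) =>
      lazymatch type of e with ?a = ?b =>
        let a := eval simpl in a in let b := eval simpl in b in
        let acc := arrow_atoms a acc in let acc := arrow_atoms b acc in
        rule_atoms es' acc
      end
  end.
Ltac reify_rules ol ml es :=
  lazymatch es with
  | tt => constr:(@nil (aterm * aterm))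
  | (?es', ?e) =>
      lazymatch type of e with ?a = ?b =>
        let a := eval simpl in a in let b := eval simpl in b in
        let x := reify_arrow ol ml a in let y := reify_arrow ol ml b in
        let r := reify_rules ol ml es' in constr:((x, y) :: r)
      end
  end.
Ltac rules_proof es :=
  lazymatch es with
  | tt => constr:(I) | (?es', ?e) => let p := rules_proof es' in constr:(conj e p)
  end.

(* [diagram es] proves an equation between arrows of a monoidal category from
   the axioms of strict monoidal categories and the equations [es], given as
   (tt, e1, ..., en) and used as rewrite rules from left to right. *)
Ltac diagram es :=
  lazymatch goal with
  | |- @eq (Mor ?D) ?a ?b =>
      let a := eval simpl in a in
      let b := eval simpl in b in
      let acc := constr:((@nil (Ob D), @nil (Mor D), tt)) in
      let acc := arrow_atoms a acc in
      let acc := arrow_atoms b acc in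
      let acc := rule_atoms es acc in
      lazymatch acc with (?ol, ?ml, ?hl) =>
        let sg := reify_signature ol hl in
        let x := reify_arrow ol ml a in
        let y := reify_arrow ol ml b in
        let rs := reify_rules ol ml es in
        let pf := typing_proof hl in
        let rp := rules_proof es in
        refine (@diagram_eq_sound sg _ ol ml pf rs x y rp _);
        vm_compute; reflexivity
      end
  end.
Tactic Notation "diag" := diagram constr:(tt).
Tactic Notation "diag" constr(e) := diagram constr:((tt, e)).
Tactic Notation "diag" constr(e) "," constr(f) := diagram constr:((tt, e, f)).
Tactic Notation "diag" constr(e) "," constr(f) "," constr(g) :=
  diagram constr:((tt, e, f, g)).
Tactic Notation "diag" constr(e) "," constr(f) "," constr(g) "," constr(h) :=
  diagram constr:((tt, e, f, g, h)).
Tactic Notation "diag" constr(e) "," constr(f) "," constr(g) "," constr(h)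
    "," constr(k) := diagram constr:((tt, e, f, g, h, k)).

(** * Duals, half braidings and centralisers *)

Section DualCalculus.
Context (C : rigid_category).
Local Notation "X ^v" := (ld (rld C) X) (at level 30, format "X ^v").
Local Notation ev := (ev (rld C)).
Local Notation coev := (coev (rld C)).

Lemma dual_coev (f : Mor C) X Y : hom f X Y ->
  (idm Y ⊠ dual f) ∘ coev Y = (f ⊠ idm (X^v)) ∘ coev X.
Proof.
move=> hf; rewrite (dualE hf).
diag (ld_snake (rld C) Y).
Qed.

Lemma ld_tens_ev (X Y : Ob C) : ev (X ⊗ Y) ∘ (ld_tens X Y ⊠ idm (X ⊗ Y)) =
  ev Y ∘ (idm (Y^v) ⊠ ev X ⊠ idm Y).
Proof. rewrite /ld_tens; diag (ld_snake (rld C) (X ⊗ Y)). Qed.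

Lemma ld_tens_inv_ev (X Y : Ob C) :
  ev Y ∘ (idm (Y^v) ⊠ ev X ⊠ idm Y) ∘ (ld_tens_inv X Y ⊠ idm (X ⊗ Y)) = ev (X ⊗ Y).
Proof.
rewrite /ld_tens_inv; diag (ld_snake (rld C) X), (ld_snake (rld C) Y).
Qed.

Lemma ev1_coev1 : ev one ∘ coev one = idm (one : Ob C).
Proof. by have := ld_snake (rld C) one => <-; diag. Qed.

Lemma coev1_ev1 : coev one ∘ ev one = idm (one^v).
Proof. by have := ld_snake' (rld C) one => <-; diag. Qed.

(** Characterises [ddual_Delta] by its pairing with [Y^v ⊗ X^v], which spares later proofs the
    explicit formula. *)
Lemma ddual_Delta_ev (X Y : Ob C) :
  ev (X^v) ∘ (idm (X^v^v) ⊠ ev (Y^v) ⊠ idm (X^v)) ∘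
    (ddual_Delta C X Y ⊠ idm (Y^v ⊗ X^v)) =
  ev ((X ⊗ Y)^v) ∘ (idm ((X ⊗ Y)^v^v) ⊠ ld_tens X Y).
Proof.
have h := ld_tens_hom X Y; have h1 := dual_hom h.
have h2 := ld_tens_inv_hom (Y^v) (X^v).
rewrite /ddual_Delta -(dual_ev h) -(ld_tens_inv_ev (Y^v) (X^v)).
by diag.
Qed.

Lemma ddual_epsE : ddual_eps C = ev (one^v) ∘ (idm (one^v^v) ⊠ coev one).
Proof.
have h : hom (coev one) one (one^v) by homs.
by rewrite /ddual_eps -(dual_ev h); have h1 := dual_hom h; diag.
Qed.

(** The object [D^v^v^v] is a left dual of [D^v^v] in two ways: by choice, and as the image of the
    duality of [D^v] and [D] under the monoidal functor of double duals. The two evaluations agree,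
    and [ddual_coev] says the same of the coevaluations. *)
Lemma ddual_ev D : ev (D^v^v) ∘ ddual_Delta C (D^v) D =
  ddual_eps C ∘ dual (dual (ev D)).
Proof.
have h := ld_tens_hom (D^v) D; have hD := ddual_Delta_hom (D^v) D.
have he : hom (ev D) (D^v ⊗ D) one by homs.
have h1 := dual_hom he; have h2 := dual_hom h1.
have e1 : ld_tens (D^v) D ∘ coev (D^v) = dual (ev D) ∘ coev one.
  apply: (ld_uniq (A := one) (X := D^v ⊗ D)); [homs|homs|].
  have -> : ev (D^v ⊗ D) ∘ ((dual (ev D) ∘ coev one) ⊠ idm (D^v ⊗ D)) = ev D.
    by diag (dual_ev he), ev1_coev1.
  by diag (ld_tens_ev (D^v) D), (ld_snake' (rld C) D), (ld_snake (rld C) (D^v)),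
    (ld_snake' (rld C) (D^v)).
have -> : ev (D^v^v) ∘ ddual_Delta C (D^v) D = 
   ev (D^v^v) ∘ (idm (D^v^v^v) ⊠ ev (D^v) ⊠ idm (D^v^v)) ∘
    (ddual_Delta C (D^v) D ⊠ coev (D^v)).
  by diag (ld_snake (rld C) (D^v)), (ld_snake' (rld C) (D^v)).
rewrite ddual_epsE.
have -> : ev (D^v^v) ∘ (idm (D^v^v^v) ⊠ ev (D^v) ⊠ idm (D^v^v)) ∘
    (ddual_Delta C (D^v) D ⊠ coev (D^v)) =
    ev ((D^v ⊗ D)^v) ∘ (idm ((D^v ⊗ D)^v^v) ⊠ (ld_tens (D^v) D ∘ coev (D^v))).
  by diag (ddual_Delta_ev (D^v) D).
rewrite e1.
by diag (dual_ev h1).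
Qed.

(** The analogue of [ld_uniq] for a product of two duals: the nested evaluation is a nondegenerate
    pairing. *)
Lemma ev2_uniq u v A X Y : hom u A (Y^v ⊗ X^v) -> hom v A (Y^v ⊗ X^v) ->
  ev Y ∘ (idm (Y^v) ⊠ ev X ⊠ idm Y) ∘ (u ⊠ idm (X ⊗ Y)) =
  ev Y ∘ (idm (Y^v) ⊠ ev X ⊠ idm Y) ∘ (v ⊠ idm (X ⊗ Y)) -> u = v.
Proof.
suff key w : hom w A (Y^v ⊗ X^v) ->
    w = ((ev Y ∘ (idm (Y^v) ⊠ ev X ⊠ idm Y) ∘ (w ⊠ idm (X ⊗ Y))) ⊠ idm (Y^v ⊗ X^v)) ∘
      (idm A ⊠ ((idm X ⊠ coev Y ⊠ idm (X^v)) ∘ coev X)).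
  by move=> hu hv e; rewrite (key u hu) (key v hv) e.
by move=> hw; diag (ld_snake' (rld C) X), (ld_snake' (rld C) Y).
Qed.

Lemma ddual_coev D : ddual_Delta C D (D^v) ∘ dual (dual (coev D)) =
  coev (D^v^v) ∘ ddual_eps C.
Proof.
have h := ld_tens_hom D (D^v); have hD := ddual_Delta_hom D (D^v).
have hc : hom (coev D) one (D ⊗ D^v) by homs.
have h1 := dual_hom hc; have h2 := dual_hom h1; have h3 := ddual_eps_hom C.
have e1 : dual (coev D) ∘ ld_tens D (D^v) = coev one ∘ ev (D^v).
  have -> : dual (coev D) ∘ ld_tens D (D^v) =
      coev one ∘ (ev one ∘ (dual (coev D) ∘ ld_tens D (D^v))).
    by diag coev1_ev1.
  congr (_ ∘ _).
  have -> : ev one ∘ (dual (coev D) ∘ ld_tens D (D^v)) =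
      ev (D ⊗ D^v) ∘ (ld_tens D (D^v) ⊠ coev D).
    by diag (dual_ev hc).
  by diag (ld_tens_ev D (D^v)), (ld_snake (rld C) D), (ld_snake' (rld C) D).
apply: (ev2_uniq (A := one^v^v) (X := D^v^v) (Y := D^v)); [homs|homs|].
have -> : ev (D^v) ∘ (idm (D^v^v) ⊠ ev (D^v^v) ⊠ idm (D^v)) ∘
    ((ddual_Delta C D (D^v) ∘ dual (dual (coev D))) ⊠ idm (D^v^v ⊗ D^v)) =
  ev (one^v) ∘ (idm (one^v^v) ⊠ (dual (coev D) ∘ ld_tens D (D^v))).
  by diag (ddual_Delta_ev D (D^v)), (dual_ev h1).
rewrite e1 ddual_epsE.
by diag (ld_snake (rld C) (D^v^v)), (ld_snake' (rld C) (D^v^v)).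
Qed.
End DualCalculus.

Section HalfBraidings.
Context (C : rigid_category).
Local Notation "X ^v" := (ld (rld C) X) (at level 30, format "X ^v").
Local Notation ev := (ev (rld C)).
Local Notation coev := (coev (rld C)).

Record half_braiding (T : functor C C) (DT : Ob C -> Ob C -> Mor C) (eT : Mor C)
    (N : Ob C) (s : Ob C -> Mor C) : Prop := HalfBraiding {
  hb_hom : forall Y, hom (s Y) (N ⊗ Y) (T Y ⊗ N);
  hb_nat : forall f Y Y', hom f Y Y' ->
    (fmap T f ⊠ idm N) ∘ s Y = s Y' ∘ (idm N ⊠ f);
  hb_tens : forall Y W, (DT Y W ⊠ idm N) ∘ s (Y ⊗ W) =
    (idm (T Y) ⊠ s W) ∘ (s Y ⊠ idm W);
  hb_one : (eT ⊠ idm N) ∘ s one = idm N }.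

(* For Y = D^v the inverse is built from s D and the duality of D^vv with D^v^vv;
   every object is the left dual of its right dual. *)
Lemma half_braiding_inv N s :
  half_braiding (ddual C) (ddual_Delta C) (ddual_eps C) N s ->
  forall Y, exists t, mutually_inverse (s Y) t (N ⊗ Y) (Y^v^v ⊗ N).
Proof.
case=> hs ns ts os Y.
have {}hs X : hom (s X) (N ⊗ X) (X^v^v ⊗ N) := hs X.
have dual_iso D : exists t, mutually_inverse (s (D^v)) t (N ⊗ D^v) (D^v^v^v ⊗ N).
  exists ((ev (D^v^v) ⊠ idm (N ⊗ D^v)) ∘ (idm (D^v^v^v) ⊠ s D ⊠ idm (D^v)) ∘
          (idm (D^v^v^v ⊗ N) ⊠ coev D)).
  have h1 := hs D; have h2 := hs (D^v); have h3 := hs (one : Ob C).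
  have he : hom (ev D) (D^v ⊗ D) one by homs.
  have hc : hom (coev D) one (D ⊗ D^v) by homs.
  have hee := ddual_hom he; have hcc := ddual_hom hc.
  have hD := ddual_Delta_hom (D^v) D; have hD' := ddual_Delta_hom D (D^v).
  have hp := ddual_eps_hom C.
  have h4 := hs (D^v ⊗ D); have h5 := hs (D ⊗ D^v).
  have n1 := ns _ _ _ he; have n2 := ns _ _ _ hc; rewrite /= in n1 n2.
  split; [homs|homs| |].
  (* Naturality of [s] along [ev D], with [s (D^v ⊗ D)] split by the tensor axiom, cancels [s (D^v)]
     against [s D]; the other inverse law uses [coev D] in the same way. *)
  - have e : (ev (D^v^v) ⊠ idm N) ∘ ((idm (D^v^v^v) ⊠ s D) ∘ (s (D^v) ⊠ idm D)) =
        idm N ⊠ ev D.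
      rewrite -ts.
      have -> : (ev (D^v^v) ⊠ idm N) ∘ ((ddual_Delta C (D^v) D ⊠ idm N) ∘ s (D^v ⊗ D)) =
          (ddual_eps C ⊠ idm N) ∘ ((dual (dual (ev D)) ⊠ idm N) ∘ s (D^v ⊗ D)).
        by diag (ddual_ev D).
      by rewrite n1; diag os.
    by diag e, (ld_snake' (rld C) D).
  have e : (idm (D^v^v) ⊠ s (D^v)) ∘ ((s D ⊠ idm (D^v)) ∘ (idm N ⊠ coev D)) =
      coev (D^v^v) ⊠ idm N.
    have -> : (idm (D^v^v) ⊠ s (D^v)) ∘ ((s D ⊠ idm (D^v)) ∘ (idm N ⊠ coev D)) =
        (ddual_Delta C D (D^v) ⊠ idm N) ∘ (s (D ⊗ D^v) ∘ (idm N ⊠ coev D)).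
      by have e := ts D (D^v); rewrite /= in e; diag e.
    by rewrite -n2; diag (ddual_coev D), os.
  by diag e, (ld_snake' (rld C) (D^v^v)).
have [R [e [c [he hc z1 z2]]]] := rright Y.
(* The inverse found at [R^v] is conjugated by the isomorphism from [Y] to [R^v] and its inverse,
   and naturality of [s] moves it to [Y]. *)
have hj : hom ((e ⊠ idm (R^v)) ∘ (idm Y ⊠ coev R)) Y (R^v) by homs.
have hk : hom ((ev R ⊠ idm Y) ∘ (idm (R^v) ⊠ c)) (R^v) Y by homs.
have jk : ((e ⊠ idm (R^v)) ∘ (idm Y ⊠ coev R)) ∘ ((ev R ⊠ idm Y) ∘ (idm (R^v) ⊠ c)) =
    idm (R^v) by diag z2, (ld_snake' (rld C) R).
have kj : ((ev R ⊠ idm Y) ∘ (idm (R^v) ⊠ c)) ∘ ((e ⊠ idm (R^v)) ∘ (idm Y ⊠ coev R)) =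
    idm Y by diag z1, (ld_snake (rld C) R).
move: jk kj hj hk; set j := (e ⊠ _) ∘ _; set k := (_ ⊠ idm Y) ∘ _ => jk kj hj hk.
have [t [_ ht ts1 ts2]] := dual_iso R.
have hjj := ddual_hom hj; have hkk := ddual_hom hk.
have h1 := hs Y; have h2 := hs (R^v).
have n := ns _ _ _ hk; rewrite /= in n.
have n' := ns _ _ _ hj; rewrite /= in n'.
have e2 := ddual_comp hj hk; rewrite kj ddual_id in e2.
exists ((idm N ⊠ k) ∘ t ∘ (dual (dual j) ⊠ idm N)); split; [homs|homs| |].
  have -> : (idm N ⊠ k) ∘ t ∘ (dual (dual j) ⊠ idm N) ∘ s Y =
      (idm N ⊠ k) ∘ t ∘ ((dual (dual j) ⊠ idm N) ∘ s Y) by diag.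
  by rewrite n'; diag ts1, kj.
have -> : s Y ∘ ((idm N ⊠ k) ∘ t ∘ (dual (dual j) ⊠ idm N)) =
    (s Y ∘ (idm N ⊠ k)) ∘ t ∘ (dual (dual j) ⊠ idm N) by diag.
by rewrite -n; diag ts2, (esym e2).
Qed.

End HalfBraidings.

(** * The universal property of a centraliser, transposed to [chi] *)

Section Centralisers.
Context (C : rigid_category) (T Z : functor C C) (zeta : Ob C -> Ob C -> Mor C).
Hypothesis cent : is_centraliser T Z zeta.
Local Notation "X ^v" := (ld (rld C) X) (at level 30, format "X ^v").
Local Notation ev := (ev (rld C)).
Local Notation coev := (coev (rld C)).
Local Notation chi := (cent_chi T zeta).

Lemma cent_zeta_hom X Y : hom (zeta X Y) ((T Y)^v ⊗ X ⊗ Y) (Z X).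
Proof. by have [[[h _] _] _] := (cent.1 X, cent.2); apply: h. Qed.

Lemma cent_chi_hom X Y : hom (chi X Y) (X ⊗ Y) (T Y ⊗ Z X).
Proof. by have h := cent_zeta_hom X Y; rewrite /cent_chi; homs. Qed.

Lemma cent_chi_natl f X X' Y : hom f X X' ->
  (idm (T Y) ⊠ fmap Z f) ∘ chi X Y = chi X' Y ∘ (f ⊠ idm Y).
Proof.
move=> hf; have e := cent.2 _ _ _ Y hf; have h := cent_zeta_hom X Y.
by have h' := cent_zeta_hom X' Y; rewrite /cent_chi; diag e.
Qed.

Lemma cent_chi_natr f X Y Y' : hom f Y Y' ->
  (fmap T f ⊠ idm (Z X)) ∘ chi X Y = chi X Y' ∘ (idm X ⊠ f).
Proof.
move=> hf; have [[_ e] _] := cent.1 X; have {}e := e _ _ _ hf.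
have h := cent_zeta_hom X Y; have h' := cent_zeta_hom X Y'.
have hT := fmap_hom T hf; have hd := dual_hom hT.
rewrite /cent_chi.
have -> : (idm (T Y') ⊠ zeta X Y') ∘ (coev (T Y') ⊠ idm (X ⊗ Y')) ∘ (idm X ⊠ f) =
    (idm (T Y') ⊠ (zeta X Y' ∘ (idm ((T Y')^v) ⊠ idm X ⊠ f))) ∘
      (coev (T Y') ⊠ idm (X ⊗ Y)) by diag.
by rewrite -e; diag (dual_coev hT).
Qed.

(** Under the duality of [T Y] and its dual, extranatural families out of the coend become natural
    families [X ⊗ Y -> T Y ⊗ P]. In this form no dual of an arrow remains. *)
Lemma cent_lift X P k :
  (forall Y, hom (k Y) (X ⊗ Y) (T Y ⊗ P)) ->
  (forall f Y Y', hom f Y Y' -> (fmap T f ⊠ idm P) ∘ k Y = k Y' ∘ (idm X ⊠ f)) ->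
  exists2 u, hom u (Z X) P & forall Y, (idm (T Y) ⊠ u) ∘ chi X Y = k Y.
Proof.
move=> hk nk; have [_ univ] := cent.1 X.
have [|u [[hu uk] _]] := univ P (fun Y => (ev (T Y) ⊠ idm P) ∘ (idm ((T Y)^v) ⊠ k Y)).
  split=> [Y|f Y Y' hf]; first by have h := hk Y; homs.
  have h := hk Y; have h' := hk Y'; have hT := fmap_hom T hf; have hd := dual_hom hT.
  have -> : (ev (T Y') ⊠ idm P) ∘ (idm ((T Y')^v) ⊠ k Y') ∘
      (idm ((T Y')^v) ⊠ idm X ⊠ f) =
      (ev (T Y') ⊠ idm P) ∘ (idm ((T Y')^v) ⊠ (k Y' ∘ (idm X ⊠ f))) by diag.
  by rewrite -(nk _ _ _ hf); diag (dual_ev hT).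
exists u => // Y; have h := hk Y; have hz := cent_zeta_hom X Y.
rewrite /cent_chi.
have -> : (idm (T Y) ⊠ u) ∘ ((idm (T Y) ⊠ zeta X Y) ∘ (coev (T Y) ⊠ idm (X ⊗ Y))) =
    (idm (T Y) ⊠ (u ∘ zeta X Y)) ∘ (coev (T Y) ⊠ idm (X ⊗ Y)) by diag.
by rewrite uk; diag (ld_snake (rld C) (T Y)).
Qed.

Lemma cent_uniq X P u v : hom u (Z X) P -> hom v (Z X) P ->
  (forall Y, (idm (T Y) ⊠ u) ∘ chi X Y = (idm (T Y) ⊠ v) ∘ chi X Y) -> u = v.
Proof.
move=> hu hv e; have [[hz ez] univ] := cent.1 X.
have zE w Y : hom w (Z X) P -> w ∘ zeta X Y =
    (ev (T Y) ⊠ idm P) ∘ (idm ((T Y)^v) ⊠ ((idm (T Y) ⊠ w) ∘ chi X Y)).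
  move=> hw; have h := cent_zeta_hom X Y; rewrite /cent_chi.
  by diag (ld_snake' (rld C) (T Y)).
have [|w [_ w1]] := univ P (fun Y => u ∘ zeta X Y).
  split=> [Y|f Y Y' hf]; first by have h := hz Y; homs.
  have h := hz Y; have h' := hz Y'; have hT := fmap_hom T hf; have hd := dual_hom hT.
  have -> : u ∘ zeta X Y ∘ (dual (fmap T f) ⊠ idm X ⊠ idm Y) =
    u ∘ (zeta X Y ∘ (dual (fmap T f) ⊠ idm X ⊠ idm Y)) by diag.
  by rewrite (ez _ _ _ hf); diag.
rewrite -(w1 u) ?(w1 v) //; split=> // Y.
by rewrite (zE _ _ hu) (zE _ _ hv) e.
Qed.

(* The family chi_{X,Y} ⊗ W stays jointly epic since W has a dual. *)
Lemma cent_uniq_tens X W P u v :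
  hom u (Z X ⊗ W) P -> hom v (Z X ⊗ W) P ->
  (forall Y, (idm (T Y) ⊠ u) ∘ (chi X Y ⊠ idm W) =
             (idm (T Y) ⊠ v) ∘ (chi X Y ⊠ idm W)) -> u = v.
Proof.
move=> hu hv e.
have uE w : hom w (Z X ⊗ W) P ->
    w = (idm P ⊠ ev W) ∘ (((w ⊠ idm (W^v)) ∘ (idm (Z X) ⊠ coev W)) ⊠ idm W).
  by move=> hw; diag (ld_snake (rld C) W).
rewrite (uE _ hu) (uE _ hv); congr (_ ∘ (_ ⊠ _)).
apply: (cent_uniq (X := X) (P := P ⊗ W^v)); [homs|homs|] => Y.
have hc := cent_chi_hom X Y.
have wE w : hom w (Z X ⊗ W) P ->
    (idm (T Y) ⊠ ((w ⊠ idm (W^v)) ∘ (idm (Z X) ⊠ coev W))) ∘ chi X Y =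
    (((idm (T Y) ⊠ w) ∘ (chi X Y ⊠ idm W)) ⊠ idm (W^v)) ∘ (idm (X ⊗ Y) ⊠ coev W).
  by move=> hw; diag.
by rewrite (wE _ hu) (wE _ hv) e.
Qed.

End Centralisers.

(** * Modules over a centraliser are half braidings *)

Section CentralisedModules.
Context (C : rigid_category) (T : functor C C) (DT : Ob C -> Ob C -> Mor C) (eT : Mor C).
Context (Z : monad C) (zeta : Ob C -> Ob C -> Mor C).
Hypothesis DT_hom : forall Y W, hom (DT Y W) (T (Y ⊗ W)) (T Y ⊗ T W).
Hypothesis eT_hom : hom eT (T one) one.
Hypothesis cm : is_cent_monad T DT eT Z zeta.
Local Notation chi := (cent_chi T zeta).

Lemma half_braiding_of_module N r : hom r (Z N) N ->
  r ∘ fmap Z r = r ∘ mu Z N -> r ∘ eta Z N = idm N ->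
  half_braiding T DT eT N (fun Y => (idm (T Y) ⊠ r) ∘ chi N Y).
Proof.
move=> hr rr re; have [cent e1 e2] := cm.
have hc X Y := cent_chi_hom cent X Y.
split.
- by move=> Y; have h := hc N Y; homs.
- move=> f Y Y' hf; have e := cent_chi_natr cent N hf.
  have h := hc N Y; have h' := hc N Y'.
  by diag e.
- move=> Y W; have h1 := hc N Y; have h2 := hc N W; have h3 := hc (Z N) W.
  have h4 := hc N (Y ⊗ W); have hD := DT_hom Y W.
  have e3 := cent_chi_natl cent W hr.
  have hZr := fmap_hom Z hr; have hm := mu_hom Z N.
  by diag (e2 N Y W), (esym rr), e3.
have h := hc N one.
by rewrite -[RHS]re e1; diag.
Qed.

(** The action [r] exists by universality. Its associativity compares arrows out of [Z (Z N)] and is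
    tested twice: against [chi (Z N) W], then against [chi N Y] tensored with [W]. There the
    defining equation of [mu Z] applies and leaves the tensor axiom of [s]. *)
Lemma module_of_half_braiding N s : half_braiding T DT eT N s ->
  exists r, [/\ hom r (Z N) N, r ∘ fmap Z r = r ∘ mu Z N, r ∘ eta Z N = idm N &
                forall Y, (idm (T Y) ⊠ r) ∘ chi N Y = s Y].
Proof.
case=> hs ns ts os; have [cent e1 e2] := cm.
have hc X Y := cent_chi_hom cent X Y.
have [r hr rs] := cent_lift cent hs ns.
have hZr := fmap_hom Z hr; have hm := mu_hom Z N.
exists r; split=> //; last first.
  have h := hc N one; rewrite e1 -os -rs.
  by diag.
apply: (cent_uniq cent (X := Z N) (P := N)); [homs|homs|] => W.
have h3 := hc (Z N) W; have h2 := hc N W.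
apply: (cent_uniq_tens cent (X := N) (W := W) (P := T W ⊗ N)); [homs|homs|] => Y.
have h1 := hc N Y; have h4 := hc N (Y ⊗ W); have hD := DT_hom Y W.
have e3 := cent_chi_natl cent W hr.
have := ts Y W; rewrite -!rs => e4.
have e5 : (idm (T Y) ⊠ ((idm (T W) ⊠ (r ∘ mu Z N)) ∘ chi (Z N) W)) ∘ (chi N Y ⊠ idm W) =
    (DT Y W ⊠ idm N) ∘ ((idm (T (Y ⊗ W)) ⊠ r) ∘ chi N (Y ⊗ W)) by diag (e2 N Y W).
by rewrite e5 e4; diag e3.
Qed.

End CentralisedModules.

(** * Comodule monads and modules over cross products *)

Section ComoduleMonadMorphisms.
Context (C : monoidal_category) (B : bimonad C).

Lemma comodule_monad_morphism_inv (K L : comodule_monad B) (f g : Ob C -> Mor C) :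
  comodule_monad_morphism K L f ->
  (forall X, mutually_inverse (f X) (g X) (K X) (L X)) ->
  comodule_monad_morphism L K g.
Proof.
case=> [[[hf nf] fm fe] fc] fg.
have hg X : hom (g X) (L X) (K X) by case: (fg X).
have gf X : g X ∘ f X = idm (K X) by case: (fg X).
have fgK X : f X ∘ g X = idm (L X) by case: (fg X).
have {}hf X : hom (f X) (K X) (L X) := hf X.
have cancel u v X Y : hom u X (K Y) -> hom v X (K Y) -> f Y ∘ u = f Y ∘ v -> u = v.
  move=> hu hv e; have h1 := hf Y; have h2 := hg Y.
  have -> : u = g Y ∘ (f Y ∘ u) by diag (gf Y).
  by rewrite e; diag (gf Y).
split; first split.
- split=> [X|h X Y hh] //.
  have h1 := hf X; have h2 := hg X; have h3 := hf Y; have h4 := hg Y.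
  have h5 := fmap_hom K hh; have h6 := fmap_hom L hh.
  apply: (cancel _ _ (L X) Y); [homs|homs|].
  have e := nf _ _ _ hh.
  have -> : f Y ∘ (fmap K h ∘ g X) = (f Y ∘ fmap K h) ∘ g X by diag.
  by rewrite -e; diag (fgK X), (fgK Y).
- move=> X; have h1 := hf X; have h2 := hg X; have m1 := mu_hom K X; have m2 := mu_hom L X.
  have h3 := fmap_hom K h1; have h4 := fmap_hom K h2.
  have h5 := hf (L X); have h6 := hg (L X); have h7 := fmap_hom L h2.
  have h8 := hg (K X); have h9 := hf (K X).
  apply: (cancel _ _ (L (L X)) X); [homs|homs|].
  have e := nf _ _ _ h2.
  have e2 : fmap K (f X) ∘ fmap K (g X) = idm (K (L X)).
    by rewrite -(fmap_comp K h2 h1) fgK fmap_id.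
  have e3 : f X ∘ (mu K X ∘ (g (K X) ∘ fmap L (g X))) =
      (f X ∘ mu K X) ∘ (g (K X) ∘ (fmap L (g X) ∘ (f (L X) ∘ g (L X)))).
    by rewrite fgK; diag.
  have e4 : fmap L (g X) ∘ (f (L X) ∘ g (L X)) = (f (K X) ∘ fmap K (g X)) ∘ g (L X).
    by rewrite -e; diag.
  by rewrite e3 fm e4; diag (gf (K X)), e2, (fgK X), (fgK (L X)).
- move=> X; have h1 := hf X; have h2 := hg X; have m1 := eta_hom K X.
  by rewrite -fe; diag (gf X).
move=> M X; have h1 := hf (M ⊗ X); have h2 := hg (M ⊗ X).
have h3 := hf M; have h4 := hg M; have c1 := coact_hom K M X; have c2 := coact_hom L M X.
have -> : coact K M X ∘ g (M ⊗ X) =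
    (g M ⊠ idm (B X)) ∘ ((f M ⊠ idm (B X)) ∘ coact K M X) ∘ g (M ⊗ X) by diag (gf M).
by rewrite -fc; diag (fgK (M ⊗ X)).
Qed.

Context (K : comodule_monad B) (t : Mor C).
Hypothesis t_hom : hom t (K one) one.
Hypothesis t_mu : t ∘ fmap K t = t ∘ mu K one.
Hypothesis t_eta : t ∘ eta K one = idm one.

(* The morphism K -> B corresponding to tensoring B-modules with the K-module
   structure t on the unit. *)
Definition unit_module_morphism (X : Ob C) : Mor C := (t ⊠ idm (B X)) ∘ coact K one X.

(** Multiplicativity combines [coact_mu] with the action law of [t]; compatibility with the
    coactions is coassociativity. *)
Lemma unit_module_morphismP :
  comodule_monad_morphism K (self_comodule B) unit_module_morphism.
Proof.
have hc X : hom (coact K one X) (K X) (K one ⊗ B X).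
  by rewrite -{2}(tob1l X); apply: coact_hom.
have hu X : hom (unit_module_morphism X) (K X) (B X).
  by have h := hc X; rewrite /unit_module_morphism; homs.
split; first split.
- split=> [X|f X Y hf]; first exact: hu.
  have := coact_nat K (idm_hom one) hf; rewrite (tmor1l hf) fmap_id => e.
  have h1 := hc X; have h2 := hc Y; have h3 := fmap_hom K hf; have h4 := fmap_hom B hf.
  by rewrite /unit_module_morphism /=; diag (esym e).
- move=> X; have e := coact_mu K one X; rewrite tob1l in e.
  have h1 := hc X; have h2 := coact_hom K (K one) (B X); have h3 := fmap_hom K h1.
  have h4 := hc (B X); have h5 := mu_hom K X; have h6 := mu_hom K one.
  have h7 := mu_hom B X; have h8 := fmap_hom K t_hom.
  rewrite {3}/unit_module_morphism (fmap_comp K h1 (tmor_hom t_hom (idm_hom _))).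
  have e' : coact K one (B X) ∘ fmap K (t ⊠ idm (B X)) =
      (fmap K t ⊠ idm (B (B X))) ∘ coact K (K one) (B X).
    by rewrite -(fmap_id B (B X)) (coact_nat K t_hom (idm_hom (B X))).
  have h9 : hom (fmap K (t ⊠ idm (B X))) (K (K one ⊗ B X)) (K (B X)).
    by rewrite -{2}(tob1l (B X)); apply: fmap_hom; homs.
  by rewrite /unit_module_morphism /=; diag e, e', t_mu.
- move=> X; have e := coact_eta K one X; rewrite tob1l in e.
  have h1 := hc X; have h2 := eta_hom K X; have h3 := eta_hom K one.
  by have h4 := eta_hom B X; rewrite /unit_module_morphism /=; diag e, t_eta.
move=> M X; have e := coactA K one M X; rewrite tob1l in e.
have h1 := hc (M ⊗ X); have h2 := hc M; have h3 := coact_hom K M X.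
have h4 := bDelta_hom B M X.
by rewrite /unit_module_morphism /=; diag e.
Qed.

End ComoduleMonadMorphisms.

Lemma unit_module_of_monad_morphism (C : monoidal_category) (B : bimonad C)
    (K : monad C) (f : Ob C -> Mor C) :
  monad_morphism K B f -> exists M : module K, carrier M = one.
Proof.
case=> [[hf nf] fm fe]; have h1 := hf one; rewrite /= in h1.
have h2 := beps_hom B; have h3 := fmap_hom K h1; have h4 := fmap_hom K h2.
have h5 := fmap_hom B h2; have h6 := mu_hom B one; have h7 := mu_hom K one.
have h8 := hf (B one); rewrite /= in h8.
have ht : hom (eps B ∘ f one) (K one) one by homs.
have tm : (eps B ∘ f one) ∘ fmap K (eps B ∘ f one) = (eps B ∘ f one) ∘ mu K one.
  rewrite (fmap_comp K h1 h2).
  by diag (fm one), (eps_mu B), (esym (nf _ _ _ h2)).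
have te : (eps B ∘ f one) ∘ eta K one = idm one.
  by have h9 := eta_hom K one; have h10 := eta_hom B one; diag (fe one), (eps_eta B).
by exists (Module ht tm te).
Qed.

(** * Modules over a cross product as H-modules with an action of T *)

Section CrossProductModules.
Context (C : monoidal_category) (H : monad C) (T : monad (EM H)) (TH : functor C C).
Hypothesis T_lift : same_functor (compF (forgetF H) T) (compF TH (forgetF H)).
Local Notation F := (freeF H).
Local Notation K := (cross_product H T).
Local Notation e := (@free_counit C H).

Lemma lift_ob (M : module H) : carrier (T M) = TH (carrier M).
Proof. exact: T_lift.1. Qed.

Lemma lift_mor f (M N : Ob (EM H)) : hom f M N ->
  em_arr (fmap T f) = fmap TH (em_arr f).
Proof. exact: T_lift.2. Qed.

(** The H-action is [t] restricted along the unit of T. The T-action [r] is [t] descended along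
    [T (e b)]. The section [eta H X] of the action of [b] is not H-linear, so T cannot be applied to
    it; since T lifts [TH], the arrow [fmap TH (eta H X)] splits [T (e b)] after forgetting to
    [C]. *)
Lemma module_of_cross_module (M : module K) : exists (b : Ob (EM H)) (r : Mor (EM H)),
  [/\ carrier b = carrier M, hom r (T b) b, r ∘ fmap T r = r ∘ mu T b,
      r ∘ eta T b = idm b & act M = em_arr (r ∘ fmap T (e b))].
Proof.
case: M => X t ht tm te /=.
pose i A := em_arr (eta T (F A)).
have hi A : hom (i A) (H A) (carrier (T (F A))) by apply: forgetF_hom (eta_hom T (F A)).
have eP (M : Ob (EM H)) : hom (e M) (F (carrier M)) M := free_counit_hom M.
have ha := act_hom (T (F X)); have hm := mu_hom H X; have h0 := eta_hom H X.
have hiX := hi X; have hHi := fmap_hom H hiX.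
have hmT := forgetF_hom (mu_hom T (F X)).
have hTe := forgetF_hom (fmap_hom T (eP (T (F X)))).
have hK := fmap_hom K ht; have hHt := fmap_hom H ht.
have ni : em_arr (fmap T (fmap F t)) ∘ i (carrier (T (F X))) = i X ∘ fmap H t.
  exact: (congr1 (@em_arr C H) (nat_sq (eta_nat T) (fmap_hom F ht))).
have mi : em_arr (mu T (F X)) ∘ em_arr (fmap T (e (T (F X)))) ∘ i (carrier (T (F X))) =
    act (T (F X)).
  have n : em_arr (fmap T (e (T (F X)))) ∘ i (carrier (T (F X))) =
      em_arr (eta T (T (F X))) ∘ act (T (F X)).
    exact: (congr1 (@em_arr C H) (nat_sq (eta_nat T) (eP (T (F X))))).
  have m : em_arr (mu T (F X)) ∘ em_arr (eta T (T (F X))) = idm (carrier (T (F X))).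
    exact: (congr1 (@em_arr C H) (mu_etal T (F X))).
  have h1 := hi (carrier (T (F X))); have h2 := forgetF_hom (eta_hom T (T (F X))).
  by diag n, m.
have li : act (T (F X)) ∘ fmap H (i X) = i X ∘ mu H X.
  by have [_ _ _ ->] := eta_hom T (F X).
have hKX := hi (carrier (T (F X))).
have hb : hom (t ∘ i X) (H X) X by homs.
have bm : (t ∘ i X) ∘ fmap H (t ∘ i X) = (t ∘ i X) ∘ mu H X.
  rewrite (fmap_comp H hiX ht).
  have tm' : t ∘ em_arr (fmap T (fmap F t)) =
      t ∘ (em_arr (mu T (F X)) ∘ em_arr (fmap T (e (T (F X))))) := tm.
  diag (esym ni), tm', mi, li.
have te' : t ∘ (i X ∘ eta H X) = idm X := te.
have be : (t ∘ i X) ∘ eta H X = idm X by diag te'.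
pose b : Ob (EM H) := Module hb bm be.
have hs : hom (fmap TH (eta H X)) (carrier (T b)) (carrier (T (F X))).
  by rewrite !lift_ob; apply: fmap_hom.
have hq : hom (em_arr (fmap T (e b))) (carrier (T (F X))) (carrier (T b)).
  exact: forgetF_hom (fmap_hom T (eP b)).
have qs : em_arr (fmap T (e b)) ∘ fmap TH (eta H X) = idm (carrier (T b)).
  rewrite (lift_mor (eP b)) lift_ob -fmap_id -be.
  exact: (esym (fmap_comp TH h0 hb)).
have hr : hom (t ∘ fmap TH (eta H X)) (carrier (T b)) X.
  exact: compm_hom hs ht.
(* The action [t] factors through [T (e b)]: moving the section past [T (e b)] produces a unit of H
   inside T, which the action law of [t] and the triangle identities absorb. *)
have rq : (t ∘ fmap TH (eta H X)) ∘ em_arr (fmap T (e b)) = t.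
  have hs' : hom (fmap TH (eta H (H X))) (carrier (T (F X))) (carrier (T (F (H X)))).
    by rewrite !lift_ob; apply: fmap_hom (eta_hom H (H X)).
  have hFi := forgetF_hom (fmap_hom T (fmap_hom F hiX)).
  have hFt := forgetF_hom (fmap_hom T (fmap_hom F ht)).
  have e1 : fmap TH (eta H X) ∘ em_arr (fmap T (e b)) =
      em_arr (fmap T (fmap F t)) ∘ (em_arr (fmap T (fmap F (i X))) ∘ fmap TH (eta H (H X))).
    rewrite (lift_mor (eP b)) -(fmap_comp TH hb h0) -(nat_sq (eta_nat H) hb).
    rewrite (fmap_comp TH (eta_hom H (H X)) (fmap_hom H hb)) (fmap_comp H hiX ht).
    rewrite (fmap_comp TH hHi hHt) (lift_mor (fmap_hom F hiX)) (lift_mor (fmap_hom F ht)).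
    by rewrite (compmA (fmap_hom TH (eta_hom H (H X))) (fmap_hom TH hHi) (fmap_hom TH hHt)).
  have tm' : t ∘ em_arr (fmap T (fmap F t)) =
      t ∘ (em_arr (mu T (F X)) ∘ em_arr (fmap T (e (T (F X))))) := tm.
  have e2 : em_arr (fmap T (e (T (F X)))) ∘ em_arr (fmap T (fmap F (i X))) =
      em_arr (fmap T (eta T (F X))) ∘ em_arr (fmap T (e (F X))).
    have hE := eta_hom T (F X); have hFE := fmap_hom F (forgetF_hom hE).
    have := congr1 (@em_arr C H) (fmap_comp T hFE (eP (T (F X)))).
    by rewrite -(free_counit_nat hE) (fmap_comp T (eP (F X)) hE).
  have e3 : em_arr (mu T (F X)) ∘ em_arr (fmap T (eta T (F X))) = idm (carrier (T (F X))).
    exact: (congr1 (@em_arr C H) (mu_etar T (F X))).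
  have e4 : em_arr (fmap T (e (F X))) ∘ fmap TH (eta H (H X)) = idm (carrier (T (F X))).
    rewrite (lift_mor (eP (F X))) lift_ob -fmap_id -(mu_etal H X).
    exact: (esym (fmap_comp TH (eta_hom H (H X)) hm)).
  have h5 := forgetF_hom (fmap_hom T (eta_hom T (F X))).
  have h6 := forgetF_hom (fmap_hom T (eP (F X))).
  by diag e1, tm', e2, e3, e4.
have tm' : t ∘ em_arr (fmap T (fmap F t)) =
    t ∘ (em_arr (mu T (F X)) ∘ em_arr (fmap T (e (T (F X))))) := tm.
have hFt := forgetF_hom (fmap_hom T (fmap_hom F ht)).
have lt : t ∘ act (T (F X)) = (t ∘ i X) ∘ fmap H t.
  by diag (esym mi), (esym tm'), ni.
pose t0 : Mor (EM H) := EmMor (T (F X)) b t.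
have ht0 : hom t0 (T (F X)) b by split.
set r := t ∘ fmap TH (eta H X) in hr rq.
pose r0 : Mor (EM H) := EmMor (T b) b r.
have hHr := fmap_hom H hr; have hHs := fmap_hom H hs; have hHq := fmap_hom H hq.
have haT := act_hom (T b).
have lr : r ∘ act (T b) = (t ∘ i X) ∘ fmap H r.
  have [_ _ _ lq] := fmap_hom T (eP b).
  have -> : r ∘ act (T b) = r ∘ (act (T b) ∘ fmap H (em_arr (fmap T (e b)))) ∘
      fmap H (fmap TH (eta H X)).
    have qs' : fmap H (em_arr (fmap T (e b))) ∘ fmap H (fmap TH (eta H X)) =
        idm (H (carrier (T b))) by rewrite -(fmap_comp H hs hq) qs fmap_id.
    by diag qs'.
  rewrite -lq {2}/r (fmap_comp H hs ht).
  by diag rq, lt.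
have hr0 : hom r0 (T b) b by split.
have hTt0 := forgetF_hom (fmap_hom T ht0); have hTr0 := forgetF_hom (fmap_hom T hr0).
(* The same non-linear section shows that [T (e (T (F X)))] can be cancelled on the right. *)
have epi u v : hom u (carrier (T (T (F X)))) X -> hom v (carrier (T (T (F X)))) X ->
    u ∘ em_arr (fmap T (e (T (F X)))) = v ∘ em_arr (fmap T (e (T (F X)))) -> u = v.
  move=> hu hv uv.
  have hsT : hom (fmap TH (eta H (carrier (T (F X))))) (carrier (T (T (F X))))
      (carrier (T (F (carrier (T (F X)))))).
    rewrite (lift_ob (T (F X))) (lift_ob (F (carrier (T (F X))))).
    exact (fmap_hom TH (eta_hom H (carrier (T (F X))))).
  have ss : em_arr (fmap T (e (T (F X)))) ∘ fmap TH (eta H (carrier (T (F X)))) =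
      idm (carrier (T (T (F X)))).
    rewrite (lift_mor (eP (T (F X)))) (lift_ob (T (F X))) -fmap_id -(act_eta (T (F X))).
    exact: (esym (fmap_comp TH (eta_hom H _) ha)).
  have cancel w : hom w (carrier (T (T (F X)))) X ->
      w = (w ∘ em_arr (fmap T (e (T (F X))))) ∘ fmap TH (eta H (carrier (T (F X)))).
    by move=> hw; diag ss.
  by rewrite (cancel u hu) (cancel v hv) uv.
(* This is the action law of the cross module with the counit at [T (F X)] cancelled. *)
have rt : r ∘ em_arr (fmap T t0) = t ∘ em_arr (mu T (F X)).
  apply: epi; [exact: compm_hom hTt0 hr | exact: compm_hom hmT ht |].
  have n : em_arr (fmap T t0) ∘ em_arr (fmap T (e (T (F X)))) =
      em_arr (fmap T (e b)) ∘ em_arr (fmap T (fmap F t)).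
    have := congr1 (@em_arr C H) (fmap_comp T (eP (T (F X))) ht0).
    by rewrite (free_counit_nat ht0) (fmap_comp T (fmap_hom F ht) (eP b)).
  by diag n, rq, tm'.
have rr : r ∘ em_arr (fmap T r0) = r ∘ em_arr (mu T b).
  have hTq := forgetF_hom (fmap_hom T (fmap_hom T (eP b))).
  have hmb := forgetF_hom (mu_hom T b).
  have hTs : hom (fmap TH (fmap TH (eta H X))) (carrier (T (T b))) (carrier (T (T (F X)))).
    by rewrite (lift_ob (T b)) (lift_ob (T (F X))); exact (fmap_hom TH hs).
  have ss : em_arr (fmap T (fmap T (e b))) ∘ fmap TH (fmap TH (eta H X)) =
      idm (carrier (T (T b))).
    rewrite (lift_mor (fmap_hom T (eP b))) (lift_ob (T b)) -fmap_id -qs.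
    exact: (esym (fmap_comp TH hs hq)).
  have -> : r ∘ em_arr (fmap T r0) =
      r ∘ (em_arr (fmap T r0) ∘ em_arr (fmap T (fmap T (e b)))) ∘
        fmap TH (fmap TH (eta H X)) by diag ss.
  have -> : em_arr (fmap T r0) ∘ em_arr (fmap T (fmap T (e b))) = em_arr (fmap T t0).
    apply: etrans (esym (congr1 (@em_arr C H) (fmap_comp T (fmap_hom T (eP b)) hr0))) _.
    congr (em_arr (fmap T _)); rewrite /t0 -[in RHS]rq.
    by have [<- _ _ _] := fmap_hom T (eP b).
  have n : em_arr (fmap T (e b)) ∘ em_arr (mu T (F X)) =
      em_arr (mu T b) ∘ em_arr (fmap T (fmap T (e b))).
    exact: (congr1 (@em_arr C H) (nat_sq (mu_nat T) (eP b))).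
  by diag rt, (esym rq), n, ss.
have re : r ∘ em_arr (eta T b) = idm X.
  have hEb := forgetF_hom (eta_hom T b).
  have n : em_arr (fmap T (e b)) ∘ i X = em_arr (eta T b) ∘ (t ∘ i X).
    exact: (congr1 (@em_arr C H) (nat_sq (eta_nat T) (eP b))).
  have -> : r ∘ em_arr (eta T b) = r ∘ (em_arr (eta T b) ∘ (t ∘ i X)) ∘ eta H X.
    by diag te'.
  by rewrite -n; diag rq, te'.
exists b, r0; split=> //.
- have [d1 _ _ _] := fmap_hom T hr0; have [d2 _ _ _] := mu_hom T b.
  by rewrite /= /em_comp /= rr d1 d2.
- by have [d _ _ _] := eta_hom T b; rewrite /= /em_comp /= re d.
Qed.

Lemma cross_module_of_module (b : Ob (EM H)) (r : Mor (EM H)) :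
  hom r (T b) b -> r ∘ fmap T r = r ∘ mu T b -> r ∘ eta T b = idm b ->
  exists M : module K, carrier M = carrier b.
Proof.
move=> hr rr re.
have he := free_counit_hom b; have hTe := fmap_hom T he.
pose t := r ∘ fmap T (e b).
have ht : hom t (T (F (carrier b))) b by exact: compm_hom hTe hr.
have hm := mu_hom T (F (carrier b)); have hmb := mu_hom T b.
have hP := free_counit_hom (T (F (carrier b))).
have hFt := fmap_hom F (forgetF_hom ht).
have tm : t ∘ fmap T (fmap F (em_arr t)) = t ∘ cross_mul T (carrier b).
  rewrite {1}/t -(compmA (fmap_hom T hFt) hTe hr) -(fmap_comp T hFt he).
  rewrite -[fmap F (em_arr t)]/(fmap F (fmap (forgetF H) t)) -(free_counit_nat ht).
  rewrite (fmap_comp T hP ht) /t (fmap_comp T hTe hr).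
  have hTTe := fmap_hom T hTe; have hTP := fmap_hom T hP; have hTr := fmap_hom T hr.
  rewrite -(compmA hTP hTTe hTr) (compmA (compm_hom hTP hTTe) hTr hr) rr.
  rewrite -(compmA (compm_hom hTP hTTe) hmb hr) (compmA hTP hTTe hmb).
  have n : fmap T (e b) ∘ mu T (F (carrier b)) = mu T b ∘ fmap T (fmap T (e b)).
    exact: (nat_sq (mu_nat T) he).
  rewrite -n -(compmA hTP hm hTe) /cross_mul.
  by rewrite (compmA (compm_hom hTP hm) hTe hr).
have te : em_arr t ∘ eta K (carrier b) = idm (carrier b).
  have hE := eta_hom T (F (carrier b)).
  have h0 := eta_hom H (carrier b).
  rewrite [eta K _]/=  /cross_eta (compmA h0 (forgetF_hom hE) (forgetF_hom ht)).
  have -> : em_arr t ∘ fmap (forgetF H) (eta T (F (carrier b))) = act b.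
    rewrite -[LHS]/(em_arr (t ∘ eta T (F (carrier b)))) /t -(compmA hE hTe hr).
    have n : fmap T (e b) ∘ eta T (F (carrier b)) = eta T b ∘ e b.
      exact: (nat_sq (eta_nat T) he).
    by rewrite n (compmA he (eta_hom T b) hr) re (compm_idl he).
  exact: act_eta.
exists (@Module C K (carrier b) (em_arr t) (forgetF_hom ht)
  (congr1 (@em_arr C H) tm) te).
by [].
Qed.

End CrossProductModules.

(** * Dual modules and characters of Hopf monads *)

Section DualModules.
Context (C : rigid_category) (H : hopf_monad C).
Local Notation "X ^v" := (ld (rld C) X) (at level 30, format "X ^v").
Local Notation ev := (ev (rld C)).
Local Notation coev := (coev (rld C)).
Local Notation VH := (EMrigid H).
Local Notation dm M := (ld (hld H) M).

(** Duals of modules are chosen over the duals of [C], so the forgetful functor preserves duals of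
    arrows strictly. This brings the double dual of modules, with its monoidal structure, down to
    the one of [C]. *)
Lemma em_dual (f : Mor VH) (M N : Ob VH) : hom f M N ->
  em_arr (dual f) = dual (em_arr f).
Proof.
move=> hf; have hf' := forgetF_hom hf.
by rewrite (dualE hf) (dualE hf') /= hld_ev hld_coev !hld_ob.
Qed.

Lemma em_ld_tens (M N : Ob VH) :
  em_arr (ld_tens M N) = ld_tens (carrier M) (carrier N).
Proof. by rewrite /ld_tens /= !hld_ev !hld_coev !hld_ob. Qed.

Lemma em_ddual_Delta (M N : Ob VH) :
  em_arr (ddual_Delta VH M N) = ddual_Delta C (carrier M) (carrier N).
Proof.
rewrite /ddual_Delta; set t := ld_tens_inv _ _.
rewrite -[LHS]/(em_arr t ∘ em_arr (@dual VH (@ld_tens VH M N))).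
rewrite (em_dual (ld_tens_hom M N)) em_ld_tens /t.
by rewrite /ld_tens_inv /= !hld_ev !hld_coev !hld_ob /= !hld_ob.
Qed.

Lemma em_ddual_eps : em_arr (ddual_eps VH) = ddual_eps C.
Proof.
rewrite -[LHS]/(em_arr (Defs.ev (hld H) (one : Ob VH)) ∘
  em_arr (@dual VH (Defs.coev (hld H) (one : Ob VH)))).
by rewrite (em_dual (coev_hom (hld H) (one : Ob VH))) hld_ev hld_coev.
Qed.

Lemma em_ddual_mor (f : Mor VH) (M N : Ob VH) : hom f M N ->
  em_arr (dual (dual f)) = dual (dual (em_arr f)).
Proof. by move=> hf; rewrite (em_dual (dual_hom hf)) (em_dual hf). Qed.

Lemma ddual_carrier (M : Ob VH) : carrier (ddual VH M) = (carrier M)^v^v.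
Proof. by rewrite /= !hld_ob. Qed.

Lemma act_ld_hom (M : Ob VH) : hom (act (dm M)) (H ((carrier M)^v)) ((carrier M)^v).
Proof. by rewrite -hld_ob; apply: act_hom. Qed.

Lemma act_ev (M : Ob VH) : let X := carrier M in
  ev X ∘ ((act (dm M) ⊠ act M) ∘ Delta H (X^v) X) = eps H ∘ fmap H (ev X).
Proof. by have [_ _ _] := ev_hom (hld H) M; rewrite /= hld_ev hld_ob. Qed.

Lemma act_coev (M : Ob VH) : let X := carrier M in
  coev X ∘ eps H = ((act M ⊠ act (dm M)) ∘ Delta H X (X^v)) ∘ fmap H (coev X).
Proof. by have [_ _ _] := coev_hom (hld H) M; rewrite /= hld_coev hld_ob. Qed.

Lemma act_dual_linear (f : Mor C) (M N : Ob VH) :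
  hom f (carrier M) (carrier N) -> f ∘ act M = act N ∘ fmap H f ->
  dual f ∘ act (dm N) = act (dm M) ∘ fmap H (dual f).
Proof.
move=> hf lf; have h : @hom VH (EmMor M N f) M N by split.
by have [_ _ _] := dual_hom h; rewrite (em_dual h).
Qed.

(** The witness is the dual of [b] transported to the unit object. With trivial carriers and a
    strict tensor product the inverse laws hold on the nose: linearity of the coevaluation gives
    [b ⊗ b' = 1], that of the evaluation gives [b' ⊗ b = 1]. *)
Lemma character_inverse (b : Ob VH) : carrier b = one -> exists b' : Ob VH,
  [/\ carrier b' = one, act b' = dual_character_act b,
      @tob (EMmon H) b b' = @one (EMmon H) & @tob (EMmon H) b' b = @one (EMmon H)].
Proof.
move=> eb; have hx := act_ld_hom b; have ce := act_coev b; have ee := act_ev b.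
rewrite /= eb in hx ce ee.
have ha := act_hom b; rewrite eb in ha.
have hc : hom (coev one) one ((one : Ob C)^v) by homs.
have he : hom (ev one) ((one : Ob C)^v) one by homs.
have hHc := fmap_hom H hc; have hHe := fmap_hom H he.
have m1 := act_mu (dm b); have m2 := act_eta (dm b); rewrite hld_ob eb in m1 m2.
have hHx := fmap_hom H hx; have h1 := mu_hom H ((one : Ob C)^v).
have h2 := eta_hom H ((one : Ob C)^v); have h3 := mu_hom H (one : Ob C).
have h4 := eta_hom H (one : Ob C); have hHHc := fmap_hom H hHc.
have d_hom : hom (dual_character_act b) (H one) one.
  by rewrite /dual_character_act; homs.
have c_e : fmap H (coev one) ∘ fmap H (ev one) = idm (H (one^v)).
  by rewrite -(fmap_comp H he hc) coev1_ev1 fmap_id.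
have d_mu : dual_character_act b ∘ fmap H (dual_character_act b) =
    dual_character_act b ∘ mu H one.
  rewrite /dual_character_act (fmap_comp H (compm_hom hHc hx) he) (fmap_comp H hHc hx).
  have n : fmap H (coev one) ∘ mu H one = mu H (one^v) ∘ fmap H (fmap H (coev one)).
    exact: (nat_sq (mu_nat H) hc).
  by diag n, c_e, m1.
have d_eta : dual_character_act b ∘ eta H one = idm one.
  have n : fmap H (coev one) ∘ eta H one = eta H (one^v) ∘ coev one.
    exact: (nat_sq (eta_nat H) hc).
  by rewrite /dual_character_act; diag n, m2, (ev1_coev1 C).
exists (Module d_hom d_mu d_eta); split=> //.
- apply: module_eq; rewrite /= eb; first exact: tob1l.
  rewrite /dual_character_act.
  have n := Delta_nat (bm_oplax H) (idm_hom one) hc.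
  rewrite fmap_id (tmor1l hc) in n.
  have -> : eps H = ev one ∘ (coev one ∘ eps H).
    by have h := beps_hom H; diag (ev1_coev1 C).
  rewrite ce.
  have hD := bDelta_hom H one one; rewrite tob1l in hD.
  have hD' := bDelta_hom H one (one^v); rewrite tob1l in hD'.
  by diag (esym n).
apply: module_eq; rewrite /= eb; first exact: tob1l.
rewrite /dual_character_act.
have n := Delta_nat (bm_oplax H) hc (idm_hom one).
rewrite fmap_id (tmor1r hc) in n.
have -> : eps H = (eps H ∘ fmap H (ev one)) ∘ fmap H (coev one).
  rewrite -(compmA hHc hHe (beps_hom H)) -(fmap_comp H hc he) ev1_coev1 fmap_id.
  by rewrite (compm_idr (beps_hom H)).
rewrite -ee.
have hD := bDelta_hom H one one; rewrite tob1l in hD.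
have hD' := bDelta_hom H (one^v) one; rewrite tob1r in hD'.
by diag (esym n).
Qed.

End DualModules.

(* The comparison of the centralisers of T and of the identity functor given by
   an invertible object b with a half braiding b ⊗ Y ≅ T(Y) ⊗ b. *)
Section TwistedComparison.
Context (C : rigid_category) (T Q Z : functor C C) (xi zeta : Ob C -> Ob C -> Mor C).
Hypothesis centQ : is_centraliser T Q xi.
Hypothesis centZ : is_centraliser (idF C) Z zeta.
Context (b b' : Ob C) (e c e' c' : Mor C) (s t : Ob C -> Mor C).
Hypothesis (e_hom : hom e (b ⊗ b') one) (c_hom : hom c one (b ⊗ b')).
Hypothesis (e'_hom : hom e' (b' ⊗ b) one) (c'_hom : hom c' one (b' ⊗ b)).
Hypothesis (ec : e ∘ c = idm one) (ce : c ∘ e = idm (b ⊗ b')).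
Hypothesis ec' : e' ∘ c' = idm one.
Hypothesis ee' : idm b ⊠ e' = e ⊠ idm b.
Hypothesis st : forall Y, mutually_inverse (s Y) (t Y) (b ⊗ Y) (T Y ⊗ b).
Hypothesis s_nat : forall f Y Y', hom f Y Y' ->
  (fmap T f ⊠ idm b) ∘ s Y = s Y' ∘ (idm b ⊠ f).
Context (P : Ob C) (k : Mor C).
Hypothesis k_hom : hom k (Q (b ⊗ P)) (b ⊗ Z P).
Local Notation chi := (cent_chi (idF C) zeta).
Local Notation xi' := (cent_chi T xi).
Hypothesis k_xi : forall Y,
  (idm (T Y) ⊠ k) ∘ xi' (b ⊗ P) Y = (s Y ⊠ idm (Z P)) ∘ (idm b ⊠ chi P Y).

Lemma comparison_iso : exists l, mutually_inverse k l (Q (b ⊗ P)) (b ⊗ Z P).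
Proof.
have hs Y : hom (s Y) (b ⊗ Y) (T Y ⊗ b) by case: (st Y).
have ht Y : hom (t Y) (T Y ⊗ b) (b ⊗ Y) by case: (st Y).
have ts Y : t Y ∘ s Y = idm (b ⊗ Y) by case: (st Y).
have stK Y : s Y ∘ t Y = idm (T Y ⊗ b) by case: (st Y).
have hchi X Y : hom (chi X Y) (X ⊗ Y) (Y ⊗ Z X) := cent_chi_hom centZ X Y.
have hxi := cent_chi_hom centQ.
have t_nat f Y Y' : hom f Y Y' -> (idm b ⊠ f) ∘ t Y = t Y' ∘ (fmap T f ⊠ idm b).
  move=> hf; have h1 := hs Y; have h2 := ht Y; have h3 := hs Y'; have h4 := ht Y'.
  have h5 := fmap_hom T hf.
  have -> : (idm b ⊠ f) ∘ t Y = t Y' ∘ (s Y' ∘ (idm b ⊠ f)) ∘ t Y by diag (ts Y').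
  by rewrite -(s_nat hf); diag (stK Y).
have z : (e ⊠ idm b) ∘ (idm b ⊠ c') = idm b by rewrite -ee'; diag ec'.
have cc' : c ⊠ idm b = idm b ⊠ c'.
  have -> : c ⊠ idm b = (c ∘ e) ⊠ idm b ∘ (idm b ⊠ c') by diag z.
  by rewrite ce; diag.
set R := Q (b ⊗ P); have hk : hom k R (b ⊗ Z P) := k_hom.
(* The family that defines the inverse, from [P ⊗ Y] to [Y ⊗ b' ⊗ R]: create [b' ⊗ b], apply the
   universal arrow of Q to [b ⊗ P], create [b ⊗ b'] behind [T Y], move [T Y] back across [b] with
   [t], and cancel [b' ⊗ b]. *)
pose lam Y := (e' ⊠ idm (Y ⊗ b' ⊗ R)) ∘
  (idm b' ⊠ (((t Y ⊠ idm b') ∘ (idm (T Y) ⊠ c)) ⊠ idm R)) ∘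
  (idm b' ⊠ xi' (b ⊗ P) Y) ∘ (c' ⊠ idm (P ⊗ Y)).
have hxi' Y : hom (xi' (b ⊗ P) Y) (b ⊗ P ⊗ Y) (T Y ⊗ R) := hxi (b ⊗ P) Y.
have [||l' hl' l'E] := cent_lift centZ (X := P) (P := b' ⊗ R) (k := lam).
- move=> Y /=; have h1 := ht Y; have h2 := hxi' Y.
  by rewrite /lam; homs.
- move=> f Y Y' hf /=; have h1 := ht Y; have h2 := hxi' Y.
  have h3 := ht Y'; have h4 := hxi' Y'; have h5 := fmap_hom T hf.
  have n := cent_chi_natr centQ (b ⊗ P) hf; rewrite -/R in n.
  by rewrite /lam; diag (t_nat _ _ _ hf), n.
rewrite /= in hl' l'E.
exists ((e ⊠ idm R) ∘ (idm b ⊠ l')); split => //; first by homs.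
- apply: (cent_uniq centQ (X := b ⊗ P) (P := R)); [homs|homs|] => Y.
  have h1 := ht Y; have h2 := hxi' Y; have h3 := hs Y; have h4 := hchi P Y.
  have -> : (idm (T Y) ⊠ ((e ⊠ idm R) ∘ (idm b ⊠ l') ∘ k)) ∘ xi' (b ⊗ P) Y =
     (idm (T Y) ⊠ e ⊠ idm R) ∘ (s Y ⊠ idm (b' ⊗ R)) ∘
       (idm b ⊠ ((idm Y ⊠ l') ∘ chi P Y)) by diag (k_xi Y).
  rewrite l'E /lam.
  by diag ee', z, (stK Y), ec.
(* Uniqueness concerns arrows out of [Z P], not out of [b ⊗ Z P]; both sides are put into the shape
   [(e ⊠ _) ∘ (idm b ⊠ _)] so that [b] can be stripped. *)
have -> : idm (b ⊗ Z P) = (e ⊠ idm (b ⊗ Z P)) ∘ (idm b ⊠ (c' ⊠ idm (Z P))).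
  by diag (esym ee'), ec'.
have -> : k ∘ ((e ⊠ idm R) ∘ (idm b ⊠ l')) =
    (e ⊠ idm (b ⊗ Z P)) ∘ (idm b ⊠ ((idm b' ⊠ k) ∘ l')) by diag.
congr (_ ∘ (_ ⊠ _)).
apply: (cent_uniq centZ (X := P) (P := b' ⊗ b ⊗ Z P)); [homs|homs|] => Y.
have h1 := ht Y; have h2 := hxi' Y; have h3 := hs Y; have h4 := hchi P Y.
have -> : (idm (idF C Y) ⊠ ((idm b' ⊠ k) ∘ l')) ∘ chi P Y =
    (idm (Y ⊗ b') ⊠ k) ∘ ((idm Y ⊠ l') ∘ chi P Y) by diag.
rewrite l'E /lam.
have kx := k_xi Y; rewrite /= in kx.
by diag kx, cc', (ts Y), ec'.
Qed.
End TwistedComparison.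

(** * Endomorphisms of H given by functionals on H(1) *)

Section Convolution.
Context (C : monoidal_category) (H : bimonad C).

(** For a Hopf algebra, [convl] and [convr] are the winding maps [h ↦ x(h1) h2] and
    [h ↦ h1 x(h2)]. *)
Definition convl (x : Mor C) (X : Ob C) : Mor C := (x ⊠ idm (H X)) ∘ Delta H one X.
Definition convr (x : Mor C) (X : Ob C) : Mor C := (idm (H X) ⊠ x) ∘ Delta H X one.

(** The objects [one ⊗ X] and [X] are equal but not convertible; restating the type keeps
    [H (one ⊗ X)] from becoming a separate atom of [diag]. *)
Lemma Delta1l_hom X : hom (Delta H one X) (H X) (H one ⊗ H X).
Proof. by rewrite -{2}(tob1l X); apply: bDelta_hom. Qed.
Lemma Delta1r_hom X : hom (Delta H X one) (H X) (H X ⊗ H one).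
Proof. by rewrite -{2}(tob1r X); apply: bDelta_hom. Qed.

Lemma convl_hom x X : hom x (H one) one -> hom (convl x X) (H X) (H X).
Proof. by move=> hx; have h := Delta1l_hom X; rewrite /convl; homs. Qed.
Lemma convr_hom x X : hom x (H one) one -> hom (convr x X) (H X) (H X).
Proof. by move=> hx; have h := Delta1r_hom X; rewrite /convr; homs. Qed.

Lemma convl_nat x f X Y : hom x (H one) one -> hom f X Y ->
  fmap H f ∘ convl x X = convl x Y ∘ fmap H f.
Proof.
move=> hx hf; have n := Delta_nat (bm_oplax H) (idm_hom one) hf.
rewrite fmap_id (tmor1l hf) in n.
have h := Delta1l_hom X; have h' := Delta1l_hom Y; have h1 := fmap_hom H hf.
by rewrite /convl; diag (esym n).
Qed.

Lemma convr_nat x f X Y : hom x (H one) one -> hom f X Y ->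
  fmap H f ∘ convr x X = convr x Y ∘ fmap H f.
Proof.
move=> hx hf; have n := Delta_nat (bm_oplax H) hf (idm_hom one).
rewrite fmap_id (tmor1r hf) in n.
have h := Delta1r_hom X; have h' := Delta1r_hom Y; have h1 := fmap_hom H hf.
by rewrite /convr; diag (esym n).
Qed.

(** Left winding reverses the order of functionals: the map applied first consumes the leftmost
    factor. Hence [b' ⊗ b = 1] is what makes [convl] of [b] after [convl] of [b'] trivial. *)
Lemma convl_comp x y X : hom x (H one) one -> hom y (H one) one ->
  convl x X ∘ convl y X = convl ((y ⊠ x) ∘ Delta H one one) X.
Proof.
move=> hx hy; have n := DeltaA (bm_oplax H) one one X; rewrite !tob1l in n.
have h := Delta1l_hom X; have h' := Delta1l_hom one.
by rewrite /convl; diag n.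
Qed.

Lemma convrl x y X : hom x (H one) one -> hom y (H one) one ->
  convr y X ∘ convl x X =
  (x ⊠ idm (H X) ⊠ y) ∘ ((Delta H one X ⊠ idm (H one)) ∘ Delta H (one ⊗ X) one).
Proof.
move=> hx hy; have h := Delta1l_hom X; have h' := Delta1r_hom X.
have n := DeltaA (bm_oplax H) one X one; rewrite tob1l tob1r in n.
rewrite /convl /convr tob1l.
by diag n.
Qed.

Lemma convl_eps X : convl (eps H) X = idm (H X).
Proof. exact: Delta_epsl (bm_oplax H) X. Qed.
Lemma em_eq (f g : Mor (EM H)) (M N : Ob (EM H)) :
  hom f M N -> hom g M N -> em_arr f = em_arr g -> f = g.
Proof.
case: f g => [? ? f] [? ? g] [/= -> -> _ _] [/= -> -> _ _] e.
by rewrite e.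
Qed.

Local Notation mtens := (@tob (EMmon H)).

(** Tensoring with an invertible character does not change a free module. The underlying arrow is
    the winding map of the character, and the inverse comes from the winding map of the inverse
    character. This leads from [Q (F X)] to [Q (b ⊗ F X)], where the centralisers can be
    compared. *)
Lemma character_free_iso (b b' : Ob (EMmon H)) (X : Ob C) :
  carrier b = one -> carrier b' = one -> b ⊗ b' = one -> b' ⊗ b = one ->
  exists h : Mor (EMmon H),
    @mutually_inverse (EMmon H)
      (((free_counit b : Mor (EMmon H)) ⊠ idm (freeF H X : Ob (EMmon H))) ∘
      free_Delta H one X) h (freeF H X) (b ⊗ (freeF H X : Ob (EMmon H))).
Proof.
move=> eb eb' bb' b'b.
pose phi (a : Ob (EMmon H)) : Mor (EMmon H) :=
  ((free_counit a : Mor (EMmon H)) ⊠ idm (freeF H X : Ob (EMmon H))) ∘ free_Delta H one X.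
have hphi (a : Ob (EMmon H)) : carrier a = one ->
    @hom (EMmon H) (phi a) (freeF H X) (a ⊗ (freeF H X : Ob (EMmon H))).
  move=> ea; have h1 := free_Delta_hom H one X; have h2 := free_counit_hom a.
  rewrite [forgetF H a]ea in h2; rewrite tob1l in h1.
  have h3 := idm_hom (freeF H X : Ob (EMmon H)).
  exact: (compm_hom h1 (@tmor_hom (EMmon H) _ _ _ _ _ _ h2 h3)).
have phiE (a : Ob (EMmon H)) : carrier a = one -> em_arr (phi a) = convl (act a) X by [].
have act1 (a : Ob (EMmon H)) : carrier a = one -> hom (act a) (H one) one.
  by move=> ea; have h := act_hom a; rewrite ea in h.
have comp (a a' : Ob (EMmon H)) : carrier a = one -> carrier a' = one -> a' ⊗ a = one ->
    em_arr (phi a) ∘ em_arr (phi a') = idm (H X).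
  move=> ea ea' aa'; rewrite !phiE // (convl_comp _ (act1 _ ea) (act1 _ ea')).
  have <- : eps H = (act a' ⊠ act a) ∘ Delta H one one.
    by rewrite -{2}ea -{1}ea' -[eps H]/(act (@one (EMmon H))) -aa'.
  exact: convl_eps.
have hpsi : @hom (EMmon H) (idm b ⊠ phi b') (b ⊗ (freeF H X : Ob (EMmon H))) (freeF H X).
  have h := tmor_hom (idm_hom b) (hphi b' eb').
  by rewrite (tobA b b') bb' tob1l in h.
have psiE : em_arr (idm b ⊠ phi b') = em_arr (phi b').
  rewrite -[LHS]/(idm (carrier b) ⊠ em_arr (phi b')) eb.
  exact: tmor1l (forgetF_hom (hphi b' eb')).
exists (idm b ⊠ phi b'); split; [exact: hphi | exact: hpsi | |].
  apply: (em_eq (compm_hom (hphi b eb) hpsi) (idm_hom _)).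
  by rewrite -[LHS]/(em_arr (idm b ⊠ phi b') ∘ em_arr (phi b)) psiE comp.
apply: (em_eq (compm_hom hpsi (hphi b eb)) (idm_hom _)).
rewrite -[LHS]/(em_arr (phi b) ∘ em_arr (idm b ⊠ phi b')) psiE comp //.
by rewrite /= eb tob1l.
Qed.

End Convolution.

Lemma mutually_inverse_comp (C : category) (f f' g g' : Mor C) X Y W :
  mutually_inverse f f' X Y -> mutually_inverse g g' Y W ->
  mutually_inverse (g ∘ f) (f' ∘ g') X W.
Proof.
case=> hf hf' ff' f'f [hg hg' gg' g'g].
split; [exact: compm_hom hf hg | exact: compm_hom hg' hf' | |].
- by rewrite -(compmA (compm_hom hf hg) hg' hf') (compmA hf hg hg') gg' (compm_idl hf).
- rewrite -(compmA (compm_hom hg' hf') hf hg) (compmA hg' hf' hf) f'f.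
  by rewrite (compm_idl hg').
Qed.

Lemma mutually_inverse_fmap (C D : category) (F : functor C D) (f g : Mor C) X Y :
  mutually_inverse f g X Y -> mutually_inverse (fmap F f) (fmap F g) (F X) (F Y).
Proof.
case=> hf hg gf fg; split; try exact: fmap_hom.
- by rewrite -(fmap_comp F hf hg) gf fmap_id.
- by rewrite -(fmap_comp F hg hf) fg fmap_id.
Qed.

(** Splits the morphism [Q(H) -> D(H)] into Q of the isomorphism [F X ≅ b ⊗ F X] followed by the
    comparison of centralisers. *)
Lemma coact_slide (D : monoidal_category) (Z : bimonad D) (Q : comodule_monad Z)
    (r e a : Mor D) (A E G b : Ob D) :
  hom r (Q b) b -> hom e A b -> hom a E (A ⊗ G) ->
  ((r ∘ fmap Q e) ⊠ idm (Z G)) ∘ (coact Q A G ∘ fmap Q a) =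
  ((r ⊠ idm (Z G)) ∘ coact Q b G) ∘ fmap Q ((e ⊠ idm G) ∘ a).
Proof.
move=> hr he ha; rewrite (fmap_comp Q ha (tmor_hom he (idm_hom G))).
have n := coact_nat Q he (idm_hom G); rewrite fmap_id in n.
have h1 := fmap_hom Q he; have h2 := fmap_hom Q ha.
have h3 := fmap_hom Q (tmor_hom he (idm_hom G)).
by diag (esym n).
Qed.

(** Here [b'] is a strict inverse of [b], so the four arrows exhibiting invertibility are identities
    of the unit, and the hypothesis on [k] becomes the defining equation of the coaction. *)
Lemma twisted_comodule_comparison (E : rigid_category) (T Q Z : functor E E)
    (xi zeta : Ob E -> Ob E -> Mor E) (b b' P : Ob E) (r d : Mor E) (t : Ob E -> Mor E) :
  let s Y := (idm (T Y) ⊠ r) ∘ cent_chi T xi b Y in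
  is_centraliser T Q xi -> is_centraliser (idF E) Z zeta ->
  b ⊗ b' = one -> b' ⊗ b = one -> hom r (Q b) b ->
  hom d (Q (b ⊗ P)) (Q b ⊗ Z P) ->
  (forall Y, (idm (T Y) ⊠ d) ∘ cent_chi T xi (b ⊗ P) Y =
     (cent_chi T xi b Y ⊠ idm (Z P)) ∘ (idm b ⊠ cent_chi (idF E) zeta P Y)) ->
  (forall Y, mutually_inverse (s Y) (t Y) (b ⊗ Y) (T Y ⊗ b)) ->
  exists l, mutually_inverse ((r ⊠ idm (Z P)) ∘ d) l (Q (b ⊗ P)) (b ⊗ Z P).
Proof.
move=> s cQ cZ bb' b'b hr hd dxi st.
have i1 := idm_hom (one : Ob E); have i2 : idm one ∘ idm one = idm (one : Ob E).
  exact: compm_idl i1.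
have hxi := cent_chi_hom cQ.
have hchi X Y : hom (cent_chi (idF E) zeta X Y) (X ⊗ Y) (Y ⊗ Z X) := cent_chi_hom cZ X Y.
apply: (@comparison_iso E T Q Z xi zeta cQ cZ b b' (idm one) (idm one) (idm one) (idm one)
  s t _ _ _ _ _ _ _ _ st); rewrite ?bb' ?b'b //.
- by rewrite (tmor1l (idm_hom b)) (tmor1r (idm_hom b)).
- move=> f Y Y' hf; have n := cent_chi_natr cQ b hf.
  have h1 := hxi b Y; have h2 := hxi b Y'; have h3 := fmap_hom T hf.
  by rewrite /s; diag n.
- by homs.
move=> Y; have h1 := hxi b Y; have h2 := hxi (b ⊗ P) Y; have h3 := hchi P Y.
by rewrite /s; diag (dxi Y).
Qed.

(** * Lifts of the unit, isomorphisms of doubles and half braidings *)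

Section UnitLifts.
Context (C : rigid_category) (H : hopf_monad C).
Context (ZH : centraliser H) (QH : centraliser (twisted_fun H)).
Context (Z : central_bimonad ZH) (Q : twisted_comodule_monad Z QH).
Local Notation VH := (EMrigid H).
Local Notation AH := (anti_drinfeld_double Q).
Local Notation DH := (drinfeld_double Z).

Lemma unit_lifts_iso :
  (exists M : module AH, carrier M = one) -> comodule_monads_iso AH (self_comodule DH).
Proof.
case=> M eM.
have [b [r [eb hr rr re tE]]] := module_of_cross_module (tc_lift Q) M.
have t_hom := act_hom M; have t_mu := act_mu M; have t_eta := act_eta M.
rewrite eM in eb t_hom t_mu t_eta.
have fP := @unit_module_morphismP _ DH AH (act M) t_hom t_mu t_eta.
set f := unit_module_morphism _ _ in fP.
(* Inverses may be found object by object: choice assembles them, and the inverse of a morphism of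
   comodule monads is again one. *)
suff inv X : exists g, mutually_inverse (f X) g (AH X) (DH X).
  have [g fg] := functional_choice _ inv.
  by exists f, g; split=> //; apply: comodule_monad_morphism_inv fP fg.
have [b' [eb' _ bb' b'b]] := character_inverse eb.
have hb : half_braiding (ddual VH) (ddual_Delta VH) (ddual_eps VH) b
    (fun Y => (idm (ddual VH Y) ⊠ r) ∘ cent_chi (ddual VH) (tc_xi Q) b Y).
  exact (@half_braiding_of_module VH (ddual VH) (ddual_Delta VH) (ddual_eps VH) Q (tc_xi Q)
    (@ddual_Delta_hom VH) (ddual_eps_hom VH) (tc_monad Q) b r hr rr re).
have [t st] := functional_choice _ (half_braiding_inv hb).
have [cQ _ _] := tc_monad Q; have [cZ _ _] := cb_monad Z.
pose FX : Ob VH := freeF H X.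
have [l kl] := @twisted_comodule_comparison VH (ddual VH) Q Z (tc_xi Q) (cb_zeta Z) b b' FX
  r (coact Q b FX) t cQ cZ bb' b'b hr (coact_hom Q b FX) (tc_coact Q b FX) st.
have [h' hh] := character_free_iso X eb eb' bb' b'b.
have inv := mutually_inverse_comp (mutually_inverse_fmap Q hh) kl.
exists (em_arr (@compm VH (fmap Q h') l)).
have hcX : carrier (@tob VH b (Z FX)) = DH X by rewrite /= eb tob1l.
have key := mutually_inverse_fmap (forgetF H) inv.
rewrite [X in mutually_inverse _ _ _ X]hcX in key.
have he : @hom VH (free_counit b) (freeF H one) b.
  by have h0 := free_counit_hom b; rewrite [forgetF H b]eb in h0.
have slide := @coact_slide VH Z Q _ _ _ _ _ _ _ hr he (free_Delta_hom H one X).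
have fE : f X = em_arr (@compm VH (@compm VH (@tmor VH r (idm (Z FX))) (coact Q b FX))
     (fmap Q (@compm VH (@tmor VH (free_counit b) (idm FX)) (free_Delta H one X)))).
  by rewrite -slide /f /unit_module_morphism tE.
by rewrite fE.
Qed.

Lemma unit_lifts_half_braiding :
  (exists M : module AH, carrier M = one) <->
  exists (b : Ob VH) (s : Ob VH -> Mor VH), carrier b = one /\
    half_braiding (ddual VH) (ddual_Delta VH) (ddual_eps VH) b s.
Proof.
split=> [[M eM]|[b [s [eb hb]]]].
  have [b [r [eb hr rr re _]]] := module_of_cross_module (tc_lift Q) M.
  exists b, (fun Y => (idm (ddual VH Y) ⊠ r) ∘ cent_chi (ddual VH) (tc_xi Q) b Y).
  split; first by rewrite eb.
  exact (@half_braiding_of_module VH (ddual VH) (ddual_Delta VH) (ddual_eps VH) Q (tc_xi Q)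
    (@ddual_Delta_hom VH) (ddual_eps_hom VH) (tc_monad Q) b r hr rr re).
have [r [hr rr re _]] := @module_of_half_braiding VH (ddual VH) (ddual_Delta VH)
  (ddual_eps VH) Q (tc_xi Q) (@ddual_Delta_hom VH) (ddual_eps_hom VH) (tc_monad Q) b s hb.
have [M eM] := cross_module_of_module hr rr re.
by exists M; rewrite eM.
Qed.
End UnitLifts.

(** * Pivotal structures and pairs in involution *)

Section PivotalAntipode.
Context (C : rigid_category) (H : hopf_monad C) (phi : pivotal C).
Local Notation "X ^v" := (ld (rld C) X) (at level 30, format "X ^v").
Local Notation VH := (EMrigid H).
Local Notation dm M := (ld (hld H) M).
Local Notation piv := (piv phi).
Local Notation piv_inv := (piv_inv phi).

Lemma piv_hom X : hom (piv X) X (X^v^v). Proof. by case: (pivK phi X). Qed.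
Lemma piv_inv_hom X : hom (piv_inv X) (X^v^v) X. Proof. by case: (pivK phi X). Qed.
Lemma pivVp X : piv_inv X ∘ piv X = idm X. Proof. by case: (pivK phi X). Qed.
Lemma pivpV X : piv X ∘ piv_inv X = idm (X^v^v). Proof. by case: (pivK phi X). Qed.

Lemma piv_sq f X Y : hom f X Y -> dual (dual f) ∘ piv X = piv Y ∘ f.
Proof. exact: (nat_sq (piv_nat phi)). Qed.

Lemma act_ddual_hom (M : Ob VH) :
  hom (act (ddual VH M)) (H ((carrier M)^v^v)) ((carrier M)^v^v).
Proof. by rewrite -ddual_carrier; apply: act_hom. Qed.

Lemma act_ddual_linear (f : Mor C) (M N : Ob VH) :
  hom f (carrier M) (carrier N) -> f ∘ act M = act N ∘ fmap H f ->
  dual (dual f) ∘ act (ddual VH M) = act (ddual VH N) ∘ fmap H (dual (dual f)).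
Proof.
move=> hf lf; have l := act_dual_linear hf lf.
have h : hom (dual f) (carrier (dm N)) (carrier (dm M)).
  by rewrite !hld_ob; apply: dual_hom.
exact: act_dual_linear h l.
Qed.

(* The square of the antipode, expressed by the double duals of free modules. *)
Definition ssq (X : Ob C) : Mor C :=
  piv_inv (H X) ∘ (act (ddual VH (freeF H X)) ∘ fmap H (piv (H X) ∘ eta H X)).

Lemma ssq_hom X : hom (ssq X) (H X) (H X).
Proof.
have h1 := act_ddual_hom (freeF H X); have h2 := piv_hom (H X).
by have h3 := piv_inv_hom (H X); have h4 := eta_hom H X; rewrite /ssq; homs.
Qed.

(** The pivotal structure is H-linear to [M^vv] not from [M] but from [M] with its action twisted by
    the square of the antipode. This governs all later uses of [ssq]. *)
Lemma piv_act (M : Ob VH) : let X := carrier M in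
  piv X ∘ (act M ∘ ssq X) = act (ddual VH M) ∘ fmap H (piv X).
Proof.
move=> X; have ha : hom (act M) (H X) X := act_hom M.
have l := @act_ddual_linear (act M) (freeF H X) M ha (esym (act_mu M)).
have hE := eta_hom H X; have h1 := act_ddual_hom (freeF H X).
have h2 := piv_hom (H X); have h3 := piv_inv_hom (H X); have h4 := piv_hom X.
have h5 := act_ddual_hom M; have hd := ddual_hom ha.
rewrite -/X in h5; rewrite /ssq.
have -> : piv X ∘ (act M ∘ (piv_inv (H X) ∘ (act (ddual VH (freeF H X)) ∘
    fmap H (piv (H X) ∘ eta H X)))) =
  (dual (dual (act M)) ∘ act (ddual VH (freeF H X))) ∘ fmap H (piv (H X) ∘ eta H X).
  by have h6 := fmap_hom H (compm_hom hE h2); diag (esym (piv_sq ha)), (pivpV (H X)).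
rewrite l -(compmA (fmap_hom H (compm_hom hE h2)) (fmap_hom H hd) h5).
rewrite -(fmap_comp H (compm_hom hE h2) hd) (compmA hE h2 hd) (piv_sq ha).
by rewrite -(compmA hE ha h4) act_eta (compm_idr h4).
Qed.

Lemma free_mor_linear f X Y : hom f X Y ->
  fmap H f ∘ act (freeF H X) = act (freeF H Y) ∘ fmap H (fmap H f).
Proof. exact: (nat_sq (mu_nat H)). Qed.

Lemma ssq_nat f X Y : hom f X Y -> fmap H f ∘ ssq X = ssq Y ∘ fmap H f.
Proof.
move=> hf; have hF := fmap_hom H hf.
have l := @act_ddual_linear (fmap H f) (freeF H X) (freeF H Y) hF (free_mor_linear hf).
have hE := eta_hom H X; have hE' := eta_hom H Y.
have h1 := act_ddual_hom (freeF H X); have h1' := act_ddual_hom (freeF H Y).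
have h2 := piv_hom (H X); have h3 := piv_inv_hom (H X).
have h2' := piv_hom (H Y); have h3' := piv_inv_hom (H Y); have hd := ddual_hom hF.
have hp := compm_hom hE h2; have hp' := compm_hom hE' h2'.
have h4 := fmap_hom H hp; have h4' := fmap_hom H hp'; have hdd := fmap_hom H hd.
have e : fmap H (dual (dual (fmap H f))) ∘ fmap H (piv (H X) ∘ eta H X) =
    fmap H (piv (H Y) ∘ eta H Y) ∘ fmap H f.
  rewrite -(fmap_comp H hp hd) -(fmap_comp H hf hp'); congr (fmap H _).
  by have n : fmap H f ∘ eta H X = eta H Y ∘ f := nat_sq (eta_nat H) hf;
     diag (piv_sq hF), n.
have n : fmap H f ∘ piv_inv (H X) = piv_inv (H Y) ∘ dual (dual (fmap H f)).
  have -> : fmap H f ∘ piv_inv (H X) =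
      piv_inv (H Y) ∘ (piv (H Y) ∘ fmap H f) ∘ piv_inv (H X) by diag (pivVp (H Y)).
  by rewrite -(piv_sq hF); diag (pivpV (H X)).
by rewrite /ssq; diag n, l, e.
Qed.

(* [antipode_square] does not depend on the choice of a left antipode. *)
Lemma antipode_squareE s X : left_antipode H s -> antipode_square H phi s X = ssq X.
Proof.
case=> hs ns sE; rewrite /antipode_square /ssq; congr (_ ∘ _).
have hE := eta_hom H X; have hm := mu_hom H X; have hHE := fmap_hom H hE.
have h2 := piv_hom (H X); have h3 := piv_hom X.
have a1 : act (dm (freeF H X)) = s (H X) ∘ fmap H (dual (mu H X)) := sE (freeF H X).
have a2 := sE (dm (freeF H X)); rewrite hld_ob in a2.
rewrite /= a2 a1.
have d1 := dual_hom hE; have d2 := dual_hom hm; have d3 := dual_hom hHE.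
have h4 := fmap_hom H d2; have h5 := hs X; have h6 := hs (H X); have h7 := fmap_hom H d3.
have h8 := compm_hom h4 h6; have h9 := dual_hom h8.
have hp := compm_hom hE h2; have h10 := hs ((H X)^v).
have h11 := fmap_hom H h9; have h12 := fmap_hom H hp.
have -> : s (ld (rld C) (carrier (freeF H X))) ∘ fmap H (dual (s (H X) ∘ fmap H (dual (mu H X)))) ∘
    fmap H (piv (H X) ∘ eta H X) = s ((H X)^v) ∘
    (fmap H (dual (s (H X) ∘ fmap H (dual (mu H X)))) ∘ fmap H (piv (H X) ∘ eta H X)).
  by rewrite (compmA h12 h11 h10).
congr (_ ∘ _); rewrite -(fmap_comp H hp h9) -(fmap_comp H h3 (dual_hom h5)).
congr (fmap H _); rewrite -(piv_sq hE).
have hdd := ddual_hom hE.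
rewrite (compmA h3 hdd h9) -(dual_comp h8 d1); congr (dual _ ∘ _).
rewrite (compmA h4 h6 d1) -(ns _ _ _ hE).
have -> : s X ∘ fmap H (dual (fmap H (eta H X))) ∘ fmap H (dual (mu H X)) =
    s X ∘ (fmap H (dual (fmap H (eta H X))) ∘ fmap H (dual (mu H X))) by diag.
rewrite -(fmap_comp H d2 d3) -(dual_comp hHE hm) mu_etar dual_id fmap_id.
by rewrite (compm_idr h5).
Qed.

(** The formula is forced: evaluate the defining property at a free module and use naturality along
    [eta H X]. *)
Lemma left_antipode_ex : exists s, left_antipode H s.
Proof.
have hd X := dual_hom (eta_hom H X).
have ha X : hom (act (dm (freeF H X))) (H ((H X)^v)) ((H X)^v) := act_ld_hom (freeF H X).
exists (fun X => dual (eta H X) ∘ act (dm (freeF H X))); split.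
- by move=> X; exact: compm_hom (ha X) (hd X).
- move=> f X Y hf; have hF := fmap_hom H hf; have dF := dual_hom hF.
  have l := @act_dual_linear C H (fmap H f) (freeF H X) (freeF H Y) hF (free_mor_linear hf).
  rewrite -(compmA (fmap_hom H dF) (ha X) (hd X)) -l.
  rewrite (compmA (ha Y) dF (hd X)) -(dual_comp (eta_hom H X) hF).
  rewrite (nat_sq (eta_nat H) hf) (dual_comp hf (eta_hom H Y)).
  by rewrite (compmA (ha Y) (hd Y) (dual_hom hf)).
move=> M; have hM := act_hom M; have dM := dual_hom hM.
have l := @act_dual_linear C H (act M) (freeF H (carrier M)) M hM (esym (act_mu M)).
rewrite -(compmA (fmap_hom H dM) (ha _) (hd _)) -l.
have h := act_ld_hom M.
rewrite (compmA h dM (hd _)) -(dual_comp (eta_hom H _) hM) act_eta dual_id.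
by rewrite (compm_idl h).
Qed.

Local Notation mtens := (@tob (EMmon H)).

(** Twisting by [ssq] is compatible with tensor products, because φ is monoidal and [ddual_Delta] is
    H-linear. *)
Lemma act_tens_ssq (M N : Ob VH) : let X := carrier M in let Y := carrier N in
  act (mtens M N) ∘ ssq (X ⊗ Y) =
  ((act M ∘ ssq X) ⊠ (act N ∘ ssq Y)) ∘ Delta H X Y.
Proof.
move=> X Y; have hM : hom (act M) (H X) X := act_hom M.
have hN : hom (act N) (H Y) Y := act_hom N.
have hMN : hom (act (mtens M N)) (H (X ⊗ Y)) (X ⊗ Y) := act_hom (mtens M N).
have p1 := piv_hom X; have p2 := piv_hom Y; have p3 := piv_hom (X ⊗ Y).
have q1 := piv_inv_hom X; have q2 := piv_inv_hom Y.
have s1 := ssq_hom X; have s2 := ssq_hom Y; have s3 := ssq_hom (X ⊗ Y).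
have d1 : hom (act (ddual VH M)) (H (X^v^v)) (X^v^v) := act_ddual_hom M.
have d2 : hom (act (ddual VH N)) (H (Y^v^v)) (Y^v^v) := act_ddual_hom N.
have d3 : hom (act (ddual VH (mtens M N))) (H ((X ⊗ Y)^v^v)) ((X ⊗ Y)^v^v).
  exact: act_ddual_hom (mtens M N).
have hD := bDelta_hom H X Y; have hD' := bDelta_hom H (X^v^v) (Y^v^v).
have hT := ddual_Delta_hom X Y; have pt := piv_tens phi X Y.
have lT : ddual_Delta C X Y ∘ act (ddual VH (mtens M N)) =
    ((act (ddual VH M) ⊠ act (ddual VH N)) ∘ Delta H (X^v^v) (Y^v^v)) ∘
      fmap H (ddual_Delta C X Y).
  have [_ _ _] := ddual_Delta_hom (C := VH) M N.
  by rewrite em_ddual_Delta /= !hld_ob.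
have e1 : piv X ∘ (act M ∘ ssq X) = act (ddual VH M) ∘ fmap H (piv X) := piv_act M.
have e2 : piv Y ∘ (act N ∘ ssq Y) = act (ddual VH N) ∘ fmap H (piv Y) := piv_act N.
have e3 : piv (X ⊗ Y) ∘ (act (mtens M N) ∘ ssq (X ⊗ Y)) =
    act (ddual VH (mtens M N)) ∘ fmap H (piv (X ⊗ Y)) := piv_act (mtens M N).
have n := Delta_nat (bm_oplax H) p1 p2.
have e4 : fmap H (ddual_Delta C X Y) ∘ fmap H (piv (X ⊗ Y)) = fmap H (piv X ⊠ piv Y).
  by rewrite -(fmap_comp H p3 hT) pt.
have h5 := fmap_hom H (tmor_hom p1 p2); have h6 := fmap_hom H p1; have h7 := fmap_hom H p2.
have h8 := fmap_hom H hT; have h9 := fmap_hom H p3.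
have -> : act (mtens M N) ∘ ssq (X ⊗ Y) = (piv_inv X ⊠ piv_inv Y) ∘
    ((piv X ⊠ piv Y) ∘ (act (mtens M N) ∘ ssq (X ⊗ Y))).
  by diag (pivVp X), (pivVp Y).
have -> : (piv X ⊠ piv Y) ∘ (act (mtens M N) ∘ ssq (X ⊗ Y)) =
    ((piv X ∘ (act M ∘ ssq X)) ⊠ (piv Y ∘ (act N ∘ ssq Y))) ∘ Delta H X Y.
  have -> : (piv X ⊠ piv Y) ∘ (act (mtens M N) ∘ ssq (X ⊗ Y)) =
    ddual_Delta C X Y ∘ (piv (X ⊗ Y) ∘ (act (mtens M N) ∘ ssq (X ⊗ Y))) by diag (esym pt).
  by rewrite e1 e2 e3; diag lT, e4, (esym n).
by diag (pivVp X), (pivVp Y).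
Qed.

Lemma act_character (b : Ob VH) : carrier b = one -> hom (act b) (H one) one.
Proof. by move=> eb; have h := act_hom b; rewrite eb in h. Qed.

(** Dualising a character inverts it, so the double dual gives [b] back: [ddual_eps] is linear from
    [b^vv] to [b]. Since it is a retraction of φ at the unit, the twist in [piv_act] disappears. *)
Lemma character_ssq (b : Ob VH) : carrier b = one -> act b ∘ ssq one = act b.
Proof.
move=> eb; have [b' [eb' ab' bb' b'b]] := character_inverse eb.
have [b'' [_ ab'' b'b'' _]] := character_inverse eb'.
have eb'' : b'' = b.
  rewrite -[b''](tob1l (m := EMmon H)) -bb' -(tobA (m := EMmon H)) b'b''.
  exact: (tob1r (m := EMmon H)).
rewrite eb'' in ab''.
have hb := act_character eb; have hb' := act_character eb'.
have hc : hom (coev (rld C) one) one ((one : Ob C)^v) by homs.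
have he : hom (ev (rld C) one) ((one : Ob C)^v) one by homs.
have ec := ev1_coev1 C; have ce := coev1_ev1 C.
have x := act_ld_hom b; have x' := act_ld_hom b'; rewrite eb in x; rewrite eb' in x'.
have hHc := fmap_hom H hc; have hHe := fmap_hom H he.
have l : dual (coev (rld C) one) ∘ act (dm (dm b)) =
    act (dm b') ∘ fmap H (dual (coev (rld C) one)).
  apply: act_dual_linear; first by rewrite hld_ob eb eb'.
  by rewrite ab' /dual_character_act; diag ce.
have p := piv_hom one; have pa := piv_act b; rewrite /= eb in pa.
have d := act_ddual_hom b; rewrite /= eb in d; have s1 := ssq_hom one.
have po : ddual_eps C ∘ piv one = idm one := piv_one phi.
have hE := ddual_eps_hom C; have hd := dual_hom hc.
have hp := fmap_hom H p; have hHE := fmap_hom H hE; have hHd := fmap_hom H hd.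
have e1 : ddual_eps C ∘ act (dm (dm b)) = act b ∘ fmap H (ddual_eps C).
  rewrite ab'' /dual_character_act /ddual_eps (fmap_comp H hd he).
  have ce' : fmap H (coev (rld C) one) ∘ fmap H (ev (rld C) one) = idm (H (one^v)).
    by rewrite -(fmap_comp H he hc) ce fmap_id.
  by diag l, ce'.
have -> : act b ∘ ssq one = ddual_eps C ∘ (piv one ∘ (act b ∘ ssq one)) by diag po.
rewrite pa.
have po' : fmap H (ddual_eps C) ∘ fmap H (piv one) = idm (H one).
  by rewrite -(fmap_comp H p hE) po fmap_id.
by diag e1, po'.
Qed.

Lemma act_tens_characterl (b M : Ob VH) : carrier b = one ->
  act (mtens b M) = act M ∘ convl H (act b) (carrier M).
Proof.
move=> eb; have hb := act_character eb; have hM := act_hom M.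
have h := Delta1l_hom H (carrier M); rewrite /= /convl eb.
by diag.
Qed.

Lemma act_tens_characterr (b M : Ob VH) : carrier b = one ->
  act (mtens M b) = act M ∘ convr H (act b) (carrier M).
Proof.
move=> eb; have hb := act_character eb; have hM := act_hom M.
have h := Delta1r_hom H (carrier M); rewrite /= /convr eb.
by diag.
Qed.

(** Module actions are jointly monic on natural endomorphisms of H: free modules suffice, since
    [w X] is recovered from [mu H X ∘ w (H X)] along the unit. *)
Lemma nat_act_inj (u v : Ob C -> Mor C) :
  (forall X, hom (u X) (H X) (H X)) -> (forall X, hom (v X) (H X) (H X)) ->
  (forall f X Y, hom f X Y -> fmap H f ∘ u X = u Y ∘ fmap H f) ->
  (forall f X Y, hom f X Y -> fmap H f ∘ v X = v Y ∘ fmap H f) ->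
  (forall M : Ob VH, act M ∘ u (carrier M) = act M ∘ v (carrier M)) ->
  forall X, u X = v X.
Proof.
move=> hu hv nu nv e X; have hE := eta_hom H X; have hHE := fmap_hom H hE.
have hm := mu_hom H X.
have uE w : hom (w X) (H X) (H X) -> hom (w (H X)) (H (H X)) (H (H X)) ->
    fmap H (eta H X) ∘ w X = w (H X) ∘ fmap H (eta H X) ->
    w X = (mu H X ∘ w (H X)) ∘ fmap H (eta H X).
  move=> h1 h2 n.
  have -> : w X = (mu H X ∘ fmap H (eta H X)) ∘ w X by rewrite mu_etar; diag.
  by diag n.
rewrite (uE u (hu _) (hu _) (nu _ _ _ hE)) (uE v (hv _) (hv _) (nv _ _ _ hE)).
by rewrite (e (freeF H X) : mu H X ∘ u (H X) = mu H X ∘ v (H X)).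
Qed.

(** On a module [M] both composites give the twisted action on [b ⊗ M], which [act_tens_ssq] splits
    and [character_ssq] simplifies. *)
Lemma convl_ssq (b : Ob VH) X : carrier b = one ->
  convl H (act b) X ∘ ssq X = ssq X ∘ convl H (act b) X.
Proof.
move=> eb; have hb := act_character eb.
have hc Y := convl_hom Y hb; have hs := ssq_hom.
apply: (nat_act_inj (u := fun X => convl H (act b) X ∘ ssq X)
                    (v := fun X => ssq X ∘ convl H (act b) X)) => {X}.
- by move=> X; exact: compm_hom (hs X) (hc X).
- by move=> X; exact: compm_hom (hc X) (hs X).
- move=> f X Y hf; have n1 := convl_nat hb hf; have n2 := ssq_nat hf.
  have h1 := hc X; have h2 := hc Y; have h3 := hs X; have h4 := hs Y.
  by have h5 := fmap_hom H hf; diag n1, n2.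
- move=> f X Y hf; have n1 := convl_nat hb hf; have n2 := ssq_nat hf.
  have h1 := hc X; have h2 := hc Y; have h3 := hs X; have h4 := hs Y.
  by have h5 := fmap_hom H hf; diag n1, n2.
move=> M; have e := act_tens_ssq b M; rewrite /= eb tob1l in e.
have e1 := act_tens_characterl M eb; rewrite /= eb in e1.
have hM := act_hom M; have h1 := hc (carrier M); have h2 := hs (carrier M).
have h3 := Delta1l_hom H (carrier M); have h4 := hs one.
have -> : act M ∘ (convl H (act b) (carrier M) ∘ ssq (carrier M)) =
   (act M ∘ convl H (act b) (carrier M)) ∘ ssq (carrier M) by diag.
rewrite -e1 e (character_ssq eb) /convl.
by diag.
Qed.

Lemma convr_ssq (b : Ob VH) X : carrier b = one ->
  convr H (act b) X ∘ ssq X = ssq X ∘ convr H (act b) X.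
Proof.
move=> eb; have hb := act_character eb.
have hc Y := convr_hom Y hb; have hs := ssq_hom.
apply: (nat_act_inj (u := fun X => convr H (act b) X ∘ ssq X)
                    (v := fun X => ssq X ∘ convr H (act b) X)) => {X}.
- by move=> X; exact: compm_hom (hs X) (hc X).
- by move=> X; exact: compm_hom (hc X) (hs X).
- move=> f X Y hf; have n1 := convr_nat hb hf; have n2 := ssq_nat hf.
  have h1 := hc X; have h2 := hc Y; have h3 := hs X; have h4 := hs Y.
  by have h5 := fmap_hom H hf; diag n1, n2.
- move=> f X Y hf; have n1 := convr_nat hb hf; have n2 := ssq_nat hf.
  have h1 := hc X; have h2 := hc Y; have h3 := hs X; have h4 := hs Y.
  by have h5 := fmap_hom H hf; diag n1, n2.
move=> M; have e := act_tens_ssq M b; rewrite /= eb tob1r in e.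
have e1 := act_tens_characterr M eb; rewrite /= eb in e1.
have hM := act_hom M; have h1 := hc (carrier M); have h2 := hs (carrier M).
have h3 := Delta1r_hom H (carrier M); have h4 := hs one.
have -> : act M ∘ (convr H (act b) (carrier M) ∘ ssq (carrier M)) =
   (act M ∘ convr H (act b) (carrier M)) ∘ ssq (carrier M) by diag.
rewrite -e1 e (character_ssq eb) /convr.
by diag.
Qed.

(* The action of H on M^vv ⊗ b, transported along the pivotal structure. *)
Lemma act_ddual_character (b M : Ob VH) : carrier b = one ->
  act (mtens (ddual VH M) b) ∘ fmap H (piv (carrier M)) =
  piv (carrier M) ∘ (act M ∘ (ssq (carrier M) ∘ convr H (act b) (carrier M))).
Proof.
move=> eb; set X := carrier M; have hb := act_character eb.
have p := piv_hom X; have h1 := ssq_hom X; have h2 := act_hom M.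
have h3 := act_ddual_hom M; rewrite -/X in h3 h2.
have e : piv X ∘ (act M ∘ ssq X) = act (ddual VH M) ∘ fmap H (piv X) := piv_act M.
have h4 := Delta1r_hom H X; have h5 := Delta1r_hom H (X^v^v); have h6 := fmap_hom H p.
have n := Delta_nat (bm_oplax H) p (idm_hom one); rewrite fmap_id (tmor1r p) in n.
rewrite (act_tens_characterr _ eb) /convr ddual_carrier -/X.
by diag (esym n), e.
Qed.

End PivotalAntipode.

(** * Group-likes, half braidings and pairs in involution *)

Section Involutions.
Context (C : rigid_category) (H : hopf_monad C) (phi : pivotal C).
Local Notation "X ^v" := (ld (rld C) X) (at level 30, format "X ^v").
Local Notation VH := (EMrigid H).
Local Notation piv := (piv phi).
Local Notation mtens := (@tob (EMmon H)).
Local Notation half_braided b s :=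
  (half_braiding (ddual VH) (ddual_Delta VH) (ddual_eps VH) b s).

(* Tannaka duality: monoidal natural endomorphisms of the forgetful functor are
   given by the action of group-likes. *)
Record monoidal_endo (u : Ob VH -> Mor C) : Prop := MonoidalEndo {
  me_hom : forall M, hom (u M) (carrier M) (carrier M);
  me_nat : forall f (M N : Ob VH), hom f M N -> em_arr f ∘ u M = u N ∘ em_arr f;
  me_tens : forall M N : Ob VH, u (mtens M N) = u M ⊠ u N;
  me_one : u (@one (EMmon H)) = idm one }.

Definition grouplike_of_endo (u : Ob VH -> Mor C) (X : Ob C) : Mor C :=
  u (freeF H X) ∘ eta H X.
Definition endo_of_grouplike (g : Ob C -> Mor C) (M : Ob VH) : Mor C :=
  act M ∘ g (carrier M).

Lemma grouplike_of_endoP u : monoidal_endo u -> grouplike H (grouplike_of_endo u).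
Proof.
case=> hu nu tu ou.
have hF X : hom (u (freeF H X)) (H X) (H X) := hu (freeF H X).
split; first split.
- by move=> X; have h := hF X; have h' := eta_hom H X; rewrite /grouplike_of_endo; homs.
- move=> f X Y hf; have h1 := hF X; have h2 := hF Y; have h3 := eta_hom H X.
  have h4 := eta_hom H Y; have h5 := fmap_hom H hf.
  have n : fmap H f ∘ u (freeF H X) = u (freeF H Y) ∘ fmap H f := nu _ _ _ (freeF_hom H hf).
  have n' : fmap H f ∘ eta H X = eta H Y ∘ f := nat_sq (eta_nat H) hf.
  by rewrite /grouplike_of_endo; diag n, n'.
- move=> X Y; have h1 := hF X; have h2 := hF Y; have h3 := hF (X ⊗ Y).
  have h4 := eta_hom H X; have h5 := eta_hom H Y; have h6 := eta_hom H (X ⊗ Y).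
  have hD := bDelta_hom H X Y.
  have n : Delta H X Y ∘ u (freeF H (X ⊗ Y)) =
      u (mtens (freeF H X) (freeF H Y)) ∘ Delta H X Y.
    exact: nu _ _ _ (free_Delta_hom H X Y).
  rewrite tu in n.
  by rewrite /grouplike_of_endo; diag n, (Delta_eta H X Y).
have h1 := hF one; have h2 := eta_hom H (one : Ob C); have h3 := beps_hom H.
have n : eps H ∘ u (freeF H one) = u (@one (EMmon H)) ∘ eps H := nu _ _ _ (free_eps_hom H).
rewrite ou in n.
by rewrite /grouplike_of_endo; diag n, (eps_eta H).
Qed.

Lemma endo_of_grouplikeP g : grouplike H g -> monoidal_endo (endo_of_grouplike g).
Proof.
case=> [[hg ng] tg og]; split.
- by move=> M; exact: compm_hom (hg _) (act_hom M).
- move=> f M N hf; have hf' := forgetF_hom hf; have [_ _ _ lf] := hf.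
  have h1 := hg (carrier M); have h2 := hg (carrier N); have h3 := fmap_hom H hf'.
  have n : fmap H (em_arr f) ∘ g (carrier M) = g (carrier N) ∘ em_arr f := ng _ _ _ hf'.
  rewrite /= in h1 h2.
  by have h4 := act_hom M; have h5 := act_hom N; rewrite /endo_of_grouplike; diag lf, n.
- move=> M N; have h1 := hg (carrier M); have h2 := hg (carrier N).
  have h3 := hg (carrier M ⊗ carrier N); have h4 := act_hom M; have h5 := act_hom N.
  rewrite /= in h1 h2 h3; have hD := bDelta_hom H (carrier M) (carrier N).
  by rewrite /endo_of_grouplike /=; diag (tg (carrier M) (carrier N)).
exact: og.
Qed.

Lemma endo_of_grouplike_of_endo u M : monoidal_endo u ->
  endo_of_grouplike (grouplike_of_endo u) M = u M.
Proof.
case=> hu nu _ _; rewrite /endo_of_grouplike /grouplike_of_endo.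
have n : act M ∘ u (freeF H (carrier M)) = u M ∘ act M := nu _ _ _ (free_counit_hom M).
have h1 := hu M; have h2 : hom (u (freeF H (carrier M))) (H (carrier M)) (H (carrier M)).
  exact: hu (freeF H (carrier M)).
by have h3 := act_hom M; have h4 := eta_hom H (carrier M); diag n, (act_eta M).
Qed.

Lemma endo_grouplike_mul g h M : grouplike H g -> grouplike H h ->
  endo_of_grouplike (grouplike_mul H g h) M =
  endo_of_grouplike g M ∘ endo_of_grouplike h M.
Proof.
case=> [[hg ng] _ _] [[hh nh] _ _].
have h1 := hg (carrier M); have h2 := hh (carrier M); have h3 := hg (H (carrier M)).
have h4 := act_hom M; have h5 := mu_hom H (carrier M); have h6 := fmap_hom H h4.
have n : fmap H (act M) ∘ g (H (carrier M)) = g (carrier M) ∘ act M := ng _ _ _ h4.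
rewrite /= in h1 h2 h3.
by rewrite /endo_of_grouplike /grouplike_mul; diag (esym (act_mu M)), n.
Qed.

Lemma convl_inverse (b b' : Ob VH) X : carrier b = one -> carrier b' = one ->
  mtens b' b = @one (EMmon H) ->
  convl H (act b) X ∘ convl H (act b') X = idm (H X).
Proof.
move=> eb eb' b'b; rewrite (convl_comp X (act_character eb) (act_character eb')).
have <- : eps H = (act b' ⊠ act b) ∘ Delta H one one.
  by rewrite -{2}eb -{1}eb' -[eps H]/(act (@one (EMmon H))) -b'b.
exact: convl_eps.
Qed.

(* Left: phi ∘ G is H-linear from b ⊗ M to M^vv ⊗ b, by [act_ddual_character]. *)
Lemma linear_iff_Ad (g h : Ob C -> Mor C) (b b' : Ob VH) :
  grouplike H g -> grouplike_inverse H g h ->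
  carrier b = one -> carrier b' = one ->
  mtens b b' = @one (EMmon H) -> mtens b' b = @one (EMmon H) ->
  (forall M : Ob VH, let X := carrier M in
     endo_of_grouplike g M ∘ (act M ∘ convl H (act b) X) =
     (act M ∘ (ssq H phi X ∘ convr H (act b) X)) ∘ fmap H (endo_of_grouplike g M)) <->
  (forall X, Ad_grouplike H g h X =
     (convr H (act b) X ∘ convl H (act b') X) ∘ ssq H phi X).
Proof.
move=> hg [hh gh hg1] eb eb' bb' b'b; set G := endo_of_grouplike g.
have G_hom := me_hom (endo_of_grouplikeP hg).
have [[gM gn] _ _] := hg; have [[hM hn] _ _] := hh.
have hb := act_character eb; have hb' := act_character eb'.
have l1 X := convl_hom X hb; have l2 X := convl_hom X hb'; have r1 X := convr_hom X hb.
have hs := ssq_hom H phi.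
have lb X := convl_ssq phi X eb; have lb' X := convl_ssq phi X eb'.
have rb X := convr_ssq phi X eb.
have lbb' X := convl_inverse X eb eb' b'b.
have lb'b X := convl_inverse X eb' eb bb'.
have {}gM X : hom (g X) X (H X) := gM X.
have {}hM X : hom (h X) X (H X) := hM X.
have hAd X : hom (Ad_grouplike H g h X) (H X) (H X).
  have h1 := gM (H X); have h2 := hM X; have h3 := mu_hom H X; have h4 := fmap_hom H h2.
  by rewrite /Ad_grouplike; homs.
split=> [lin X|ad M X].
  have h1 := gM (H X); have h2 := hM X; have h3 := mu_hom H X; have h4 := fmap_hom H h2.
  have h5 := eta_hom H X; have h6 := fmap_hom H h5; have h7 := compm_hom h1 h3.
  have h8 := fmap_hom H h7.
  have a1 := l1 X; have a2 := l1 (H X); have a3 := r1 X; have a4 := r1 (H X).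
  have a5 := hs X; have a6 := hs (H X); have a7 := l2 X; have a8 := hAd X.
  (* Linearity at the free module on [X]. Precomposition with [fmap H (h X)] turns the left side
     into [Ad_grouplike] and cancels [g] against [h] on the right. *)
  have e : (mu H X ∘ g (H X)) ∘ (mu H X ∘ convl H (act b) (H X)) =
      (mu H X ∘ (ssq H phi (H X) ∘ convr H (act b) (H X))) ∘ fmap H (mu H X ∘ g (H X)).
    exact: lin (freeF H X).
  have gh' : fmap H (mu H X ∘ g (H X)) ∘ fmap H (h X) = fmap H (eta H X).
    rewrite -(fmap_comp H h2 h7) -gh /grouplike_mul.
    by rewrite (compmA h2 h1 h3).
  have n1 := convl_nat hb h2; have n2 := convr_nat hb h5; have n3 := ssq_nat H phi h5.
  have key : Ad_grouplike H g h X ∘ convl H (act b) X = ssq H phi X ∘ convr H (act b) X.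
    have -> : Ad_grouplike H g h X ∘ convl H (act b) X =
       ((mu H X ∘ g (H X)) ∘ (mu H X ∘ convl H (act b) (H X))) ∘ fmap H (h X).
      by rewrite /Ad_grouplike; diag n1.
    rewrite e.
    by diag gh', (esym n2), (esym n3), (mu_etar H X).
  have -> : Ad_grouplike H g h X =
      (Ad_grouplike H g h X ∘ convl H (act b) X) ∘ convl H (act b') X by diag (lbb' X).
  by rewrite key; diag (lb' X), (rb X).
have h1 := gM (H X); have h2 := hM X; have h3 := mu_hom H X; have h4 := fmap_hom H h2.
have hm : hom (act M) (H X) X := act_hom M; have h5 := fmap_hom H hm; have h6 := gM X.
have hG : hom (G M) X X := G_hom M; have hHG := fmap_hom H hG.
have a1 := l1 X; have a3 := r1 X; have a5 := hs X; have a7 := l2 X; have a8 := hAd X.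
have key : Ad_grouplike H g h X ∘ convl H (act b) X = ssq H phi X ∘ convr H (act b) X.
  by rewrite ad; diag (esym (lb X)), (lb'b X), (rb X).
have n := convl_nat hb hG.
have n1 : fmap H (act M) ∘ g (H X) = g X ∘ act M := gn _ _ _ hm.
have am : act M ∘ fmap H (act M) = act M ∘ mu H X := act_mu M.
(* The inverse [h] acts on [M] as the inverse of [G M]; this restores the linearity equation from
   its conjugated form. *)
have inv : fmap H (act M) ∘ fmap H (h X) ∘ fmap H (G M) = idm (H X).
  have hhM := compm_hom h2 hm.
  rewrite -(fmap_comp H h2 hm) -(fmap_comp H hG hhM) -fmap_id; congr (fmap H _).
  rewrite -[act M ∘ h X]/(endo_of_grouplike h M) -(endo_grouplike_mul M hh hg).
  by rewrite /endo_of_grouplike hg1 act_eta.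
have -> : (act M ∘ (ssq H phi X ∘ convr H (act b) X)) ∘ fmap H (G M) =
    (act M ∘ (Ad_grouplike H g h X ∘ convl H (act b) X)) ∘ fmap H (G M) by rewrite key.
have e : act M ∘ Ad_grouplike H g h X = G M ∘ (act M ∘ (fmap H (act M) ∘ fmap H (h X))).
  by rewrite /Ad_grouplike /G /endo_of_grouplike -/X; diag (esym am), n1.
by diag e, (esym n), inv.
Qed.

Lemma dual_character_act_inverse (b b' : Ob VH) :
  carrier b = one -> carrier b' = one -> mtens b b' = @one (EMmon H) ->
  dual_character_act b = act b'.
Proof.
move=> eb eb' bb'; have [c [ec <- bc cb]] := character_inverse eb.
congr act; rewrite -[c](tob1r (m := EMmon H)) -bb' (tobA (m := EMmon H)) cb.
exact: (tob1l (m := EMmon H)).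
Qed.

(** The dual of [b'] is its inverse [b], which therefore acts on the right. This is where the
    inverse of the lifting character enters the pair. *)
Lemma Ad_characterE (b b' : Ob VH) X :
  carrier b = one -> carrier b' = one -> mtens b' b = @one (EMmon H) ->
  Ad_character b' X = convr H (act b) X ∘ convl H (act b') X.
Proof.
move=> eb eb' b'b; rewrite /Ad_character (dual_character_act_inverse eb' eb b'b).
by rewrite (convrl X (act_character eb') (act_character eb)).
Qed.

Lemma monoidal_endo_inv (u v : Ob VH -> Mor C) : monoidal_endo u ->
  (forall M, mutually_inverse (u M) (v M) (carrier M) (carrier M)) -> monoidal_endo v.
Proof.
case=> hu nu tu ou uv.
have hv M : hom (v M) (carrier M) (carrier M) by case: (uv M).
have vu M : v M ∘ u M = idm (carrier M) by case: (uv M).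
have uvK M : u M ∘ v M = idm (carrier M) by case: (uv M).
split=> //.
- move=> f M N hf; have hf' := forgetF_hom hf; have n := nu _ _ _ hf.
  have h1 := hu M; have h2 := hu N; have h3 := hv M; have h4 := hv N.
  have -> : em_arr f ∘ v M = v N ∘ (u N ∘ em_arr f) ∘ v M by diag (vu N).
  by rewrite -n; diag (uvK M).
- move=> M N; have h1 := hu M; have h2 := hu N; have h3 := hv M; have h4 := hv N.
  have h5 : hom (v (mtens M N)) (carrier M ⊗ carrier N) (carrier M ⊗ carrier N).
    exact: hv (mtens M N).
  have e := uvK (mtens M N); rewrite tu in e.
  have -> : v (mtens M N) = (v M ⊠ v N) ∘ ((u M ⊠ u N) ∘ v (mtens M N)).
    by diag (vu M), (vu N).
  by rewrite e /=; diag.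
have e := uvK (@one (EMmon H)); rewrite ou in e.
have h : hom (v (@one (EMmon H))) one one := hv (@one (EMmon H)).
by rewrite -[LHS](compm_idl h).
Qed.

(** Only the naturality and the monoidality of [s] are used here. Its H-linearity is the remaining
    information, and [linear_iff_Ad] converts it into the equation of the pair. *)
Lemma endo_of_half_braiding (b : Ob VH) s : carrier b = one -> half_braided b s ->
  monoidal_endo (fun M => piv_inv phi (carrier M) ∘ em_arr (s M)).
Proof.
move=> eb [hs ns ts os].
have sh M : hom (em_arr (s M)) (carrier M) ((carrier M)^v^v).
  by have := forgetF_hom (hs M); rewrite /= eb tob1l tob1r !hld_ob.
have p := piv_hom phi; have q := piv_inv_hom phi.
split.
- by move=> M; exact: compm_hom (sh M) (q _).
- move=> f M N hf; have hf' := forgetF_hom hf; have h1 := sh M; have h2 := sh N.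
  have hd := ddual_hom hf'.
  have n : dual (dual (em_arr f)) ∘ em_arr (s M) = em_arr (s N) ∘ em_arr f.
    have : (em_arr (@dual VH (@dual VH f)) ⊠ idm (carrier b)) ∘ em_arr (s M) =
        em_arr (s N) ∘ (idm (carrier b) ⊠ em_arr f).
      exact: (congr1 (@em_arr C H) (ns _ _ _ hf)).
    by rewrite (em_ddual_mor hf) eb (tmor1l hf') (tmor1r hd).
  have q1 := q (carrier M); have q2 := q (carrier N).
  have p1 := p (carrier M); have p2 := p (carrier N).
  have -> : em_arr f ∘ (piv_inv phi (carrier M) ∘ em_arr (s M)) =
      piv_inv phi (carrier N) ∘ (piv (carrier N) ∘ em_arr f) ∘
        (piv_inv phi (carrier M) ∘ em_arr (s M)) by diag (pivVp phi (carrier N)).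
  by rewrite -(piv_sq phi hf'); diag (pivpV phi (carrier M)), n.
- move=> M N; set X := carrier M; set Y := carrier N.
  have h1 : hom (em_arr (s M)) X (X^v^v) := sh M.
  have h2 : hom (em_arr (s N)) Y (Y^v^v) := sh N.
  have h3 : hom (em_arr (s (mtens M N))) (X ⊗ Y) ((X ⊗ Y)^v^v) := sh (mtens M N).
  have hT := ddual_Delta_hom X Y; have pt := piv_tens phi X Y.
  have p1 := p X; have p2 := p Y; have p3 := p (X ⊗ Y).
  have q1 := q X; have q2 := q Y; have q3 := q (X ⊗ Y).
  have e : ddual_Delta C X Y ∘ em_arr (s (mtens M N)) = em_arr (s M) ⊠ em_arr (s N).
    have : (em_arr (ddual_Delta VH M N) ⊠ idm (carrier b)) ∘ em_arr (s (mtens M N)) =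
        (idm (carrier (ddual VH M)) ⊠ em_arr (s N)) ∘ (em_arr (s M) ⊠ idm Y).
      exact: (congr1 (@em_arr C H) (ts M N)).
    by rewrite em_ddual_Delta ddual_carrier eb -/X -/Y (tmor1r hT) => ->; diag.
  have -> : piv_inv phi (X ⊗ Y) ∘ em_arr (s (mtens M N)) =
      (piv_inv phi X ⊠ piv_inv phi Y) ∘ ((piv X ⊠ piv Y) ∘
        (piv_inv phi (X ⊗ Y) ∘ em_arr (s (mtens M N)))).
    by diag (pivVp phi X), (pivVp phi Y).
  by rewrite -pt; diag (pivpV phi (X ⊗ Y)), e.
have e : ddual_eps C ∘ em_arr (s (@one (EMmon H))) = idm one.
  have : (em_arr (ddual_eps VH) ⊠ idm (carrier b)) ∘ em_arr (s (@one (EMmon H))) =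
      idm (carrier b) := congr1 (@em_arr C H) os.
  by rewrite em_ddual_eps eb (tmor1r (ddual_eps_hom C)).
have h : hom (em_arr (s (@one (EMmon H)))) one ((one : Ob C)^v^v) := sh (@one (EMmon H)).
have hE := ddual_eps_hom C; have p1 := p one; have q1 := q one.
have po : ddual_eps C ∘ piv one = idm one := piv_one phi.
have -> : piv_inv phi (carrier (@one (EMmon H))) ∘ em_arr (s (@one (EMmon H))) =
    (ddual_eps C ∘ piv one) ∘ (piv_inv phi one ∘ em_arr (s (@one (EMmon H)))).
  by rewrite po /=; diag.
rewrite -(compmA (compm_hom h q1) p1 hE) (compmA h q1 p1) pivpV (compm_idl h).
exact: e.
Qed.

Lemma involution_of_half_braiding (b : Ob VH) s : carrier b = one -> half_braided b s ->
  exists (g : Ob C -> Mor C) (b' : module H), pair_in_involution H phi g b'.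
Proof.
move=> eb hb; have [b' [eb' _ bb' b'b]] := character_inverse eb.
have hu := endo_of_half_braiding eb hb; set u := fun M => _ in hu.
have [t st] := functional_choice _ (half_braiding_inv hb).
have sh M : hom (em_arr (s M)) (carrier M) ((carrier M)^v^v).
  by have := forgetF_hom (hb_hom hb M); rewrite /= eb tob1l tob1r !hld_ob.
(* Invertibility of the half braiding supplies the inverse group-like that the adjoint action
   requires. *)
pose v M := em_arr (t M) ∘ piv (carrier M).
have uv M : mutually_inverse (u M) (v M) (carrier M) (carrier M).
  have /= := mutually_inverse_fmap (forgetF H) (st M).
  rewrite /= eb tob1l tob1r !hld_ob => st'.
  apply: (mutually_inverse_comp st').
  by case: (pivK phi (carrier M)) => h1 h2 h3 h4; split.
have hv := monoidal_endo_inv hu uv.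
pose g := grouplike_of_endo u; pose h := grouplike_of_endo v.
have hg : grouplike H g := grouplike_of_endoP hu.
have hh : grouplike H h := grouplike_of_endoP hv.
have mulE (x y : Ob VH -> Mor C) X : monoidal_endo x -> monoidal_endo y ->
    x (freeF H X) ∘ y (freeF H X) = idm (H X) ->
    grouplike_mul H (grouplike_of_endo x) (grouplike_of_endo y) X = eta H X.
  move=> hx hy xy; have [[h1 _] _ _] := grouplike_of_endoP hx.
  have [[h2 _] _ _] := grouplike_of_endoP hy.
  rewrite /grouplike_mul (compmA (h2 X) (h1 (H X)) (mu_hom H X)).
  have -> : mu H X ∘ grouplike_of_endo x (H X) = x (freeF H X).
    exact: (endo_of_grouplike_of_endo (freeF H X) hx).
  have h3 : hom (x (freeF H X)) (H X) (H X) := me_hom hx (freeF H X).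
  have h4 : hom (y (freeF H X)) (H X) (H X) := me_hom hy (freeF H X).
  rewrite /grouplike_of_endo (compmA (eta_hom H X) h4 h3) xy.
  exact: compm_idl (eta_hom H X).
have gh : grouplike_inverse H g h.
  split=> // X; apply: mulE => //; first by case: (uv (freeF H X)).
  by case: (uv (freeF H X)).
have [s0 hs0] := left_antipode_ex H.
exists g, b'; split => //; exists h, s0; split => // X.
rewrite (antipode_squareE phi X hs0) (Ad_characterE X eb eb' b'b).
move: X; apply/(linear_iff_Ad hg gh eb eb' bb' b'b) => M X; rewrite endo_of_grouplike_of_endo //.
have q := piv_inv_hom phi X; have p := piv_hom phi X.
have hs : hom (em_arr (s M)) X (X^v^v) := sh M.
have hM : hom (act M) (H X) X := act_hom M.
have hc := convl_hom X (act_character eb); have hr := convr_hom X (act_character eb).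
have hS := ssq_hom H phi X; have huM : hom (u M) X X := me_hom hu M.
have hHu := fmap_hom H huM.
have sE : em_arr (s M) = piv X ∘ u M by rewrite /u -/X; diag (pivpV phi X).
have l : em_arr (s M) ∘ (act M ∘ convl H (act b) X) =
    act (mtens (ddual VH M) b) ∘ fmap H (em_arr (s M)).
  by rewrite -(act_tens_characterl M eb); have [_ _ _ <-] := hb_hom hb M.
have -> : u M ∘ (act M ∘ convl H (act b) X) =
    piv_inv phi X ∘ (em_arr (s M) ∘ (act M ∘ convl H (act b) X)).
  by rewrite sE; diag (pivVp phi X).
have hdb : hom (act (mtens (ddual VH M) b)) (H (X^v^v)) (X^v^v).
  by have := act_hom (mtens (ddual VH M) b); rewrite /= eb tob1r !hld_ob.
rewrite l sE (fmap_comp H huM p) (compmA hHu (fmap_hom H p) hdb).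
by rewrite (act_ddual_character phi M eb) -/X; diag (pivVp phi X).
Qed.

Lemma half_braiding_of_involution g (b' : module H) : pair_in_involution H phi g b' ->
  exists (b : Ob VH) (s : Ob VH -> Mor VH), carrier b = one /\ half_braided b s.
Proof.
case=> hg eb' [h [s0 [gh hs0 ad]]]; rewrite /character in eb'.
have [b [eb _ b'b bb']] := character_inverse (eb' : carrier (b' : Ob VH) = one).
have lin : forall M : Ob VH, let X := carrier M in endo_of_grouplike g M ∘
     (act M ∘ convl H (act b) X) =
     (act M ∘ (ssq H phi X ∘ convr H (act b) X)) ∘ fmap H (endo_of_grouplike g M).
  apply/(linear_iff_Ad hg gh eb eb' bb' b'b) => X.
  by rewrite ad (antipode_squareE phi X hs0) (Ad_characterE X eb eb' b'b).
have [hG nG tG oG] := endo_of_grouplikeP hg.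
set G := endo_of_grouplike g in lin hG nG tG oG.
have p := piv_hom phi.
(* As [b] has the unit as carrier, φ after the action of [g] already has the underlying type of an
   arrow [b ⊗ M -> M^vv ⊗ b]; the equation of the pair supplies its linearity. *)
pose s (M : Ob VH) : Mor VH :=
  EmMor (mtens b M) (mtens (ddual VH M) b) (piv (carrier M) ∘ G M).
have hpG M : hom (piv (carrier M) ∘ G M) (carrier M) ((carrier M)^v^v).
  exact: compm_hom (hG M) (p _).
have hs M : hom (s M) (mtens b M) (mtens (ddual VH M) b).
  split=> //; first by rewrite /= eb tob1l tob1r !hld_ob; exact: hpG.
  rewrite [em_arr _]/=; set X := carrier M.
  have h1 : hom (G M) X X := hG M; have h2 := p X; have hM : hom (act M) (H X) X := act_hom M.
  have hdb : hom (act (mtens (ddual VH M) b)) (H (X^v^v)) (X^v^v).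
    by have := act_hom (mtens (ddual VH M) b); rewrite /= eb tob1r !hld_ob.
  have hc := convl_hom X (act_character eb); have hr := convr_hom X (act_character eb).
  have hS := ssq_hom H phi X; have hHG := fmap_hom H h1.
  rewrite (fmap_comp H h1 h2) (compmA hHG (fmap_hom H h2) hdb).
  rewrite (act_ddual_character phi M eb) (act_tens_characterl M eb) -/X.
  have e : G M ∘ (act M ∘ convl H (act b) X) =
     (act M ∘ (ssq H phi X ∘ convr H (act b) X)) ∘ fmap H (G M) := lin M.
  by diag e.
exists b, s; split=> //; split => //.
- move=> f M N hf; have hf' := forgetF_hom hf; have hd := ddual_hom hf'.
  have h1 := hG M; have h2 := hG N; have p1 := p (carrier M); have p2 := p (carrier N).
  have hdf : hom (fmap (ddual VH) f) (ddual VH M) (ddual VH N) := fmap_hom (ddual VH) hf.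
  apply: (em_eq (compm_hom (hs M) (tmor_hom hdf (idm_hom b)))
                (compm_hom (tmor_hom (idm_hom b) hf) (hs N))).
  rewrite -[LHS]/((em_arr (@dual VH (@dual VH f)) ⊠ idm (carrier b)) ∘
    (piv (carrier M) ∘ G M)) -[RHS]/((piv (carrier N) ∘ G N) ∘ (idm (carrier b) ⊠ em_arr f)).
  rewrite (em_ddual_mor hf) eb (tmor1r hd) (tmor1l hf').
  by diag (piv_sq phi hf'), (nG _ _ _ hf).
- move=> M N; set X := carrier M; set Y := carrier N.
  have t1 := tmor_hom (ddual_Delta_hom (C := VH) M N) (idm_hom b).
  have t2 := tmor_hom (hs M) (idm_hom N).
  have t3 := tmor_hom (idm_hom (ddual VH M)) (hs N).
  (* Module arrows record their source and target, so the bracketings must agree before underlying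
     arrows can be compared. *)
  rewrite !(tobA (m := EMmon H)) in t3; have k := hs (mtens M N).
  rewrite (tobA (m := EMmon H)) in k.
  apply: (em_eq (compm_hom k t1) (compm_hom t2 t3)).
  rewrite -[LHS]/((em_arr (ddual_Delta VH M N) ⊠ idm (carrier b)) ∘
    (piv (X ⊗ Y) ∘ G (mtens M N))) em_ddual_Delta -/X -/Y eb.
  rewrite tG -[RHS]/((idm (carrier (ddual VH M)) ⊠ (piv Y ∘ G N)) ∘ ((piv X ∘ G M) ⊠ idm Y)).
  rewrite ddual_carrier -/X.
  have h1 : hom (G M) X X := hG M; have h2 : hom (G N) Y Y := hG N.
  have p1 := p X; have p2 := p Y; have p3 := p (X ⊗ Y); have hT := ddual_Delta_hom X Y.
  by diag (piv_tens phi X Y).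
have t1 := tmor_hom (ddual_eps_hom VH) (idm_hom b); have k := hs (@one (EMmon H)).
rewrite (tob1r (m := EMmon H)) in k; rewrite [X in hom _ _ X](tob1l (m := EMmon H)) in t1.
apply: (em_eq (compm_hom k t1) (idm_hom b)).
rewrite -[LHS]/((em_arr (ddual_eps VH) ⊠ idm (carrier b)) ∘
  (piv one ∘ G (@one (EMmon H)))) em_ddual_eps oG /= eb.
have p1 := p one; have hE := ddual_eps_hom C.
have po : ddual_eps C ∘ piv one = idm one := piv_one phi.
by diag po.
Qed.

End Involutions.

Theorem theorem6p26 (V : rigid_category) (H : hopf_monad V)
    (ZH : centraliser H) (QH : centraliser (twisted_fun H))
    (Z : central_bimonad ZH) (Q : twisted_comodule_monad Z QH) :
  let DH := drinfeld_double Z in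
  let AH := anti_drinfeld_double Q in
  let unit_lifts := exists M : module AH, carrier M = one in
  let iso_comodule_monads := comodule_monads_iso AH (self_comodule DH) in
  let iso_monads := monads_iso AH DH in
  [/\ unit_lifts <-> iso_comodule_monads,
      iso_comodule_monads <-> iso_monads &
      forall phi : pivotal V,
        let involutive :=
          exists (g : Ob V -> Mor V) (b : module H), pair_in_involution H phi g b in
        [/\ unit_lifts <-> involutive,
            iso_comodule_monads <-> involutive &
            iso_monads <-> involutive]].
Proof.
move=> DH AH unit_lifts iso_comodule_monads iso_monads.
have i_ii : unit_lifts -> iso_comodule_monads by apply: unit_lifts_iso.
have ii_iii : iso_comodule_monads -> iso_monads.
  by case=> f [g [[mf _] [mg _] fg]]; exists f, g.
have iii_i : iso_monads -> unit_lifts.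
  by case=> f [g [mf _ _]]; apply: unit_module_of_monad_morphism mf.
split; [by split; auto | by split; auto |].
move=> phi involutive; have i_inv : unit_lifts <-> involutive.
  apply: (iff_trans (unit_lifts_half_braiding Q)); split=> [[b [s [eb hb]]]|[g [b gb]]].
    exact: involution_of_half_braiding eb hb.
  exact: half_braiding_of_involution gb.
by split; tauto.
Qed.
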